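(* The three-speed ballistic annihilation model undergoes a phase transition at $p_c=1/4$. More precisely, for every probability measure $m$ on $(0,\infty)$ and every $p\in[0,1]$, the probability $q=\mathbb P(0\leftarrow\bullet)$ that $0$ is reached by a particle, for the process started from particles on $(0,\infty)$, is given by $$q=\begin{cases}1 & \text{if } p\le \tfrac14,\\[2pt] \dfrac{1}{\sqrt p}-1 & \text{if } p>\tfrac14.\end{cases}$$
   Context: Model (half-line three-speed ballistic annihilation). Let $p\in[0,1]$ and let $m$ be a probability measure on $(0,\infty)$. Let $(x_n)_{n\ge1}$ be such that $x_1,x_2-x_1,x_3-x_2,\dots$ are i.i.d. with law $m$; let $(v_n)_{n\ge1}$ be i.i.d. with $\mathbb P(v_n=0)=p$, $\mathbb P(v_n=-1)=\mathbb P(v_n=+1)=\frac{1-p}2$; let $(s_n)_{n\ge1}$ (spins) be i.i.d. uniform on $\{-1,+1\}$; the three sequences are independent. Particle $\bullet_n$ starts at time $0$ at $x_n$ and moves at constant velocity $v_n$ until it is annihilated. When exactly two particles meet, both are annihilated and removed. When three particles meet (necessarily a static particle $\bullet_i$, a right-moving one and a left-moving one), the static particle and one of the two moving particles are annihilated, and the other moving particle continues unperturbed: the right-moving one survives if $s_i=+1$ and the left-moving one survives if $s_i=-1$. Since velocities are bounded and starting points have no accumulation point, this almost surely defines the evolution. $\{0\leftarrow\bullet\}$ is the event that some particle crosses location $0$ from the right, i.e. there is $n\ge1$ such that $v_n=-1$ and $\bullet_n$ is not annihilated when or before it reaches $0$. *)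

(* Defs.v *)
From HB Require Import structures.
From mathcomp Require Import all_boot all_order all_algebra.
From mathcomp Require Import all_classical all_reals all_analysis.
Export numFieldNormedType.Exports.

Set Implicit Arguments.
Unset Strict Implicit.
Unset Printing Implicit Defensive.

Import Order.TTheory GRing.Theory Num.Theory.
Local Open Scope classical_set_scope.
Local Open Scope ring_scope.

(** * Deterministic dynamics of three-speed ballistic annihilation

    Particles are numbered from 0.  Particle [n] has initial location [x n],
    velocity [v n] and spin [s n].  An evolution is encoded by its
    annihilation times: [d n : \bar R] is the time at which particle [n] is
    annihilated, with [d n = +oo] if this never happens. *)

Definition location (R : realType) (x v : nat -> R) (n : nat) (t : R) : R :=
  x n + v n * t.

(** [d n = t] is allowed: a particle annihilated at time [t] takes part in the
    collision at time [t]. *)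
Definition present (R : realType) (d : nat -> \bar R) (n : nat) (t : R) : Prop :=
  (t%:E <= d n)%E.

Definition meet (R : realType) (x v : nat -> R) (d : nat -> \bar R)
    (t : R) (i j : nat) : Prop :=
  [/\ i != j, present d i t, present d j t &
      location x v i t = location x v j t].

(** Particle [n] is the moving particle that goes through a triple collision at
    time [t]: it meets a static particle [i] and a particle [k] of opposite
    velocity, and the spin of [i] has the sign of the velocity of [n].  Since
    spins are nonzero, [v n = s i] forces [n] to be moving. *)
Definition survives_triple (R : realType) (x v s : nat -> R)
    (d : nat -> \bar R) (t : R) (n : nat) : Prop :=
  exists i k : nat,
    [/\ meet x v d t n i, meet x v d t n k, v i = 0, v k = - v n & v n = s i].

(** [d] lists the annihilation times of the evolution started from
    [(x, v, s)]: a particle is annihilated at time [t] exactly when, being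
    still present, it meets another one at time [t], unless it is the survivor
    of a triple collision. *)
Definition evolution (R : realType) (x v s : nat -> R)
    (d : nat -> \bar R) : Prop :=
  (forall n, (0 <= d n)%E) /\
  (forall n t, 0 <= t ->
     (d n = t%:E <->
      (exists j, meet x v d t n j) /\ ~ survives_triple x v s d t n)).

Definition gap (R : realType) (x : nat -> R) (n : nat) : R :=
  if n is k.+1 then x n - x k else x 0%N.

(** Configurations for which the evolution is defined: starting points in
    (0, oo), increasing and without accumulation point, velocities in
    {-1, 0, 1} and spins in {-1, 1}.  In the random model below this holds
    almost surely, but not necessarily everywhere. *)
Definition well_posed (R : realType) (x v s : nat -> R) : Prop :=
  [/\ forall n, 0 < gap x n,
      x @ \oo --> +oo,
      forall n, [\/ v n = -1, v n = 0 | v n = 1] &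
      forall n, s n = -1 \/ s n = 1].

(** A left-moving particle [n] is at [0] at time [x n]; it must not have been
    annihilated at or before that time. *)
Definition zero_reached (R : realType) (x v s : nat -> R) : Prop :=
  well_posed x v s /\
  exists d : nat -> \bar R,
    evolution x v s d /\ exists n : nat, v n = -1 /\ ((x n)%:E < d n)%E.

(** * Independence *)

Definition mutually_independent (R : realType) (dT : measure_display)
    (T : measurableType dT) (P : probability T R) (X : nat -> T -> R) : Prop :=
  forall (J : seq nat) (B : nat -> set R),
    uniq J -> (forall i, measurable (B i)) ->
    P (\bigcap_(i in [set` J]) (X i @^-1` B i)) =
    (\prod_(i <- J) P (X i @^-1` B i))%E.

Definition sigma_of (R : realType) (T : Type) (X : nat -> T -> R) : set_system T :=
  <<s \bigcup_n preimage_set_system setT (X n) measurable >>.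

Definition sequences_independent (R : realType) (dT : measure_display)
    (T : measurableType dT) (P : probability T R)
    (X Y Z : nat -> T -> R) : Prop :=
  forall A B C : set T, sigma_of X A -> sigma_of Y B -> sigma_of Z C ->
    P (A `&` B `&` C) = (P A * P B * P C)%E.

(** * The random model *)

(** The static velocity has probability [p], each of the two others
    [(1 - p) / 2]; [m] is the law of the interdistances. *)
Record ballistic_model (R : realType) (dT : measure_display)
    (T : measurableType dT) (P : probability T R)
    (m : probability (measurableTypeR R) R) (p : R)
    (x v s : nat -> {RV P >-> R}) : Prop := BallisticModel {
  gap_indep : mutually_independent P (fun n w => gap (x ^~ w) n) ;
  gap_law : forall n (B : set (measurableTypeR R)), measurable B ->
    P [set w | B (gap (x ^~ w) n)] = m B ;
  velocity_indep : mutually_independent P (fun n w => v n w) ;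
  velocity_law : forall n,
    [/\ P [set w | v n w = 0] = p%:E,
        P [set w | v n w = -1] = ((1 - p) / 2)%:E &
        P [set w | v n w = 1] = ((1 - p) / 2)%:E] ;
  spin_indep : mutually_independent P (fun n w => s n w) ;
  spin_law : forall n,
    P [set w | s n w = -1] = (2^-1)%:E /\ P [set w | s n w = 1] = (2^-1)%:E ;
  gap_velocity_spin_indep :
    sequences_independent P (fun n w => gap (x ^~ w) n)
      (fun n w => v n w) (fun n w => s n w)
}.

Definition zero_reached_event (R : realType) (dT : measure_display)
    (T : measurableType dT) (P : probability T R)
    (x v s : nat -> {RV P >-> R}) : set T :=
  [set w | zero_reached (x ^~ w) (v ^~ w) (s ^~ w)].

(* Main.v *)
Require Import Defs.
From HB Require Import structures.
From mathcomp Require Import all_boot all_order all_algebra.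
From mathcomp Require Import all_classical all_reals all_analysis.
From mathcomp Require Import measurable_realfun zify ring lra.
Set Implicit Arguments.
Unset Strict Implicit.
Unset Printing Implicit Defensive.
Import Order.TTheory GRing.Theory Num.Theory.
Local Open Scope classical_set_scope.
Local Open Scope ring_scope.

(* Let A be the index of the first particle to reach 0 and q(z) = E[z^A; A < oo],
   so that q = q(1). Decomposing on the fate of the first particle gives
     q(z) = z (1-p)/2 + p z q(z)^2 + r(z) q(z) + p z q(z)^2 / 2,
   where r(z) marks the annihilation of a right-moving first particle by a
   left-moving one. The last term is the case where that particle is stopped by
   a static one: a reflection of the block up to the particle that reaches 0
   swaps the two distances to the static particle, whence the factor 1/2, ties
   being broken by the spin. Erasing the first particle gives in turn
     z (1-p)/2 q(z) = r(z) + p z q(z)^3 / 2.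
   Hence 2 q(z) = z F(q(z)) with F(u) = (1-p) + (1+2p) u^2 - p u^4, and at z = 1
   (1-q)^2 (p (1+q)^2 - 1) = 0, which settles p <= 1/4. For 1/4 < p < 1, the value
   q = 1 is excluded by continuity of q(.) on [0, 1]: otherwise q(z) = p^(-1/2) - 1
   for some z < 1, while this is a nonzero root of 2 u = F(u). *)

(** Counting particles up to the arrival, rather than measuring a distance, is what makes the result
    independent of [m]: the count is additive over consecutive blocks. All terms of the
    decomposition are events on finite blocks. Since the fate of a left-moving particle does not
    depend on what starts to its right, these blocks capture the infinite evolution, and disjoint
    blocks are independent.

    The obstacle is r: the mutual annihilation of two moving particles has no product form. Erasing
    the right-moving one circumvents this. It frees either the partner, or the static particle that
    had stopped it; the latter then absorbs an arrival, so that one more arrival has to follow,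
    whence the cube.

    At z = 1 the value 1 is a root for every p, so the equation alone cannot decide; this is why the
    variable z is kept. The power series itself is never constructed: its partial sums satisfy the
    equation up to a tail of the coefficients, uniformly in z. *)

(** * Dynamics *)

(* [evolution] restricted to the particles of [I]: the others get the fate
   [-oo], so that they are never [present]. *)
Definition evol (R : realType) (x v s : nat -> R) (I : set nat)
    (d : nat -> \bar R) : Prop :=
  [/\ forall n, ~ I n -> d n = -oo%E,
      forall n, I n -> (0 <= d n)%E &
      forall n t, I n -> 0 <= t ->
        (d n = t%:E <->
         (exists j, meet x v d t n j) /\ ~ survives_triple x v s d t n)].

Definition admissible (R : realType) (x v s : nat -> R) : Prop :=
  [/\ forall i j, (i < j)%N -> x i < x j,
      forall n, [\/ v n = -1, v n = 0 | v n = 1] &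
      forall n, s n = -1 \/ s n = 1].

Definition blk (a b : nat) : set nat := [set n | (a <= n <= b)%N].

(* In the evolution restricted to [a..b], the particle [b] leaves to the left and
   is the only survivor: this is the event that [b] is the first particle to
   cross a location to the left of [x a], for the process on [a, +oo). *)
Definition Hit (R : realType) (x v s : nat -> R) (a b : nat) : Prop :=
  [/\ (a <= b)%N, v b = -1 &
    exists2 d, evol x v s (blk a b) d &
      forall n, blk a b n -> (d n = +oo%E <-> n = b)].

Definition Esc (R : realType) (x v s : nat -> R) (a b : nat) : Prop :=
  [/\ (a <= b)%N, v a = 1 &
    exists2 d, evol x v s (blk a b) d &
      forall n, blk a b n -> (d n = +oo%E <-> n = a)].

(** Half the distance is the time at which opposite unit velocities bring [a] and [b] together; both
    dying at that instant encodes their mutual annihilation. *)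
Definition Pair (R : realType) (x v s : nat -> R) (a b : nat) : Prop :=
  [/\ (a < b)%N, v a = 1, v b = -1 &
    exists2 d, evol x v s (blk a b) d &
      d a = ((x b - x a) / 2)%:E /\ d b = ((x b - x a) / 2)%:E].

(** The left-moving [b] comes to the static [z] after the right-moving [a], or together with it; in
    the latter case the spin -1 lets [b] go through the triple collision. *)
Definition late (R : realType) (x s : nat -> R) (a z b : nat) : Prop :=
  x z - x a < x b - x z \/ (x z - x a = x b - x z /\ s z = -1).

(** A particle starting to the right of [x b] stays strictly to the right of the ray [x b - u]. A
    block that dies out without passing this ray is therefore invisible to what follows. *)
Definition clear (R : realType) (x v s : nat -> R) (a b : nat) : Prop :=
  (a <= b)%N /\
  exists2 d, evol x v s (blk a b) d &
    forall m, blk a b m -> d m != +oo%E /\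
      (forall u, 0 <= u -> present d m u -> location x v m u <= x b - u).

(* The right-moving particle [a] is stopped by the static particle [k.+1], and
   [b], the first particle to reach [x k.+1] from the right, comes late enough
   to go on to the left of [x a]. *)
Definition Halt (R : realType) (x v s : nat -> R) (a k b : nat) : Prop :=
  [/\ Esc x v s a k, v k.+1 = 0, Hit x v s k.+2 b & late x s a k.+1 b].

Section Dynamics.
Context (R : realType) (x v s : nat -> R) (adm : admissible x v s).
Implicit Types (d : nat -> \bar R) (I : set nat).

Local Notation y := (location x v).

(** * Meetings, survivors and the order of trajectories *)

Let xlt i j : (i < j)%N -> x i < x j. Proof. by case: adm => + _ _; apply. Qed.
Let vP n : [\/ v n = -1, v n = 0 | v n = 1]. Proof. by case: adm. Qed.
Let sP n : s n = -1 \/ s n = 1. Proof. by case: adm. Qed.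

Lemma evolution_evol d : evolution x v s d <-> evol x v s setT d.
Proof.
split=> [[d0 dE]|[_ d0 dE]]; first by split=> [n []//|n _|n t _]; [exact: d0|exact: dE].
by split=> [n|n t]; [apply: d0|apply: dE].
Qed.

Lemma x_le i j : (i <= j)%N -> x i <= x j.
Proof. by rewrite leq_eqVlt => /predU1P[->//|/xlt/ltW]. Qed.

Let xle i j : (i <= j)%N -> x i <= x j. Proof. exact: x_le. Qed.
Let yL n u : v n = -1 -> y n u = x n - u.
Proof. by rewrite /location => ->; rewrite mulN1r. Qed.
Let yR n u : v n = 1 -> y n u = x n + u.
Proof. by rewrite /location => ->; rewrite mul1r. Qed.
Let yS n u : v n = 0 -> y n u = x n.
Proof. by rewrite /location => ->; rewrite mul0r addr0. Qed.
Let y_ge n u : 0 <= u -> x n - u <= y n u.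
Proof. by move=> u0; rewrite /location; case: (vP n) => ->; lra. Qed.

Lemma x_inj i j : x i = x j -> i = j.
Proof.
move=> xij; have [/xlt|/xlt|//] := ltngtP i j; rewrite xij ltxx //.
Qed.

Lemma present_le d n t u : u <= t -> present d n t -> present d n u.
Proof. by rewrite /present => ut; apply: le_trans; rewrite lee_fin. Qed.

Lemma present_dom I d n t : evol x v s I d -> present d n t -> I n.
Proof.
move=> [dN _ _] pn; apply: contrapT => /dN dn; move: pn.
by rewrite /present dn leeNy_eq.
Qed.

Lemma meet_sym d t i j : meet x v d t i j -> meet x v d t j i.
Proof. by case=> ij pi pj e; split=> //; rewrite eq_sym. Qed.

Lemma same_velocity i j t : y i t = y j t -> v i = v j -> i = j.
Proof. by rewrite /location => e vij; apply: x_inj; move: e; rewrite vij; lra. Qed.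

Lemma dies I d t i j : evol x v s I d -> 0 <= t -> meet x v d t i j ->
  d i = t%:E \/ survives_triple x v s d t i.
Proof.
move=> e t0 m; have [Si|nSi] := pselect (survives_triple x v s d t i); [by right|left].
case: (e) => _ _ dE; apply/dE => //; first by case: m => _ /(present_dom e).
by split => //; exists j.
Qed.

Lemma static_not_survivor d t i : v i = 0 -> ~ survives_triple x v s d t i.
Proof. by move=> vi [j [k []]] _ _ _ _; rewrite vi; case: (sP j) => ->; lra. Qed.

Lemma static_dies I d t i j : evol x v s I d -> 0 <= t -> meet x v d t i j ->
  v i = 0 -> d i = t%:E.
Proof. by move=> e t0 m vi; have [//|/static_not_survivor []] := dies e t0 m. Qed.

(* The static particles at a given location coincide, so that two survivors
   have the same velocity. *)
Lemma survivors_eq d t i j : y i t = y j t ->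
  survives_triple x v s d t i -> survives_triple x v s d t j -> i = j.
Proof.
move=> yij [a [b [[_ _ _ yia] _ va _ via]]] [a' [b' [[_ _ _ yja] _ va' _ vja]]].
have aa' : a = a'.
  by apply: (same_velocity (t := t)); rewrite ?va ?va' // -yia -yja.
by apply: (same_velocity yij); rewrite via vja aa'.
Qed.

Lemma one_dies I d t i j : evol x v s I d -> 0 <= t -> meet x v d t i j ->
  d i = t%:E \/ d j = t%:E.
Proof.
move=> e t0 m; have [|Si] := dies e t0 m; first by left.
have [|Sj] := dies e t0 (meet_sym m); first by right.
by case: m => /eqP ij _ _ yij; case: ij; exact: survivors_eq yij Si Sj.
Qed.

(** A meeting kills at least one of the two particles, so if both are present at [t] they can have
    met only at [t]; an inversion would force an earlier meeting. *)
Lemma no_crossing I d i j t u : evol x v s I d -> (i < j)%N ->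
  present d i t -> present d j t -> 0 <= u <= t ->
  y i u <= y j u /\ (y i u = y j u -> u = t).
Proof.
move=> e ij pi pj /andP[u0 ut].
have eqP' w : 0 <= w <= t -> y i w = y j w -> w = t.
  move=> /andP[w0 wt] yw.
  have m : meet x v d w i j.
    by split; rewrite ?ltn_eqF //; apply: present_le wt _.
  apply/eqP; rewrite eq_le wt /= -lee_fin.
  by have [<-|<-] := one_dies e w0 m.
split; last by apply: eqP'; rewrite u0.
rewrite leNgt; apply/negP => lt.
have xij := xlt ij.
have vij : 1 <= v i - v j.
  move: lt; rewrite /location.
  by case: (vP i) => ->; case: (vP j) => ->; move=> lt; lra.
(* The instant at which the two lines intersect; an inversion at [u] puts it strictly before [u]. *)
pose w := (x j - x i) / (v i - v j).
have v0 : 0 < v i - v j by lra.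
have wE : w * (v i - v j) = x j - x i by rewrite /w divfK // gt_eqF.
have w0 : 0 <= w by rewrite divr_ge0 //; lra.
have wu : w < u.
  rewrite -(ltr_pM2r v0) wE; move: lt; rewrite /location; lra.
suff : w = t by lra.
apply: eqP'; first by rewrite w0 /= ltW // (lt_le_trans wu).
by rewrite /location; lra.
Qed.

(* [C n t]: the fate of particle [n] up to time [t] is determined by particles
   lying in both [I] and [I']. *)
Lemma evol_agree (I I' : set nat) d d' (C : nat -> R -> Prop) N :
  evol x v s I d -> evol x v s I' d' ->
  (forall n t, C n t -> [/\ (n < N)%N, I n & I' n]) ->
  (forall n (t u : R), C n t -> 0 <= u <= t -> C n u) ->
  (forall n j (t : R), 0 <= t -> C n t -> I j -> present d n t -> present d j t ->
     y n t = y j t -> C j t) ->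
  (forall n j (t : R), 0 <= t -> C n t -> I' j -> present d' n t -> present d' j t ->
     y n t = y j t -> C j t) ->
  forall n (t : R), 0 <= t -> C n t -> (d n = t%:E <-> d' n = t%:E).
Proof.
move=> e e' CN Cle Cd Cd' n t.
(* Induction on the number of recorded death times before [t] replaces induction on real time: a
   death at [u < t] belongs to [T], so fewer entries lie below [u]. Infinite times only add harmless
   zeros. *)
pose T := [seq fine (d m) | m <- iota 0 N] ++ [seq fine (d' m) | m <- iota 0 N].
have [k] := ubnP (count (fun u => u < t) T).
elim: k => // k IH in n t *; rewrite ltnS => Tk t0 Cn.
have cnt u : u < t -> u \in T -> (count (fun w => (w < u)%R) T < k)%N.
  move=> ut uT; apply: leq_trans Tk.
  have := count_predUI (fun w => w < u) (pred1 u) T.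
  rewrite (@eq_count _ (predI _ _) pred0) => [|w /=]; last first.
    by apply/negbTE/negP => /andP[/[swap] /eqP->]; rewrite ltxx.
  rewrite count_pred0 addn0 => cE.
  have : (0 < count (pred1 u) T)%N by rewrite -has_count has_pred1.
  rewrite -(ltn_add2l (count (fun w => w < u) T)) addn0 -cE => /leq_trans; apply.
  apply: sub_count => w /= /orP[/lt_trans-> //|/eqP->//].
have finT u m : (m < N)%N -> d m = u%:E \/ d' m = u%:E -> u \in T.
  move=> mN dm; rewrite mem_cat; apply/orP.
  by case: dm => dm; [left|right]; apply/mapP; exists m; rewrite ?mem_iota ?dm.
have presE m : C m t -> present d m t <-> present d' m t.
  move=> Cm; have [mN Im I'm] := CN _ _ Cm.
  have [_ /(_ m Im) dm0 _] := e; have [_ /(_ m I'm) dm0' _] := e'.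
  split=> pm; rewrite /present leNgt; apply/negP => dt.
    case d'mE: (d' m) dm0' dt => [u| |] //; rewrite !lee_fin lte_fin => u0 ut.
    have Cu : C m u by apply: Cle Cm _; rewrite u0 ltW.
    have /IH : (count (fun w => (w < u)%R) T < k)%N.
      by apply: cnt => //; apply: finT mN _; right.
    by move=> /(_ m u0 Cu)[_ /(_ d'mE)] dm; move: pm; rewrite /present dm lee_fin leNgt ut.
  case dmE: (d m) dm0 dt => [u| |] //; rewrite !lee_fin lte_fin => u0 ut.
  have Cu : C m u by apply: Cle Cm _; rewrite u0 ltW.
  have /IH : (count (fun w => (w < u)%R) T < k)%N.
    by apply: cnt => //; apply: finT mN _; left.
  by move=> /(_ m u0 Cu)[/(_ dmE)] dm _; move: pm; rewrite /present dm lee_fin leNgt ut.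
have meetE j : meet x v d t n j <-> meet x v d' t n j.
  split=> -[nj pn pj yj]; have Ij := present_dom _ pj.
    have Cj : C j t by apply: Cd Cn (Ij _ e) pn pj yj.
    by split=> //; apply/presE.
  have Cj : C j t by apply: Cd' Cn (Ij _ e') pn pj yj.
  by split=> //; apply/presE.
have survE : survives_triple x v s d t n <-> survives_triple x v s d' t n.
  by split=> -[i [j [mi mj vi vj ni]]]; exists i, j; split=> //; apply/meetE.
have [_ In I'n] := CN _ _ Cn.
case: e => _ _ -> //; case: e' => _ _ -> //.
by split=> -[[j mj] ns]; split; try (by rewrite survE || rewrite -survE);
  exists j; apply/meetE.
Qed.

Lemma eq_ereal_ge0 (a b : \bar R) : (0 <= a)%E -> (0 <= b)%E ->
  (forall t : R, 0 <= t -> a = t%:E <-> b = t%:E) -> a = b.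
Proof.
case: a b => [a| |] [b| |] //; rewrite ?lee_fin => a0 b0 ab //.
- by apply/esym/(ab a a0).
- by have [/(_ erefl)] := ab a a0.
- by have [_ /(_ erefl)] := ab b b0.
Qed.

Lemma evol_unique I N d d' : (forall n, I n -> (n < N)%N) ->
  evol x v s I d -> evol x v s I d' -> d = d'.
Proof.
move=> IN e e'; apply/funext => n.
have [In|nIn] := pselect (I n); last first.
  by case: e => -> // _ _; case: e' => ->.
apply: eq_ereal_ge0; [by case: e => _ + _; apply|by case: e' => _ + _; apply|].
move=> t t0; apply: (evol_agree (C := fun m _ => I m) (N := N) e e') => //.
by move=> m _ Im; split=> //; exact: IN.
Qed.

(** * Finite propagation speed *)

Lemma location_dist n t u : `|y n t - y n u| <= `|t - u|.
Proof.
rewrite /location (_ : _ - _ = v n * (t - u)); last by ring.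
by rewrite normrM ler_piMl //; case: (vP n) => ->; rewrite ?normrN ?normr0 ?normr1.
Qed.

Lemma location0 n : y n 0 = x n.
Proof. by rewrite /location mulr0 addr0. Qed.

(** Speeds are at most 1, so a particle inside the backward cone of [(c, t)] has been in it since
    time 0, and so has any partner it meets there. *)
Lemma evol_cone I I' d d' c t N : evol x v s I d -> evol x v s I' d' ->
  (forall m, `|x m - c| <= t -> (m < N)%N /\ (I m <-> I' m)) ->
  forall m u, 0 <= u -> `|y m u - c| <= t - u -> I m ->
  (d m = u%:E <-> d' m = u%:E).
Proof.
move=> e e' cone.
pose C m u := [/\ 0 <= u, `|y m u - c| <= t - u & I m].
have C0 m u : 0 <= u -> `|y m u - c| <= t - u -> `|x m - c| <= t.
  move=> u0 Cu; rewrite -(location0 m).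
  rewrite (_ : _ - c = (y m 0 - y m u) + (y m u - c)); last by ring.
  rewrite (le_trans (ler_normD _ _)) // -(subrK u t) addrC lerD //.
  by rewrite (le_trans (location_dist _ _ _)) // sub0r normrN ger0_norm.
move=> m u u0 Cu Im; apply: (evol_agree (C := C) (N := N) e e') => //.
- move=> n w [w0 Cw In]; have [nN II] := cone n (C0 _ _ w0 Cw).
  by split=> //; apply/II.
- move=> n w w' [w0 Cw In] /andP[w'0 w'w]; split => //.
  rewrite (_ : _ - c = (y n w' - y n w) + (y n w - c)); last by ring.
  rewrite (le_trans (ler_normD _ _)) // (_ : t - w' = (w - w') + (t - w)); last by ring.
  rewrite lerD // (le_trans (location_dist _ _ _)) // distrC ger0_norm // subr_ge0 //.
- by move=> n j w w0 [_ Cw In] Ij _ _ yE; split=> //; rewrite -yE.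
- move=> n j w w0 [_ Cw In] Ij _ _ yE.
  have Cj : `|y j w - c| <= t - w by rewrite -yE.
  by split=> //; have [_ ->] := cone j (C0 j w w0 Cj).
Qed.

(** * Existence of the evolution *)

Lemma seq_min (T : seq R) : T != [::] ->
  exists2 m, m \in T & forall u, u \in T -> m <= u.
Proof.
elim: T => // a [_ _|b T /(_ isT)[m mT mP] _].
  by exists a => [|u]; rewrite inE // => /eqP->.
have [am|ma] := leP a m; [exists a|exists m] => [|u|//|u]; rewrite ?inE ?eqxx //.
- by case/predU1P => [->//|/mP]; apply: le_trans.
- by move: mT; rewrite inE => ->; rewrite orbT.
- by case/predU1P => [->|/mP//]; apply: ltW.
Qed.

(** Event-driven construction: the particles of [S] move freely until their first meeting after
    [t0], those killed there are removed, and the survivors are restarted from that time. *)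
Lemma evol_exists_from (S : seq nat) (t0 : R) : 0 <= t0 ->
  exists d : nat -> \bar R,
    [/\ forall n, n \notin S -> d n = -oo%E,
        forall n, n \in S -> (t0%:E < d n)%E &
        forall n t, n \in S -> t0 < t -> (d n = t%:E <->
         (exists j, meet x v d t n j) /\ ~ survives_triple x v s d t n)].
Proof.
have [k] := ubnP (size S); elim: k => // k IH in S t0 *; rewrite ltnS => Sk t00.
pose d0 n : \bar R := if n \in S then +oo%E else -oo%E.
have d0E n t : present d0 n t <-> n \in S.
  by rewrite /present /d0; case: ifP => _; rewrite ?leey ?leeNy_eq.
(* Candidate meeting times. For equal velocities the quotient is 0, which the filter discards
   because [0 <= t0]. *)
pose T := [seq u <- [seq (x j - x i) / (v i - v j) | i <- S, j <- S] | t0 < u].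
have TP i j t : t0 < t -> meet x v d0 t i j -> t \in T.
  move=> t0t [ij /d0E iS /d0E jS yij]; rewrite mem_filter t0t.
  apply/allpairsP; exists (i, j); split => //=.
  have vij : v i - v j != 0.
    by apply: contra ij; rewrite subr_eq0 => /eqP/(same_velocity yij)/eqP.
  by apply/(mulIf vij); rewrite divfK //; move: yij; rewrite /location; lra.
have [T0|/seq_min[t tT tmin]] := eqVneq T [::].
  exists d0; split => [n /negbTE|n|n t]; rewrite /d0; [by move=> ->|by move=> ->; rewrite ltry|].
  by move=> nS t0t; rewrite nS; split => // -[[j /(TP _ _ _ t0t)]]; rewrite T0.
move: (tT); rewrite mem_filter => /andP[t0t /allpairsP[[i j] /= [iS jS tE]]].
have vij : v i - v j != 0.
  by apply: contraTneq t0t; rewrite tE => ->; rewrite invr0 mulr0 -leNgt.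
have mij : meet x v d0 t i j.
  split; rewrite ?d0E //; first by apply: contraNneq vij => ->; rewrite subrr.
  by apply/eqP; rewrite -subr_eq0 /location -[X in X == _]opprK oppr_eq0 tE;
    apply/eqP; field.
pose K n := `[< (exists l, meet x v d0 t n l) /\ ~ survives_triple x v s d0 t n >].
(* Of two particles that meet, not both survive, so the recursive call is on a shorter list. *)
have iK : K i || K j.
  apply/orP; have [Si|] := pselect (survives_triple x v s d0 t i); last first.
    by move=> nSi; left; apply/asboolP; split => //; exists j.
  right; apply/asboolP; split; first by exists i; exact: meet_sym.
  move=> Sj; case: (mij) => /eqP ij _ _ yij; apply: ij.
  exact: survivors_eq yij Si Sj.
have t_ge0 : 0 <= t by lra.
have [||d' [d'N d't d'E]] := IH [seq n <- S | ~~ K n] t => //.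
  apply: leq_trans Sk; rewrite size_filter -(count_predC K S) -[ltnLHS]add0n ltn_add2r.
  by rewrite -has_count; apply/hasP; case/orP: iK => ?; [exists i|exists j].
pose d n := if (n \in S) && K n then t%:E else d' n.
have dt n : n \in S -> (t%:E <= d n)%E.
  move=> nS; rewrite /d nS /=; case: ifPn => // nK.
  by rewrite ltW // d't // mem_filter nK.
have dN n : n \notin S -> d n = -oo%E.
  by move=> nS; rewrite /d (negbTE nS) /= d'N // mem_filter (negbTE nS) andbF.
have dP n u : u <= t -> present d n u <-> present d0 n u.
  move=> ut; rewrite d0E; split => [|/dt]; last first.
    by apply: le_trans; rewrite lee_fin.
  by apply: contraPT => /dN; rewrite /present => ->; rewrite leeNy_eq.
have dP' n u : t < u -> present d n u <-> present d' n u.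
  move=> tu; rewrite /present /d; case: ifP => // /andP[nS Kn].
  rewrite lee_fin leNgt tu d'N ?leeNy_eq //.
  by rewrite mem_filter Kn.
have meetE u d1 d2 : (forall n, present d1 n u <-> present d2 n u) ->
    forall n l, meet x v d1 u n l <-> meet x v d2 u n l.
  by move=> P n l; split => -[nl pn pl yn]; split => //; apply/P.
have survE u d1 d2 : (forall n, present d1 n u <-> present d2 n u) ->
    forall n, survives_triple x v s d1 u n <-> survives_triple x v s d2 u n.
  by move=> P n; split => -[a [b [? ? ? ? ?]]]; exists a, b; split => //;
    apply/(meetE _ _ _ P).
have rhsE u d1 d2 : (forall n, present d1 n u <-> present d2 n u) -> forall n,
    ((exists l, meet x v d1 u n l) /\ ~ survives_triple x v s d1 u n) <->
    ((exists l, meet x v d2 u n l) /\ ~ survives_triple x v s d2 u n).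
  move=> P n; rewrite (survE _ _ _ P).
  by split => -[[l ml] ns]; split => //; exists l; apply/(meetE _ _ _ P).
exists d; split => // [n nS|n u nS t0u].
  by apply: lt_le_trans (dt _ nS); rewrite lte_fin.
have [ut|tu|ut] := ltgtP u t.
- rewrite (rhsE _ _ _ (fun n => dP n u (ltW ut))); split => [dn|[[l /TP-/(_ t0u)/tmin]]].
    by have := dt _ nS; rewrite dn lee_fin leNgt ut.
  by rewrite leNgt ut.
- rewrite (rhsE _ _ _ (fun n => dP' n u tu)) /d nS /=.
  case: ifPn => Kn; last by apply: d'E; rewrite // mem_filter Kn.
  split => [[ut]|[[l [_]]]]; first by rewrite ut ltxx in tu.
  by rewrite /present d'N ?leeNy_eq // mem_filter Kn.
- rewrite ut (rhsE _ _ _ (fun n => dP n t (lexx t))) /d nS /=.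
  case: ifPn => Kn; first by split => // _; exact/asboolP.
  split => [d'n|/asboolP]; last by rewrite -/(K n) (negbTE Kn).
  by have := d't n; rewrite mem_filter Kn nS d'n ltxx => /(_ isT).
Qed.

Lemma evol_exists I N : (forall n, I n -> (n < N)%N) -> exists d, evol x v s I d.
Proof.
move=> IN; pose S := [seq n <- iota 0 N | n \in I].
have SE n : n \in S <-> I n.
  rewrite mem_filter mem_iota /= add0n; split => [/andP[/set_mem//]|In].
  by rewrite mem_set //= IN.
have [d [dN d0 dE]] := @evol_exists_from S 0 (lexx 0).
exists d; split => [n nI|n /SE/d0/ltW//|n t /SE nS].
  apply: dN; apply/negP; rewrite SE. exact: nI.
rewrite le_eqVlt => /predU1P[<-|t0]; last exact: dE.
split => [dn|[[j [/eqP nj _ _ +]] _]]; first by have := d0 n nS; rewrite dn ltxx.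
by rewrite !location0 => /(x_inj).
Qed.

(** The evolutions [f N] of the first [N] particles stabilise: by finite speed, the fate of a
    particle up to time [t] involves finitely many starting points. A particle is immortal when no
    finite death time stabilises. *)
Lemma evol_exists_setT : (forall M, exists N, forall n, (N <= n)%N -> M < x n) ->
  exists d, evol x v s setT d.
Proof.
move=> x_infty.
have /choice[f fE] N : exists d, evol x v s [set n | (n < N)%N] d.
  exact: (@evol_exists _ N).
pose st n (t : R) := 0 <= t /\ exists N, forall M, (N <= M)%N -> f M n = t%:E.
pose d n : \bar R := if pselect (exists t, st n t) is left e then (projT1 (cid e))%:E else +oo%E.
have dE n t : 0 <= t -> d n = t%:E <-> exists N, forall M, (N <= M)%N -> f M n = t%:E.
  move=> t0; rewrite /d; case: pselect => [e|ne]; last first.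
    by split=> // NM; case: ne; exists t.
  case: (cid e) => /= u [u0 [N NP]]; split => [[<-]|[N' N'P]]; first by exists N.
  by rewrite -(NP (maxn N N')) ?leq_maxl // N'P ?leq_maxr.
have d_ge0 n : (0 <= d n)%E.
  by rewrite /d; case: pselect => // e; case: cid => /= t []; rewrite lee_fin.
exists d; split => [n []//|n _|n t _ t0]; first exact: d_ge0.
(* Every particle that can be where [n] is at time [t], and every starting point in the backward
   cone of that place, has index below [N]. *)
have [N NP] := x_infty (y n t + t).
have cone k : `|x k - y n t| <= t -> (k < N)%N.
  move=> Ck; rewrite ltnNge; apply/negP => /NP; move: Ck; rewrite ler_norml; lra.
have yN m : y m t = y n t -> (m < N)%N.
  move=> ym; apply: cone; rewrite -ym -(location0 m) (le_trans (location_dist _ _ _)) //.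
  by rewrite sub0r normrN ger0_norm.
have agree M M' m u : (N <= M)%N -> (N <= M')%N -> 0 <= u -> y m t = y n t -> u <= t ->
    f M m = u%:E <-> f M' m = u%:E.
  move=> NM NM' u0 yu ut.
  apply: (evol_cone (N := N) (c := y n t) (t := t) (fE M) (fE M')) => //=.
  - move=> k /cone kN; split => //.
    by split => _; apply: leq_trans kN _.
  - by rewrite -yu (le_trans (location_dist _ _ _)) // distrC ger0_norm ?subr_ge0.
  - by apply: leq_trans NM; exact: yN.
have dN m u : 0 <= u -> u <= t -> y m t = y n t -> d m = u%:E <-> f N m = u%:E.
  move=> u0 ut ym; rewrite dE //; split => [[N' N'P]|fu].
    by apply/(agree N (maxn N N')) => //; rewrite ?leq_maxl // N'P ?leq_maxr.
  by exists N => M NM; apply/(agree M N).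
have fN_ge0 m : y m t = y n t -> (0 <= f N m)%E.
  by move=> /yN mN; have [_ + _] := fE N; apply.
have dlt m (g g' : nat -> \bar R) : (forall u, 0 <= u -> u <= t -> g m = u%:E <-> g' m = u%:E) ->
    (0 <= g' m)%E -> present g m t -> present g' m t.
  move=> gg' g'0 gm; rewrite /present leNgt; apply/negP => g't.
  case g'E: (g' m) g'0 g't => [u| |] //; rewrite lee_fin lte_fin => u0 ut.
  have [_ /(_ g'E) gE] := gg' u u0 (ltW ut).
  by move: gm; rewrite /present gE lee_fin leNgt ut.
have presE m : y m t = y n t -> present d m t <-> present (f N) m t.
  move=> ym; split; apply: dlt; rewrite ?d_ge0 ?fN_ge0 // => u u0 ut.
    exact: dN.
  by apply: iff_sym; exact: dN.
have meetE j : meet x v d t n j <-> meet x v (f N) t n j.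
  by split => -[nj pn pj yj]; split => //; apply/presE => //; exact/esym.
have survE : survives_triple x v s d t n <-> survives_triple x v s (f N) t n.
  by split => -[a [b [? ? ? ? ?]]]; exists a, b; split => //; apply/meetE.
have [_ _ fNE] := fE N.
rewrite survE dN // fNE //=; last exact: yN.
by split => -[[j mj] ns]; split => //; exists j; apply/meetE.
Qed.

(** * Gluing, inserting, removing and relabelling particles *)

Definition glue I1 d1 d2 n : \bar R := if n \in I1 then d1 n else d2 n.

(** The cross meetings allowed are those that change no fate: the particle of [I1] dies at that time
    anyway, and the immortal one of [I2] goes through a triple collision. This serves for ties at a
    static particle; in the other uses the two sides never meet. *)
Lemma evol_glue I1 I2 d1 d2 : (forall n, I1 n -> ~ I2 n) ->
  evol x v s I1 d1 -> evol x v s I2 d2 ->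
  (forall i j u, 0 <= u -> I1 i -> I2 j -> present d1 i u -> present d2 j u ->
     y i u = y j u ->
     [/\ d1 i = u%:E, d2 j = +oo%E,
         survives_triple x v s (glue I1 d1 d2) u j &
         ~ survives_triple x v s (glue I1 d1 d2) u i]) ->
  evol x v s (I1 `|` I2) (glue I1 d1 d2).
Proof.
move=> I12 e1 e2 cross; set d := glue I1 d1 d2.
have J1 n : I1 n -> d n = d1 n by move=> In; rewrite /d /glue mem_set.
have J2 n : I2 n -> d n = d2 n.
  by move=> In; rewrite /d /glue memNset // => /I12.
have P1 n u : I1 n -> present d n u = present d1 n u by rewrite /present => /J1->.
have P2 n u : I2 n -> present d n u = present d2 n u by rewrite /present => /J2->.
have PI n u : present d n u -> I1 n \/ I2 n.
  rewrite /present /d /glue; case: ifPn => [/set_mem|_ /(present_dom e2)]; first by left.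
  by right.
have m1 u n j : meet x v d1 u n j -> meet x v d u n j.
  case=> nj pn pj yj; have In := present_dom e1 pn; have Ij := present_dom e1 pj.
  by split => //; rewrite P1.
have m2 u n j : meet x v d2 u n j -> meet x v d u n j.
  case=> nj pn pj yj; have In := present_dom e2 pn; have Ij := present_dom e2 pj.
  by split => //; rewrite P2.
have m1' u n j : I1 n -> I1 j -> meet x v d u n j -> meet x v d1 u n j.
  by move=> In Ij [nj pn pj yj]; split => //; rewrite -P1.
have m2' u n j : I2 n -> I2 j -> meet x v d u n j -> meet x v d2 u n j.
  by move=> In Ij [nj pn pj yj]; split => //; rewrite -P2.
have X u n j : 0 <= u -> I1 n -> I2 j -> meet x v d u n j ->
    [/\ d1 n = u%:E, d2 j = +oo%E, survives_triple x v s d u j &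
        ~ survives_triple x v s d u n].
  by move=> u0 In Ij [nj pn pj yj]; apply: cross; rewrite // -?P1 // -?P2.
have [N1 Z1 E1] := e1; have [N2 Z2 E2] := e2.
split=> [n nI|n [In|In]|n t [In|In] t0].
- rewrite /d /glue memNset => [|In]; last by apply: nI; left.
  by apply: N2 => In; apply: nI; right.
- by rewrite J1 // Z1.
- by rewrite J2 // Z2.
- rewrite J1 //; split => [dn|[[j mj] nS]].
    have [[j mj] nS] := (E1 _ _ In t0).1 dn.
    split; first by exists j; exact: m1.
    have [[k [Ik mk]]|nX] := pselect (exists k, I2 k /\ meet x v d t n k).
      by have [] := X _ _ _ t0 In Ik mk.
    move=> [i [k [mi mk vi vk ni]]]; apply: nS; exists i, k.
    have I1m l : meet x v d t n l -> meet x v d1 t n l.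
      move=> ml; apply: m1' => //; case: (ml) => _ _ /PI[//|Il] _.
      by case: nX; exists l.
    by split => //; exact: I1m.
  case: (mj) => _ _ /PI[Ij|Ij] _; last by have [] := X _ _ _ t0 In Ij mj.
  apply/E1 => //; split; first by exists j; exact: m1'.
  by move=> [i [k [/m1 mi /m1 mk *]]]; apply: nS; exists i, k.
- rewrite J2 //; split => [dn|[[j mj] nS]].
    have [[j mj] nS] := (E2 _ _ In t0).1 dn.
    split; first by exists j; exact: m2.
    have [[k [Ik mk]]|nX] := pselect (exists k, I1 k /\ meet x v d t n k).
      by have [_] := X _ _ _ t0 Ik In (meet_sym mk); rewrite dn.
    move=> [i [k [mi mk vi vk ni]]]; apply: nS; exists i, k.
    have I2m l : meet x v d t n l -> meet x v d2 t n l.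
      move=> ml; apply: m2' => //; case: (ml) => _ _ /PI[Il|//] _.
      by case: nX; exists l.
    by split => //; exact: I2m.
  case: (mj) => _ _ /PI[Ij|Ij] _; first by have [] := X _ _ _ t0 Ij In (meet_sym mj).
  apply/E2 => //; split; first by exists j; exact: m2'.
  by move=> [i [k [/m2 mi /m2 mk *]]]; apply: nS; exists i, k.
Qed.

(** A static [z] is placed in the way of the immortal [h]. The last two hypotheses make [h] the
    first to reach [z], and ensure that nobody would have met [h] after time [t], so that its death
    frees nobody. *)
Lemma evol_collide I d h z t : evol x v s I d -> I h -> d h = +oo%E ->
  ~ I z -> v z = 0 -> 0 <= t -> y h t = x z ->
  (forall m u, m != h -> 0 <= u <= t -> present d m u -> y m u != x z) ->
  (forall m u, m != h -> t < u -> present d m u -> y m u != y h u) ->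
  evol x v s (I `|` [set z]) (fun n => if (n == h) || (n == z) then t%:E else d n).
Proof.
move=> e Ih dh nIz vz t0 yht A B; set d' := fun n => _.
have hz : h != z by apply: contra_notN nIz => /eqP<-.
have vh : v h != 0.
  apply/eqP => vh; case/eqP: hz; apply: (x_inj).
  by move: yht; rewrite /location vh; lra.
have yz u : y z u = x z by rewrite /location vz mul0r addr0.
have [dN d0 dE] := e.
have P n u : n != h -> n != z -> present d' n u = present d n u.
  by rewrite /present /d' => /negbTE-> /negbTE->.
have Ph u : present d' h u <-> u <= t by rewrite /present /d' eqxx /= lee_fin.
have Pz u : present d' z u <-> u <= t by rewrite /present /d' eqxx orbT /= lee_fin.
have Pdh u : present d h u by rewrite /present dh leey.
have Pdz u : ~ present d z u by move=> /(present_dom e).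
have Pw n u : present d n u -> u <= t -> present d' n u.
  move=> pn ut; have [->|nh] := eqVneq n h; first exact/Ph.
  by have [->|nz] := eqVneq n z; [apply/Pz|rewrite P].
have Py u : y h u = x z -> u = t.
  move=> yu; apply: (mulfI vh); move: yu; rewrite -yht /location; lra.
split=> [n nI|n|n u].
- have nh : n != h by apply: contra_notN nI => /eqP->; left.
  have nz : n != z by apply: contra_notN nI => /eqP->; right.
  rewrite /d' (negbTE nh) (negbTE nz) /=; apply: dN => In; apply: nI; by left.
- rewrite /d'; case: ifPn => [_ _|]; first by rewrite lee_fin.
  by rewrite negb_or => /andP[_ /eqP nz] [/d0|].
- have [-> _ u0|nz] := eqVneq n z.
    rewrite /d' eqxx orbT /=; split => [[<-]|[[j [zj /Pz ut pj yj]] _]].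
      split; last exact: static_not_survivor.
      by exists h; split; rewrite 1?eq_sym //; [exact/Pz|exact/Ph|rewrite yz].
    congr (_%:E); apply/esym; have [jh|jh] := eqVneq j h.
      by apply: Py; rewrite -jh -(yz u).
    have jz : j != z by rewrite eq_sym.
    have := A j u jh; rewrite u0 ut => /(_ isT).
    by rewrite -P // => /(_ pj)/eqP; rewrite -(yz u) -yj.
  have [->|nh] := eqVneq n h.
    move=> _ u0; rewrite /d' eqxx /=; split => [[<-]|[[j [hj /Ph ut pj yj]] nS]].
      split; first by exists z; split => //; [exact/Ph|exact/Pz|rewrite yz].
      move=> [i [k [[_ _ _ yi] [hk _ pk yk] vi vk _]]].
      have iz : i = z.
        by apply: (same_velocity (t := t)); rewrite ?vi ?vz // -yi yht yz.
      have kz : k != z.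
        apply: contraNneq vh => kz.
        by move: vk; rewrite kz vz => /eqP; rewrite eq_sym oppr_eq0.
      have kh : k != h by rewrite eq_sym.
      have := A k t kh; rewrite t0 lexx => /(_ isT).
      by rewrite -P // => /(_ pk)/eqP; apply; rewrite -yk.
    congr (_%:E); apply/esym; have [jz|jz] := eqVneq j z.
      by apply: Py; rewrite -(yz u) -jz.
    have mj : meet x v d u h j by split => //; rewrite -P // eq_sym.
    move: ut; rewrite le_eqVlt => /predU1P[//|ut].
    case: (dies e u0 mj) => [|S]; first by rewrite dh.
    case: nS; case: S => [i [k [mi mk vi vk hi]]].
    have mm l : meet x v d u h l -> meet x v d' u h l.
      by case=> hl ph pl yl; split => //; [apply/Ph; exact: ltW|apply: Pw => //; exact: ltW].
    by exists i, k; split => //; exact: mm.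
  case=> [In|/eqP]; last by rewrite (negbTE nz).
  move=> u0; rewrite {1}/d' (negbTE nh) (negbTE nz) /=.
  have mE j : meet x v d' u n j <-> meet x v d u n j.
    split => -[nj pn pj yj].
      have pn' : present d n u by rewrite -P.
      split => //; have [->//|jh] := eqVneq j h.
      have [jz|jz] := eqVneq j z; last by rewrite -P.
      have ut : u <= t by apply/Pz; rewrite -jz.
      have := A n u nh; rewrite u0 ut => /(_ isT pn')/eqP[].
      by rewrite yj jz yz.
    split => //; first by rewrite P.
    have jz : j != z by apply: contra_notN (Pdz u) => /eqP<-.
    have [jh|jh] := eqVneq j h; last by rewrite P.
    rewrite jh; apply/Ph; rewrite leNgt; apply/negP => tu.
    by have /eqP[] := B n u nh tu pn; rewrite yj jh.
  rewrite (dE _ _ In u0); split => -[[j mj] nS]; split;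
    try by (exists j; apply/mE).
    by move=> [i [k [/mE mi /mE mk *]]]; apply: nS; exists i, k.
  by move=> [i [k [/mE mi /mE mk *]]]; apply: nS; exists i, k.
Qed.

(* Removing a right-moving particle that is behind all others frees the
   left-moving particle [b] that annihilated it ([b = a] if there is none):
   in the triple collisions that [a] survives, the two other particles would
   annihilate each other anyway. *)
Lemma evol_remove I d a b : evol x v s I d -> I a -> v a = 1 ->
  (forall u j, d a = u%:E -> meet x v d u a j -> j = b) ->
  (b != a -> [/\ v b = -1, d b = d a,
    forall u, d a = u%:E -> meet x v d u a b &
    forall m u, m != a -> m != b -> (d b < u%:E)%E -> present d m u -> y m u != y b u]) ->
  evol x v s (I `\ a)
    (fun n => if n == a then -oo%E else if n == b then +oo%E else d n).
Proof.
move=> e Ia va H1 H2; set d' := fun n => _.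
have [dN d0 dE] := e.
have P n u : n != a -> n != b -> present d' n u = present d n u.
  by rewrite /present /d' => /negbTE-> /negbTE->.
have Pa u : ~ present d' a u by rewrite /present /d' eqxx leeNy_eq.
have Pw n u : n != a -> present d n u -> present d' n u.
  by move=> na; rewrite /present /d' (negbTE na); case: ifP => // _ _; rewrite leey.
have mw u n j : n != a -> j != a -> meet x v d u n j -> meet x v d' u n j.
  by move=> na ja [nj pn pj yj]; split => //; exact: Pw.
have na n u : present d' n u -> n != a by apply: contraPneq => ->; exact: Pa.
have dead n u : I n -> 0 <= u -> survives_triple x v s d u n -> d n <> u%:E.
  by move=> In u0 S dn; have [] := (dE _ _ In u0).1 dn.
have static i : v i = 0 -> i != a.
  by move=> vi; apply: contra_eq_neq vi => ->; rewrite va oner_neq0.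
split=> [n nI|n [In /eqP na']|n u [In /eqP na'] u0].
- rewrite /d'; case: ifPn => // n_a; case: ifPn => [/eqP nb|_].
    rewrite nb in n_a nI; have [_ dba _ _] := H2 n_a.
    case: nI; split; last exact/eqP.
    by apply: contrapT => /dN db; have := d0 _ Ia; rewrite -dba db leeNy_eq.
  by apply: dN => In; apply: nI; split => //; exact/eqP.
- by rewrite /d' (negbTE na'); case: ifPn => // _; exact: d0.
have [nb|nb] := eqVneq n b.
  rewrite nb in na' In *; have [vb dba mab after] := H2 na'.
  rewrite /d' eqxx (negbTE na'); split => [//|[[j [bj pb pj yj]] nS]]; exfalso.
  have ja := na _ _ pj.
  have pj' : present d j u by rewrite -P // eq_sym.
  have [ub|ub] := leP u%:E (d b); last first.
    have := after j u ja; rewrite eq_sym bj => /(_ isT ub pj')/eqP; apply.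
    exact/esym.
  have mj : meet x v d u b j by split.
  have [db|S] := dies e u0 mj.
    have [_ pa _ yab] := mab u (etrans (esym dba) db).
    have maj : meet x v d u a j by split; rewrite 1?eq_sym // yab.
    by have jb := H1 u j (etrans (esym dba) db) maj; rewrite jb eqxx in bj.
  apply: nS; case: (S) => [i [k [mi mk vi vk bi]]].
  exists i, k; split => //; apply: mw => //; first exact: static.
  apply/eqP => ka; rewrite ka in mk.
  have [da|Sa] := dies e u0 (meet_sym mk).
    by apply: (dead _ _ In u0 S); rewrite dba.
  by case: (mk) => /eqP ab _ _ yab; apply: ab; exact: survivors_eq yab S Sa.
have after' j : j != a -> present d' j u -> present d n u -> y n u = y j u ->
    present d j u.
  move=> ja pj pn yn; have [jb|jb] := eqVneq j b; last by rewrite -P.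
  rewrite jb in ja pj yn *; have [vb dba mab after] := H2 ja.
  rewrite /present leNgt; apply/negP => db.
  by have /eqP[] := after n u na' nb db pn.
rewrite {1}/d' (negbTE na') (negbTE nb) dE //; split => -[[j mj] nS].
  have [ja|ja] := eqVneq j a; last first.
    split; first by exists j; exact: mw.
    move=> [i [k [[ni pn pi yi] [nk _ pk yk] vi vk vn]]]; apply: nS.
    have pn' : present d n u by rewrite -P.
    exists i, k; split => //; split => //.
      by apply: after' => //; exact: na pi.
    by apply: after' => //; exact: na pk.
  rewrite ja in mj; have maj := meet_sym mj.
  have [da|Sa] := dies e u0 maj; first by rewrite (H1 u n da maj) eqxx in nb.
  (* Here [n] takes part in a triple collision that [a] survives. Without [a], the static and the
     left-moving particle still have each other as partners. *)
  case: (Sa) => i [k [mi mk vi vk ai]].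
  have ia := static _ vi.
  have ka : k != a by case: mk; rewrite eq_sym.
  have [_ _ _ yan] := maj.
  split.
    have [ni|ni] := eqVneq n i.
      exists k; apply: mw => //; case: mi => _ _ _ yi; case: mk => _ _ pk yk.
      case: mj => _ pn _ _; split => //; last by rewrite -yan.
      by rewrite ni; apply: contra_eq_neq vk => <-; rewrite vi va eq_sym oppr_eq0 oner_neq0.
    exists i; apply: mw => //; case: mi => _ _ pi yi; case: mj => _ pn _ _.
    by split => //; rewrite -yan.
  (* The static particle at that place is unique, so its spin would give [n] the velocity of [a],
     forcing [n = a]. *)
  move=> [i' [k' [[_ _ _ yi'] _ vi' _ ni']]].
  have ii' : i = i'.
    apply: (same_velocity (t := u)); rewrite ?vi ?vi' // -yi' -yan.
    by case: mi.
  by case/eqP: na'; apply: (same_velocity (t := u)); rewrite ?yan // ni' ai ii'.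
case: (mj) => nj pn' pj' yj.
have pn : present d n u by rewrite -P.
split; first by exists j; split => //; apply: after' => //; exact: na pj'.
move=> S; apply: nS; case: (S) => [i [k [mi mk vi vk ni]]].
exists i, k; split => //; apply: mw => //; first exact: static.
apply/eqP => ka; rewrite ka in mk.
have [da|Sa] := dies e u0 (meet_sym mk).
  by rewrite (H1 u n da (meet_sym mk)) eqxx in nb.
by case: (mk) => /eqP ab _ _ yab; apply: ab; exact: survivors_eq yab S Sa.
Qed.

(** [e = 1] gives translations and [e = -1] reflections. Time is unchanged, and spins are multiplied
    by [e] like velocities, so that the survivor of a triple collision is preserved. *)
Lemma evol_transport (x' v' s' : nat -> R) (I I' : set nat) (f : nat -> nat)
    (c e : R) d : e != 0 ->
  (forall n, I' n -> I (f n)) ->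
  (forall n m, I' n -> I' m -> f n = f m -> n = m) ->
  (forall m, I m -> exists2 n, I' n & f n = m) ->
  (forall n, I' n -> x' n = c + e * x (f n)) ->
  (forall n, I' n -> v' n = e * v (f n)) ->
  (forall n, I' n -> s' n = e * s (f n)) ->
  evol x v s I d ->
  evol x' v' s' I' (fun n => if n \in I' then d (f n) else -oo%E).
Proof.
move=> e0 fI finj fsurj x'E v'E s'E [dN d0 dE]; set d' := fun n => _.
have d'E n : I' n -> d' n = d (f n) by move=> In; rewrite /d' mem_set.
have P n u : present d' n u <-> I' n /\ present d (f n) u.
  rewrite /present; split => [|[In]]; last by rewrite d'E.
  rewrite /d'; case: ifPn => [/set_mem//|_]; by rewrite leeNy_eq.
have Y n u : I' n -> location x' v' n u = c + e * y (f n) u.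
  by move=> In; rewrite /location x'E // v'E // /location; ring.
have M n j u : I' n -> I' j -> meet x' v' d' u n j <-> meet x v d u (f n) (f j).
  move=> In Ij; split => -[nj pn pj yj].
    split; [|by have [] := (P _ _).1 pn|by have [] := (P _ _).1 pj|].
      by apply: contra nj => /eqP/finj->.
    by move: yj; rewrite !Y // => /addrI/(mulfI e0).
  split; [|exact/P|exact/P|by rewrite !Y // yj].
  by apply: contra nj => /eqP->.
have dom g n u : evol x v s I g -> present g n u -> I n by exact: present_dom.
have e_ : evol x v s I d by [].
split => [n nI|n In|n u In u0].
- by rewrite /d' memNset.
- by rewrite d'E //; exact/d0/fI.
rewrite d'E // dE //; last exact: fI.
split => -[[j mj] nS].
  have [j' Ij' jE] : exists2 j', I' j' & f j' = j.
    by apply: fsurj; case: mj => _ _ /(present_dom e_).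
  split; first by exists j'; apply/M => //; rewrite jE.
  move=> [i [k [mi mk vi vk ni]]]; apply: nS.
  have Ii : I' i by case: mi => _ _ /P[].
  have Ik : I' k by case: mk => _ _ /P[].
  exists (f i), (f k); split; [exact/M|exact/M|..].
  - by apply: (mulfI e0); rewrite -v'E // mulr0.
  - by apply: (mulfI e0); rewrite mulrN -!v'E.
  - by apply: (mulfI e0); rewrite -v'E // -s'E.
have Ij : I' j by case: mj => _ _ /P[].
split; first by exists (f j); apply/M.
move=> [i' [k' [mi mk vi vk ni]]]; apply: nS.
have [i Ii iE] : exists2 i, I' i & f i = i'.
  by apply: fsurj; case: mi => _ _ /(present_dom e_).
have [k Ik kE] : exists2 k, I' k & f k = k'.
  by apply: fsurj; case: mk => _ _ /(present_dom e_).
rewrite -iE -kE in mi mk vi vk ni.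
exists i, k; split; [exact/M|exact/M|..].
- by rewrite v'E // vi mulr0.
- by rewrite !v'E // vk mulrN.
- by rewrite v'E // s'E // ni.
Qed.

(** * Evolution of blocks of consecutive particles *)

Lemma blk_exists a b : exists d, evol x v s (blk a b) d.
Proof. by apply: (@evol_exists _ b.+1) => n /andP[]. Qed.

Lemma blk_unique a b d d' :
  evol x v s (blk a b) d -> evol x v s (blk a b) d' -> d = d'.
Proof. by apply: (@evol_unique _ b.+1) => n /andP[]. Qed.

Lemma present_oo d n u : d n = +oo%E -> present d n u.
Proof. by rewrite /present => ->; rewrite leey. Qed.

Lemma no_crossing_le I d i j u : evol x v s I d -> 0 <= u -> (i <= j)%N ->
  present d i u -> present d j u -> y i u <= y j u.
Proof.
move=> e u0; rewrite leq_eqVlt => /predU1P[->//|ij] pi pj.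
by have [] := no_crossing e ij pi pj (_ : 0 <= u <= u); rewrite ?u0 ?lexx.
Qed.

Lemma Hit_confined a b d m u : evol x v s (blk a b) d -> v b = -1 ->
  d b = +oo%E -> blk a b m -> 0 <= u -> present d m u -> y m u <= x b - u.
Proof.
move=> e vb db /andP[_ mb] u0 pm; rewrite -yL //.
exact: no_crossing_le e u0 mb pm (present_oo _ db).
Qed.

(** To the left of [x a] a left-moving particle can only be met by another left-moving one, which
    equal speeds forbid; having got there it would be immortal, hence [b]. *)
Lemma Hit_bounded a b d m u : evol x v s (blk a b) d ->
  (forall n, blk a b n -> d n = +oo%E -> n = b) -> blk a b m -> m != b ->
  0 <= u -> present d m u -> x a <= y m u.
Proof.
move=> e db bm mb u0 pm; rewrite leNgt; apply/negP => ylt.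
have /andP[am _] := bm; have xam := xle am.
have vm : v m = -1 by move: ylt; rewrite /location; case: (vP m) => -> //; lra.
have [_ /(_ m bm) d0 dE] := e.
case dm: (d m) d0 => [w| |] //; last by move/(db _ bm)/eqP: dm; rewrite (negbTE mb).
rewrite lee_fin => w0; have uw : u <= w by move: pm; rewrite /present dm lee_fin.
have [[j mj] _] := (dE _ _ bm w0).1 dm; case: (mj) => /eqP mj' _ pj yj.
have /andP[aj _] := present_dom e pj; apply: mj'.
apply: (same_velocity yj); rewrite vm; apply/esym.
have xaj := xle aj.
move: ylt yj; rewrite /location vm; case: (vP j) => -> //; lra.
Qed.

Lemma Esc_bounded a b d m u : evol x v s (blk a b) d ->
  (forall n, blk a b n -> d n = +oo%E -> n = a) -> blk a b m -> m != a ->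
  0 <= u -> present d m u -> y m u <= x b.
Proof.
move=> e da bm ma u0 pm; rewrite leNgt; apply/negP => ylt.
have /andP[_ mb] := bm; have xmb := xle mb.
have vm : v m = 1 by move: ylt; rewrite /location; case: (vP m) => -> //; lra.
have [_ /(_ m bm) d0 dE] := e.
case dm: (d m) d0 => [w| |] //; last by move/(da _ bm)/eqP: dm; rewrite (negbTE ma).
rewrite lee_fin => w0; have uw : u <= w by move: pm; rewrite /present dm lee_fin.
have [[j mj] _] := (dE _ _ bm w0).1 dm; case: (mj) => /eqP mj' _ pj yj.
have /andP[_ jb] := present_dom e pj; apply: mj'.
apply: (same_velocity yj); rewrite vm; apply/esym.
have xjb := xle jb.
move: ylt yj; rewrite /location vm; case: (vP j) => -> //; lra.
Qed.

(** The backward cone of [(y m w, w)] stays to the left of [x b], where [I] and the block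
    coincide. *)
Lemma agree_left I d a b d' m w : evol x v s I d ->
  (forall k, (k <= b)%N -> I k <-> (a <= k)%N) -> evol x v s (blk a b) d' ->
  blk a b m -> 0 <= w -> y m w + w <= x b -> (d m = w%:E <-> d' m = w%:E).
Proof.
move=> e IE e' bm w0 yb.
apply: (evol_cone (N := b.+1) (c := y m w) (t := w) e e') => //.
- move=> k; rewrite ler_norml => /andP[_ h].
  have kb : (k <= b)%N.
    by rewrite leqNgt; apply/negP => /xlt; move: h yb; lra.
  by split; rewrite ?ltnS // IE // /blk /= kb andbT.
- by rewrite subrr normr0 subrr.
- by case/andP: bm => am mb; rewrite IE.
Qed.

(** The least index of a left-moving particle that gets past [x a] is a first arrival for its own
    block, since nothing to its right influences it. *)
Lemma arrival I d a b u : evol x v s I d -> (a <= b)%N ->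
  (forall k, (k <= b)%N -> I k <-> (a <= k)%N) ->
  v b = -1 -> 0 <= u -> present d b u -> y b u < x a ->
  exists k, (a <= k <= b)%N /\ Hit x v s a k.
Proof.
have [n] := ubnP b; elim: n => // n IH in b u *; rewrite ltnS => bn.
move=> e ab IE vb u0 pb yba.
have [[m [am mb vm [w [w0 pm ym]]]]|nm] := pselect (exists m,
    [/\ (a <= m)%N, (m < b)%N, v m = -1 &
       exists w, [/\ 0 <= w, present d m w & y m w < x a]]).
  have IE' k : (k <= m)%N -> I k <-> (a <= k)%N.
    by move=> km; apply: IE; apply: leq_trans km (ltnW mb).
  have [k [/andP[ak km] Hk]] := IH m w (leq_trans mb bn) e am IE' vm w0 pm ym.
  by exists k; rewrite ak (leq_trans km (ltnW mb)).
exists b; rewrite ab leqnn; split=> //; split=> //.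
have [d' e'] := blk_exists a b; exists d' => // k bk.
have ag m w := @agree_left I d a b d' m w e IE e'.
have [_ d0 dE] := e; have [_ d'0 d'E] := e'.
have bb : blk a b b by rewrite /blk /= ab leqnn.
have d'b : d' b = +oo%E.
  case d'b: (d' b) (d'0 _ bb) => [w| |//] //; rewrite lee_fin => w0.
  have db : d b = w%:E by apply/ag => //; rewrite yL // subrK.
  have uw : u <= w by move: pb; rewrite /present db lee_fin.
  have [[j mj] _] := (d'E _ _ bb w0).1 d'b; case: (mj) => /eqP bj _ pj yj.
  have /andP[aj _] := present_dom e' pj; case: bj.
  apply: (same_velocity yj); rewrite vb; apply/esym; have xaj := xle aj.
  move: yba yj; rewrite /location vb; case: (vP j) => -> //; lra.
split=> [d'k|->//]; apply: contrapT => kb.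
have /andP[ak kb'] := bk; have {kb kb'}kb : (k < b)%N.
  by rewrite ltn_neqAle kb' andbT; apply/eqP.
(* A second immortal [k < b] is either left-moving, and then gets past [x a] against minimality, or
   stands in the way of [b]. *)
have [vk|vk] : v k = -1 \/ v k != -1 by case: (eqVneq (v k) (-1)) => h; [left|right].
  apply: nm; exists k; split => //; exists (x k - x a + 1).
  have xak := xle ak; split; [lra| |by rewrite yL //; lra].
  apply: present_oo; have Ik : I k by apply/IE => //; exact: ltnW.
  case dk: (d k) (d0 _ Ik) => [w| |//] //; rewrite lee_fin => w0.
  have : d' k = w%:E by apply/(ag k) => //; rewrite yL // subrK xle // ltnW.
  by rewrite d'k.
pose w := x b - x a + 1; have xab := xle ab; have xak := xle ak.
have w0 : 0 <= w by rewrite /w; lra.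
have := no_crossing_le e' w0 (ltnW kb) (present_oo w d'k) (present_oo w d'b).
rewrite (yL _ vb) /w /location; case: (vP k) vk => -> /eqP // _; lra.
Qed.

(** The fate of the left-moving [b] does not depend on the particles behind it, so [b] is immortal
    in the larger block too. *)
Lemma Hit_unique a b b' : Hit x v s a b -> Hit x v s a b' -> b = b'.
Proof.
wlog bb : b b' / (b <= b')%N.
  by move=> W H H'; case/orP: (leq_total b b') => h; [|apply/esym]; apply: W.
move=> [ab vb [d e dE]] [ab' vb' [d' e' d'E]].
have bkb : blk a b b by rewrite /blk /= ab leqnn.
have bkb' : blk a b' b by rewrite /blk /= ab.
apply/(d'E _ bkb'); have [_ d'0 _] := e'.
case d'b: (d' b) (d'0 _ bkb') => [w| |//] //; rewrite lee_fin => w0.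
have : d b = w%:E.
  apply/(@agree_left (blk a b') d' a b d b w) => //.
    by move=> k kb; rewrite /blk /= (leq_trans kb bb) andbT.
  by rewrite yL // subrK.
by rewrite ((dE b bkb).2 erefl).
Qed.

Lemma blk_join a b c : (a <= b.+1)%N -> (b <= c)%N ->
  blk a b `|` blk b.+1 c = blk a c.
Proof. by move=> ab bc; apply/seteqP; split=> n; rewrite /blk /=; lia. Qed.

Lemma blk_disj a b c n : blk a b n -> ~ blk b.+1 c n.
Proof. by rewrite /blk /=; lia. Qed.

Lemma glueL I d1 d2 n : I n -> glue I d1 d2 n = d1 n.
Proof. by move=> In; rewrite /glue mem_set. Qed.

Lemma glueR I d1 d2 n : ~ I n -> glue I d1 d2 n = d2 n.
Proof. by move=> In; rewrite /glue memNset. Qed.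

Lemma evol_append a b c d1 d2 : (a <= b)%N -> (b <= c)%N ->
  evol x v s (blk a b) d1 -> evol x v s (blk b.+1 c) d2 ->
  (forall m u, blk a b m -> 0 <= u -> present d1 m u -> y m u <= x b - u) ->
  evol x v s (blk a c) (glue (blk a b) d1 d2).
Proof.
move=> ab bc e1 e2 conf; rewrite -(blk_join (leqW ab) bc).
apply: evol_glue => //; first by move=> n; exact: blk_disj.
move=> i j u u0 bi /andP[bj _] pi _ yij; exfalso.
by have := conf i u bi u0 pi; have := y_ge j u0; have := xlt bj; rewrite yij; lra.
Qed.

(** Renewal: the clear block dies out unnoticed, so arrivals at its left end are those of the
    process started after it. This is the source of the convolutions with an arrival among the
    remaining particles. *)
Lemma clear_Hit a b n : clear x v s a b -> (b <= n)%N ->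
  Hit x v s a n <-> ((b < n)%N /\ Hit x v s b.+1 n).
Proof.
move=> [ab [d1 e1 d1P]] bn; have [d2 e2] := blk_exists b.+1 n.
have conf m u : blk a b m -> 0 <= u -> present d1 m u -> y m u <= x b - u.
  by move=> /d1P[_]; exact.
have e := evol_append ab bn e1 e2 conf.
have an := leq_trans ab bn.
have sub m : blk b.+1 n m -> blk a n m by rewrite /blk /=; lia.
have JR m : blk b.+1 n m -> glue (blk a b) d1 d2 m = d2 m.
  by move=> bm; apply: glueR => /blk_disj; apply; exact: bm.
split => [[_ vn [d' e' d'E]]|[{}bn [_ vn [d2' e2' d2E]]]].
  rewrite (blk_unique e' e) in d'E.
  have {}bn : (b < n)%N.
    move: bn; rewrite leq_eqVlt => /predU1P[bn|//]; subst n.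
    have bb : blk a b b by rewrite /blk /= ab leqnn.
    by have := (d'E b bb).2 erefl; rewrite glueL // => h; have [] := d1P b bb; rewrite h.
  split=> //; split=> //; exists d2 => // m bm.
  by rewrite -d'E ?JR //; exact: sub.
rewrite (blk_unique e2' e2) in d2E.
split=> //; exists (glue (blk a b) d1 d2) => // m bm.
have [bm'|/negP bm'] := boolP (a <= m <= b)%N.
  rewrite glueL //; split=> [h|h]; first by have [] := d1P m bm'; rewrite h.
  by move: bm'; rewrite h; lia.
have bm2 : blk b.+1 n m by move: bm bm'; rewrite /blk /=; lia.
by rewrite JR // d2E.
Qed.

(** * Static obstacles, mutual annihilation and clear blocks *)

Lemma Esc_dead a b d m u : evol x v s (blk a b) d -> v a = 1 ->
  (forall n, blk a b n -> (d n = +oo%E <-> n = a)) -> blk a b m -> m != a ->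
  0 <= u -> present d m u -> x a + u <= y m u <= x b.
Proof.
move=> e va da bm ma u0 pm; have /andP[am mb] := bm.
have ba : blk a b a by rewrite /blk /= leqnn (leq_trans am mb).
apply/andP; split; last first.
  by apply: (Esc_bounded e _ bm ma u0 pm) => n /da[].
rewrite -(yR _ va); apply: (no_crossing_le e u0 am _ pm).
by apply: present_oo; apply/da.
Qed.

(** The other particles are caught between [a] and [x k], so they never reach [x k.+1] and are dead
    before [a] gets there. *)
Lemma Esc_collide a k : Esc x v s a k -> v k.+1 = 0 ->
  let t := x k.+1 - x a in
  exists d, [/\ evol x v s (blk a k.+1) d, d a = t%:E, d k.+1 = t%:E,
    forall m u, 0 <= u -> present d m u -> y m u <= x k.+1 &
    forall m u, 0 <= u -> present d m u ->
      u <= t /\ (m != a -> m != k.+1 -> u < t)].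
Proof.
move=> [ak va [d e dE]] vz t.
have ba : blk a k a by rewrite /blk /= leqnn ak.
have xaz : x a < x k.+1 by apply: xlt; rewrite ltnS.
have xkz : x k < x k.+1 by apply: xlt.
have dead m u := @Esc_dead a k d m u e va dE.
have az : a != k.+1 by apply/eqP; lia.
have t0 : 0 <= t by rewrite /t; lra.
have dom m u : present d m u -> blk a k m by move/(present_dom e).
have -> : blk a k.+1 = blk a k `|` [set k.+1].
  by apply/seteqP; split => n; rewrite /blk /=; lia.
exists (fun n => if (n == a) || (n == k.+1) then t%:E else d n); split.
- apply: (evol_collide e ba) => //.
  + exact/(dE _ ba).
  + by rewrite /blk /=; lia.
  + by rewrite (yR _ va) /t addrC subrK.
  + move=> m u ma /andP[u0 ut] pm; rewrite lt_eqF //.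
    by have /andP[_ h] := dead m u (dom _ _ pm) ma u0 pm; apply: le_lt_trans xkz.
  + move=> m u ma ut pm; rewrite lt_eqF //.
    have u0 : 0 <= u by lra.
    have /andP[_ h] := dead m u (dom _ _ pm) ma u0 pm.
    by rewrite (yR _ va); apply: le_lt_trans h _; rewrite /t in ut; lra.
- by rewrite eqxx.
- by rewrite eqxx orbT.
- move=> m u u0; rewrite /present; have [->|ma] := eqVneq m a.
    by rewrite /= lee_fin (yR _ va) /t; lra.
  have [->|mz] := eqVneq m k.+1; first by rewrite /= (yS _ vz).
  by move=> pm; have /andP[_ h] := dead m u (dom _ _ pm) ma u0 pm; rewrite /=; lra.
- move=> m u u0; rewrite /present; have [->|ma] := eqVneq m a.
    by rewrite /= lee_fin; split.
  have [->|mz] := eqVneq m k.+1; first by rewrite /= lee_fin; split.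
  move=> pm; have /andP[h h'] := dead m u (dom _ _ pm) ma u0 pm.
  by rewrite /t; split => [|_ _]; lra.
Qed.

Lemma Esc_remove a k : Esc x v s a k ->
  exists2 d, evol x v s (blk a.+1 k) d &
    forall m u, 0 <= u -> present d m u ->
      [/\ y m u <= x k & u < x k.+1 - x a].
Proof.
move=> [ak va [d e dE]].
have ba : blk a k a by rewrite /blk /= leqnn ak.
have xkz : x k < x k.+1 by apply: xlt.
have -> : blk a.+1 k = blk a k `\ a.
  apply/seteqP; split => n; rewrite /blk /=; first by move=> ?; split=> [|/eqP]; lia.
  by case=> ? /eqP; lia.
exists (fun n => if n == a then -oo%E else if n == a then +oo%E else d n).
  apply: (evol_remove e ba va); last by rewrite eqxx.
  by move=> u j; rewrite ((dE _ ba).2 erefl).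
move=> m u u0; rewrite /present; case: eqP => [_|/eqP ma pm]; first by rewrite leeNy_eq.
by have /andP[] := Esc_dead e va dE (present_dom e pm) ma u0 pm; split => //; lra.
Qed.

(** A third particle alive at time [t] is squeezed between [a] and [b], hence at their meeting
    point, and static. Its spin would then let [a] or [b] survive. *)
Lemma Pair_dead a b d m u : let t := (x b - x a) / 2 in
  evol x v s (blk a b) d -> (a < b)%N -> v a = 1 -> v b = -1 ->
  d a = t%:E -> d b = t%:E -> 0 <= u -> present d m u -> m != a -> m != b -> u < t.
Proof.
move=> t e ab va vb da db u0 pm ma mb; rewrite ltNge; apply/negP => tu.
have xab := xlt ab; have t0 : 0 <= t by rewrite /t; lra.
have /andP[am mb'] := present_dom e pm.
have pa : present d a t by rewrite /present da.
have pb : present d b t by rewrite /present db.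
have {}pm : present d m t by apply: present_le pm.
have := no_crossing_le e t0 am pa pm; have := no_crossing_le e t0 mb' pm pb.
rewrite (yL _ vb) (yR _ va) => h h'.
have ym : y m t = y a t by rewrite (yR _ va) /t in h h' *; lra.
have yb : y m t = y b t by rewrite (yL _ vb) /t in h h' *; lra.
have vm : v m = 0.
  case: (vP m) => // vm; first by case/eqP: mb; apply: (same_velocity yb); rewrite vm.
  by case/eqP: ma; apply: (same_velocity ym); rewrite vm.
have ba : blk a b a by rewrite /blk /=; lia.
have bb : blk a b b by rewrite /blk /=; lia.
have mam : meet x v d t a m by split; rewrite // eq_sym.
have mbm : meet x v d t b m by split; rewrite // eq_sym.
have mab : meet x v d t a b.
  by split => //; [apply/eqP; lia|rewrite -ym].
have [_ _ dE] := e.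
have [_ nSa] := (dE _ _ ba t0).1 da; have [_ nSb] := (dE _ _ bb t0).1 db.
case: (sP m) => sm.
  by apply: nSb; exists m, a; split; rewrite ?va ?vb ?opprK //; exact: meet_sym.
by apply: nSa; exists m, b; split; rewrite ?va ?vb.
Qed.

Lemma clear_Pair a b : Pair x v s a b -> clear x v s a b.
Proof.
move=> [ab va vb [d e [da db]]]; split; first exact: ltnW.
exists d => // m bm; set t := (x b - x a) / 2 in da db.
have xab := xlt ab; have t0 : 0 <= t by rewrite /t; lra.
have ut u : 0 <= u -> present d m u -> u <= t.
  move=> u0 pm; have [ma|ma] := eqVneq m a.
    by move: pm; rewrite /present ma da lee_fin.
  have [mb|mb] := eqVneq m b; first by move: pm; rewrite /present mb db lee_fin.
  by apply/ltW/(Pair_dead e ab va vb da db u0 pm).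
split.
  apply/eqP => dm; have t1 : 0 <= t + 1 by lra.
  by have := ut _ t1 (present_oo _ dm); lra.
move=> u u0 pm; rewrite -(yL _ vb); have /andP[_ mb] := bm.
apply: (no_crossing_le e u0 mb pm).
by rewrite /present db lee_fin; exact: ut.
Qed.

(** [evol_remove] with partner [b], which the removal of [a] frees at a time when all others are
    dead. *)
Lemma Pair_remove a b : Pair x v s a b -> Hit x v s a.+1 b.
Proof.
move=> [ab va vb [d e [da db]]]; set t := (x b - x a) / 2 in da db.
have xab := xlt ab; have t0 : 0 <= t by rewrite /t; lra.
have ba : blk a b a by rewrite /blk /=; lia.
have dead m u := @Pair_dead a b d m u e ab va vb da db.
split => //.
have -> : blk a.+1 b = blk a b `\ a.
  apply/seteqP; split => n; rewrite /blk /=; first by move=> ?; split=> [|/eqP]; lia.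
  by case=> ? /eqP; lia.
exists (fun n => if n == a then -oo%E else if n == b then +oo%E else d n).
  apply: (evol_remove e ba va).
    move=> u j; rewrite da => -[<-] [ja _ pj _]; apply/eqP/negPn/negP => jb.
    by have := dead j t t0 pj; rewrite eq_sym ja jb ltxx => /(_ isT isT).
  move=> _; split=> //; first by rewrite da db.
    move=> u; rewrite da => -[<-]; split; rewrite ?/present ?da ?db //.
      by apply/eqP; lia.
    by rewrite (yL _ vb) (yR _ va) /t; lra.
  move=> m u ma mb; rewrite db lte_fin => tu pm.
  by have := dead m u (ltW (le_lt_trans t0 tu)) pm ma mb; rewrite ltNge ltW.
move=> m [bm /eqP ma]; rewrite (negbTE ma); case: eqP => // /eqP mb.
split=> [dm|/eqP]; last by rewrite (negbTE mb).
by have := dead m t t0 (present_oo _ dm) ma mb; rewrite ltxx.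
Qed.

(** The arriving [k] and the static [a] annihilate each other, since in [a.+1..k] only [k] gets to
    the left of [x a.+1]. *)
Lemma clear_static a k : v a = 0 -> Hit x v s a.+1 k -> clear x v s a k.
Proof.
move=> va [ak vk [d e dE]]; split; first exact: ltnW.
have bk : blk a.+1 k k by rewrite /blk /= ak leqnn.
have dk : d k = +oo%E by apply/dE.
have xak := xlt ak; have xa1 := xlt (ltnSn a).
have dom m u : present d m u -> blk a.+1 k m by move/(present_dom e).
have bd m u : m != k -> 0 <= u -> present d m u -> x a.+1 <= y m u.
  by move=> mk u0 pm; apply: (Hit_bounded e _ (dom _ _ pm)) => // n /dE[].
have -> : blk a k = blk a.+1 k `|` [set a].
  by apply/seteqP; split => n; rewrite /blk /=; lia.
set t := x k - x a.
exists (fun n => if (n == k) || (n == a) then t%:E else d n).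
  apply: (evol_collide e bk dk) => //.
  - by rewrite /blk /=; lia.
  - by rewrite /t; lra.
  - by rewrite (yL _ vk) /t; lra.
  - by move=> m u mk /andP[u0 _] pm; rewrite gt_eqF // (lt_le_trans xa1) // bd.
  - move=> m u mk tu pm; have u0 : 0 <= u by rewrite /t in tu; lra.
    rewrite gt_eqF // (lt_le_trans _ (bd _ _ mk u0 pm)) //.
    by rewrite (yL _ vk); rewrite /t in tu; lra.
move=> m bm; split.
  case: ifPn => //; rewrite negb_or => /andP[mk ma].
  apply: contra mk => /eqP dm; apply/eqP/dE => //.
  by case: bm => // /eqP; rewrite (negbTE ma).
move=> u u0; rewrite /present; have [->|mk] := eqVneq m k.
  by rewrite (yL _ vk).
have [->|ma] /= := eqVneq m a.
  by rewrite lee_fin (yS _ va) /t; lra.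
by move=> pm; apply: (Hit_confined e) => //; apply: dom; exact: pm.
Qed.

(** A particle from the right entering the region of the left block would yield a [Hit] on [z.+1] by
    [arrival]; without one the two sides never meet. *)
Lemma no_arrival a z n d1 d2 : (a <= z)%N -> (z <= n)%N ->
  evol x v s (blk a z) d1 -> evol x v s (blk z.+1 n) d2 ->
  (forall m u, 0 <= u -> present d1 m u -> y m u <= x z) ->
  (forall j, (j <= n)%N -> ~ Hit x v s z.+1 j) ->
  evol x v s (blk a n) (glue (blk a z) d1 d2).
Proof.
move=> az zn e1 e2 bd nH; rewrite -(blk_join (leqW az) zn).
apply: evol_glue => //; first by move=> i; exact: blk_disj.
move=> i j u u0 bi bj pi pj yij; exfalso.
have := bd i u u0 pi; rewrite yij => yj.
have /andP[zj jn] := bj; have xzj := xlt zj.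
have vj : v j = -1 by move: yj; rewrite /location; case: (vP j) => -> //; lra.
have IE k : (k <= j)%N -> blk z.+1 n k <-> (z < k)%N.
  by move=> kj; rewrite /blk /= (leq_trans kj jn) andbT.
have yz : y j u < x z.+1 by apply: le_lt_trans yj _; exact: xlt.
have [k [/andP[_ kj]]] := arrival e2 zj IE vj u0 pj yz.
by apply: nH; exact: leq_trans jn.
Qed.

Lemma no_arrival_Hit a z n d1 : (a <= z)%N -> (z <= n)%N -> v z = 0 ->
  evol x v s (blk a z) d1 ->
  (forall m u, 0 <= u -> present d1 m u -> y m u <= x z) ->
  (forall j, (j <= n)%N -> ~ Hit x v s z.+1 j) -> ~ Hit x v s a n.
Proof.
move=> az zn vz e1 bd nH [an vn [d e dE]].
have [d2 e2] := blk_exists z.+1 n.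
rewrite (blk_unique e (no_arrival az zn e1 e2 bd nH)) in dE.
have {}zn : (z < n)%N.
  rewrite ltn_neqAle zn andbT; apply/eqP => zn'; move: vn.
  by rewrite -zn' vz; lra.
have bn : blk a n n by rewrite /blk /= an leqnn.
have := (dE n bn).2 erefl; rewrite glueR; last by rewrite /blk /=; lia.
move=> d2n.
pose u := x n - x z; have xzn := xlt zn.
have u0 : 0 <= u by rewrite /u; lra.
have IE k : (k <= n)%N -> blk z.+1 n k <-> (z < k)%N.
  by move=> kn; rewrite /blk /= kn andbT.
have yz : y n u < x z.+1 by rewrite (yL _ vn) /u; have := xlt (ltnSn z); lra.
have [k [/andP[_ kj]]] := arrival e2 zn IE vn u0 (present_oo u d2n) yz.
exact: nH.
Qed.

(** Except for a tie, the left block is over before [j] reaches the static particle. In a tie, [j]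
    survives the triple collision: the cross meeting allowed by [evol_glue]. *)
Lemma static_block a k j : Esc x v s a k -> v k.+1 = 0 -> Hit x v s k.+2 j ->
  late x s a k.+1 j ->
  exists d, [/\ evol x v s (blk a j) d,
    forall m, blk a j m -> (d m = +oo%E <-> m = j),
    d a = (x k.+1 - x a)%:E & d k.+1 = (x k.+1 - x a)%:E].
Proof.
move=> E vz [zj vj [d2 e2 d2E]] L.
have [d1 [e1 d1a d1z bd dead]] := Esc_collide E vz.
set z := k.+1 in vz zj d2 e2 d2E L d1 e1 d1a d1z bd dead *; set t := x z - x a in dead d1a d1z *.
have [ak va _] := E; have az : (a < z)%N by rewrite ltnS.
have ba : blk a z a by rewrite /blk /=; lia.
have bz : blk a z z by rewrite /blk /=; lia.
have bj : blk z.+1 j j by rewrite /blk /=; lia.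
have xaz := xlt az; have xzj := xlt zj; have xz1 := xlt (ltnSn z).
have d2j : d2 j = +oo%E by apply/d2E.
exists (glue (blk a z) d1 d2); split; rewrite ?glueL //; last first.
  move=> m bm; have [bm1|/negP bm1] := boolP (a <= m <= z)%N.
    rewrite glueL //; split=> [dm|mj]; last by move: bm1; rewrite mj; lia.
    have t1 : 0 <= t + 1 by rewrite /t; lra.
    by exfalso; have [h _] := dead m (t + 1) t1 (present_oo _ dm); lra.
  by rewrite glueR //; apply: d2E; move: bm bm1; rewrite /blk /=; lia.
rewrite -(blk_join (leqW (ltnW az)) (ltnW zj)).
apply: evol_glue => //; first by move=> i; exact: blk_disj.
move=> i j' u u0 bi bj' pi pj yij.
have yi : y i u <= x z := bd i u u0 pi; have [ut ut'] := dead i u u0 pi.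
have jj : j' = j.
  apply/eqP/negPn/negP => jj.
  have := Hit_bounded e2 (fun n bn => (d2E n bn).1) bj' jj u0 pj.
  by rewrite -yij; lra.
subst j'; rewrite yij (yL _ vj) in yi.
(* A strictly later [j] is still to the right of [x z] when the left block has died out. *)
case: L => [L|[L sz]]; first by exfalso; rewrite -/t in L; lra.
have uE : u = t by rewrite -/t in L; lra.
subst u; have iaz : i = a \/ i = z.
  have [->|ia] := eqVneq i a; first by left.
  have [->|iz] := eqVneq i z; first by right.
  by have := ut' ia iz; rewrite ltxx.
have pa : present (glue (blk a z) d1 d2) a t by rewrite /present glueL // d1a.
have pz : present (glue (blk a z) d1 d2) z t by rewrite /present glueL // d1z.
have pj' : present (glue (blk a z) d1 d2) j t by rewrite /present glueR //; rewrite /blk /=; lia.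
have yz : location x v j t = location x v z t.
  by rewrite (yL _ vj) (yS _ vz); rewrite -/t in L; lra.
have ya : location x v a t = location x v z t.
  by rewrite (yR _ va) (yS _ vz) /t; lra.
split => //; first by case: iaz => ->.
  exists z, a; split; rewrite ?va ?vj ?opprK ?sz //; split => //; last by rewrite ya.
    by apply/eqP; lia.
  by apply/eqP; lia.
case: iaz => ->; last exact: (static_not_survivor).
move=> [i' [k' [[_ _ _ yi'] _ vi' _ si']]].
have i'z : i' = z by apply: (same_velocity (t := t)); rewrite ?vi' ?vz // -yi' ya.
by move: si'; rewrite i'z sz va; lra.
Qed.

(** Without [a], the static particle waits for [j] and both vanish. One arrival is thus absorbed,
    whence the additional [hit] after [halt] in [hit_behind]. *)
Lemma clear_after_static a k j : Esc x v s a k -> v k.+1 = 0 ->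
  Hit x v s k.+2 j -> late x s a k.+1 j -> clear x v s a.+1 j.
Proof.
move=> E vz [zj vj [d2 e2 d2E]] L.
have [d0 e0 d0P] := Esc_remove E; have [ak va _] := E.
have {}d0P m u : 0 <= u -> present d0 m u -> y m u <= x k /\ u < x k.+1 - x a.
  by move=> u0 /(d0P _ _ u0)[].
set z := k.+1 in vz zj d2 e2 d2E L d0P *.
have az : (a < z)%N by rewrite ltnS.
have bj : blk z.+1 j j by rewrite /blk /=; lia.
have xaz := xlt az; have xzj := xlt zj; have xz1 := xlt (ltnSn z).
have xkz : x k < x z by apply: xlt.
have d2j : d2 j = +oo%E by apply/d2E.
(* Both cases of [late] give this inequality, by which the particles left of [z] are dead when [j]
   reaches it. *)
have {}L : x z - x a <= x j - x z by case: L => [/ltW//|[->]].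
have dom2 m u : present d2 m u -> blk z.+1 j m by move/(present_dom e2).
have bd2 m u : m != j -> 0 <= u -> present d2 m u -> x z.+1 <= y m u.
  by move=> mj u0 pm; apply: (Hit_bounded e2 (fun n bn => (d2E n bn).1) (dom2 _ _ pm) mj u0 pm).
have e : evol x v s (blk a.+1 k `|` blk z.+1 j) (glue (blk a.+1 k) d0 d2).
  apply: evol_glue => //; first by move=> n; rewrite /blk /= /z; lia.
  move=> i j' u u0 bi bj' pi pj yij.
  have [yi ut] := d0P i u u0 pi; exfalso.
  have [jj|jj] := eqVneq j' j; last by have := bd2 _ _ jj u0 pj; rewrite -yij; lra.
  by move: yij; rewrite jj (yL _ vj); lra.
set d := glue _ _ _ in e.
have bj1 : ~ blk a.+1 k j by rewrite /blk /=; lia.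
have dj : d j = +oo%E by rewrite /d glueR.
have P m u : present d m u -> 0 <= u -> m != j ->
    (blk a.+1 k m /\ (y m u <= x k /\ u < x z - x a)) \/
    (blk z.+1 j m /\ (present d2 m u /\ x z.+1 <= y m u)).
  rewrite /present => pm u0 mj.
  case: (present_dom e pm) => bm; [left|right]; split => //; move: pm.
    by rewrite /d glueL // => /(d0P _ _ u0)[].
  rewrite /d glueR; last by move: bm; rewrite /blk /= /z; lia.
  by move=> pm; split => //; exact: bd2.
split; first by lia.
have -> : blk a.+1 j = (blk a.+1 k `|` blk z.+1 j) `|` [set z].
  by apply/seteqP; split => n; rewrite /blk /= /z; lia.
pose t := x j - x z.
have t0 : 0 <= t by rewrite /t; lra.
exists (fun n => if (n == j) || (n == z) then t%:E else d n).
  apply: (evol_collide e) => //; first by right.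
  - by rewrite /blk /= /z; lia.
  - by rewrite (yL _ vj) /t; lra.
  - move=> m u mj /andP[u0 ut] pm.
    case: (P _ _ pm u0 mj) => -[_ []] h h'; first by rewrite lt_eqF //; lra.
    by rewrite gt_eqF //; lra.
  - move=> m u mj ut pm; have u0 : 0 <= u by lra.
    case: (P _ _ pm u0 mj) => -[_ []] h h'; first by rewrite /t in ut; lra.
    by rewrite gt_eqF // (yL _ vj); rewrite /t in ut; lra.
move=> m bm; split.
  case: ifPn => //; rewrite negb_or => /andP[mj mz]; apply/eqP => dm.
  case: (P _ _ (present_oo (x z - x a) dm) _ mj); first by lra.
    by case=> _ []; rewrite ltxx.
  move=> [bm2 _]; move: dm; rewrite /d glueR; last by move: bm2; rewrite /blk /= /z; lia.
  by move/(d2E _ bm2)/eqP; rewrite (negbTE mj).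
move=> u u0; rewrite /present ; have [->|mj] := eqVneq m j.
  by rewrite (yL _ vj).
have [->|mz] /= := eqVneq m z; first by rewrite lee_fin (yS _ vz) /t; lra.
move=> pm; case: (P _ _ pm u0 mj) => -[bm2 []]; first by lra.
by move=> pm2 _; apply: (Hit_confined e2 vj d2j bm2 u0 pm2).
Qed.

(** * The fate of a right-moving first particle *)

(** If [a] dies, it is at a static particle or, failing that, against a left-moving one. In the
    static case, an earlier arrival from the right would have removed the obstacle, and a tie with
    spin +1 would have saved [a]; whence [late]. *)
Lemma fate a n d : (a <= n)%N -> evol x v s (blk a n) d -> v a = 1 ->
  [\/ d a = +oo%E,
      exists2 b, (b <= n)%N & Pair x v s a b |
      exists k, [/\ (k < n)%N, Esc x v s a k, v k.+1 = 0 &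
        forall j, (j <= n)%N -> Hit x v s k.+2 j -> late x s a k.+1 j]].
Proof.
move=> an e va; have ba : blk a n a by rewrite /blk /= leqnn.
have [_ d_ge0 dE] := e.
case da: (d a) (d_ge0 _ ba) => [t| |] //; last by move=> _; apply: Or31.
rewrite lee_fin => t0.
have [[b mab] nSa] := (dE _ _ ba t0).1 da.
have gta m u : 0 <= u -> meet x v d u a m -> [/\ (a < m)%N, (m <= n)%N, x a < x m & v m != 1].
  move=> u0 [am _ /(present_dom e)/andP[am' mn] yam].
  have am2 : (a < m)%N by rewrite ltn_neqAle am.
  split => //; first exact: xlt.
  by apply: contra am => /eqP vm; apply/eqP/(same_velocity yam); rewrite va.
have [[z [maz vz]]|nst] := pselect (exists z, meet x v d t a z /\ v z = 0).
  apply: Or33; have [az zn xaz _] := gta _ _ t0 maz.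
  have dz : d z = t%:E by apply: (static_dies e t0 (meet_sym maz) vz).
  have tE : x z = x a + t by case: maz => _ _ _; rewrite (yR _ va) (yS _ vz).
  have bz : blk a n z by rewrite /blk /=; lia.
  have pz u : u <= t -> present d z u by rewrite /present dz lee_fin.
  have pa u : u <= t -> present d a u by rewrite /present da lee_fin.
  (* Until time [t], the static particle [z] separates its two sides. *)
  have sepL m j u : 0 <= u -> u < t -> (m < z)%N -> present d m u -> present d j u ->
      y m u = y j u -> (j < z)%N.
    move=> u0 ut mz pm pj ymj; rewrite ltnNge; apply/negP => zj.
    have h := no_crossing_le e u0 zj (pz _ (ltW ut)) pj.
    have h' := no_crossing_le e u0 (ltnW mz) pm (pz _ (ltW ut)).
    have mzm : meet x v d u z m.
      split => //; [by apply/eqP; lia|exact/pz/ltW|].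
      by apply/eqP; rewrite eq_le h' andbT ymj.
    by have := static_dies e u0 mzm vz; rewrite dz => -[ut']; rewrite ut' ltxx in ut.
  have sepR m j u : 0 <= u -> u < t -> (z < m)%N -> present d m u -> present d j u ->
      y m u = y j u -> (z < j)%N.
    move=> u0 ut zm pm pj ymj; rewrite ltnNge; apply/negP => jz.
    have h := no_crossing_le e u0 jz pj (pz _ (ltW ut)).
    have h' := no_crossing_le e u0 (ltnW zm) (pz _ (ltW ut)) pm.
    have mzm : meet x v d u z m.
      split => //; [by apply/eqP; lia|exact/pz/ltW|].
      by apply/eqP; rewrite eq_le h' /= ymj.
    by have := static_dies e u0 mzm vz; rewrite dz => -[ut']; rewrite ut' ltxx in ut.
  have zE : z.-1.+1 = z by rewrite prednK // (leq_ltn_trans _ az).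
  exists z.-1; rewrite zE; split => //.
  - split => //; first by lia.
    have [d' e'] := blk_exists a z.-1; exists d' => // m bm.
    (* Before [t] the static [z] is a wall: the particles to its left evolve as in their own
       block. *)
    have agr i u : blk a z.-1 i -> 0 <= u -> u < t -> d i = u%:E <-> d' i = u%:E.
      move=> bi u0 ut.
      apply: (@evol_agree _ _ d d' (fun m u => blk a z.-1 m /\ u < t) n.+1 e e') => //.
      + by move=> m' u' [bm' _]; split => //; move: bm'; rewrite /blk /=; lia.
      + by move=> m' u1 u2 [bm' ut1] /andP[_ u21]; split => //; exact: le_lt_trans ut1.
      + move=> m' j u' u'0 [bm' ut'] bj pm' pj yj; split => //.
        have mz : (m' < z)%N by move: bm'; rewrite /blk /=; lia.
        by have := sepL _ _ _ u'0 ut' mz pm' pj yj; move: bj; rewrite /blk /=; lia.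
      + by move=> m' j u' u'0 [_ ut'].
    have ba' : blk a z.-1 a by rewrite /blk /=; lia.
    have [_ d'_ge0 d'E] := e'.
    (* At time [t], [a] is at [x z], beyond all starting points of the block; only a right-moving
       particle can still be ahead, and [a] never catches up with it. *)
    have d'a : d' a = +oo%E.
      case d'a: (d' a) (d'_ge0 _ ba') => [w| |//] //; rewrite lee_fin => w0.
      have [wt|tw] := ltP w t.
        by move/(agr _ _ ba' w0 wt): d'a; rewrite da => -[tw]; rewrite tw ltxx in wt.
      have [[i mi] _] := (d'E _ _ ba' w0).1 d'a.
      case: (mi) => /eqP ai pa' pi yi; case: ai.
      have /andP[ai iz] := present_dom e' pi.
      have pat : present d' a t by apply: present_le pa'.
      have pit : present d' i t by apply: present_le pi.
      have := no_crossing_le e' t0 ai pat pit.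
      rewrite (yR _ va) -tE => yz.
      have xiz : x i < x z by apply: xlt; lia.
      apply: (same_velocity yi); rewrite va.
      by move: yz; rewrite /location; case: (vP i) => -> //; lra.
    split=> [d'm|->//]; apply: contrapT => /eqP ma.
    have /andP[am mz] := bm.
    have am' : (a < m)%N by rewrite ltn_neqAle eq_sym ma.
    have xam := xlt am'; have xmz : x m < x z by apply: xlt; lia.
    (* An immortal [m] stays ahead of the immortal [a], hence moves right, and would have passed the
       static [z] by time [t]. *)
    have vm : v m = 1.
      pose w := x m - x a + 1; have w0 : 0 <= w by rewrite /w; lra.
      have := no_crossing_le e' w0 am (present_oo w d'a) (present_oo w d'm).
      rewrite (yR _ va) /w /location; case: (vP m) => -> //; lra.
    have bmn : blk a n m by rewrite /blk /=; lia.
    have pm : present d m t.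
      rewrite /present leNgt; apply/negP => dm.
      case dmE: (d m) (d_ge0 _ bmn) dm => [w| |//] //; rewrite lee_fin lte_fin => w0 wt.
      by have := (agr m w bm w0 wt).1 dmE; rewrite d'm.
    have := no_crossing_le e t0 (_ : (m <= z)%N) pm (pz t (lexx t)).
    by rewrite (yR _ vm) (yS _ vz) => /(_ ltac:(lia)); lra.
  - move=> j jn [zj vj [dR eR dRE]]; rewrite /late.
    have xzj := xlt zj; have bj : blk z.+1 j j by rewrite /blk /=; lia.
    have dRj : dR j = +oo%E by apply/dRE.
    have bjn : blk a n j by rewrite /blk /=; lia.
    have pj : present d j t.
      rewrite /present leNgt; apply/negP => dj.
      case djE: (d j) (d_ge0 _ bjn) dj => [w| |//] //; rewrite lee_fin lte_fin => w0 wt.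
      suff : dR j = w%:E by rewrite dRj.
      (* Particles right of [z], before [t], in the past of the trajectory of [j]: the wall [z] and
         the speed bound isolate them from the rest. *)
      apply/(@evol_agree _ _ d dR
        (fun m u => [/\ blk z.+1 j m, y m u + u <= x j & u < t]) n.+1 e eR) => //.
      + by move=> m' u' [bm' _ _]; split => //; move: bm'; rewrite /blk /=; lia.
      + move=> m' u1 u2 [bm' ym ut1] /andP[u20 u21]; split => //; last by apply: le_lt_trans ut1.
        apply: le_trans ym; rewrite /location; case: (vP m') => ->; lra.
      + move=> m' j' u' u'0 [bm' ym ut'] bj' pm' pj' yj'.
        have zm : (z < m')%N by case/andP: bm'.
        have zj' := sepR _ _ _ u'0 ut' zm pm' pj' yj'.
        have ym' : y j' u' + u' <= x j by rewrite -yj'.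
        split => //; rewrite /blk /= zj' /= leqNgt; apply/negP => /xlt.
        by have := y_ge j' u'0; lra.
      + move=> m' j' u' u'0 [bm' ym ut'] bj' pm' pj' yj'; split => //.
        by rewrite -yj'.
      + by split => //; rewrite (yL _ vj); lra.
    have [Dt|tD] := ltP (x j - x z) (x z - x a).
      have D0 : 0 <= x j - x z by lra.
      have mzj : meet x v d (x j - x z) z j.
        split; [by apply/eqP; lia|apply: pz; lra|apply: present_le pj; lra|].
        by rewrite (yS _ vz) (yL _ vj); lra.
      by have := static_dies e D0 mzj vz; rewrite dz => -[]; lra.
    have [tD'|tD'] := ltP (x z - x a) (x j - x z); [by left|right].
    split; first by lra.
    case: (sP z) => // sz; case: nSa; exists z, j; split; rewrite ?va //.
    split => //; [by apply/eqP; lia|exact: pa|].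
    by rewrite (yR _ va) (yL _ vj); lra.
apply: Or32; have [ab bn xab vb1] := gta _ _ t0 mab.
have vb : v b = -1.
  case: (vP b) vb1 => // [vb|->]; last by rewrite eqxx.
  by case: nst; exists b.
have tE : t = (x b - x a) / 2.
  by case: mab => _ _ _; rewrite (yR _ va) (yL _ vb); lra.
have db : d b = t%:E.
  have [//|[i [k [[_ _ pi yi] _ vi _ _]]]] := dies e t0 (meet_sym mab).
  case: nst; exists i; split => //; case: mab => _ pa _ yab; split => //.
    by apply: contra_eq_neq vi => <-; rewrite va oner_neq0.
  by rewrite yab.
exists b => //; split => //.
have [d' e'] := blk_exists a b; exists d' => //; rewrite -tE.
have IE k : (k <= b)%N -> blk a n k <-> (a <= k)%N.
  by move=> kb; rewrite /blk /= (leq_trans kb bn) andbT.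
split; (apply/(agree_left e IE e') => //; first by rewrite /blk /=; lia).
  by rewrite (yR _ va); lra.
by rewrite (yL _ vb); lra.
Qed.

(** Later particles do not change the death time of [a]. Read in a common larger block, it makes the
    outcomes [Pair] and [Halt] unique and mutually exclusive. *)
Lemma fate_Pair a b n d : Pair x v s a b -> (b <= n)%N ->
  evol x v s (blk a n) d ->
  d a = ((x b - x a) / 2)%:E /\ d b = ((x b - x a) / 2)%:E.
Proof.
move=> [ab va vb [d' e' [d'a d'b]]] bn e; have xab := xlt ab.
have t0 : 0 <= (x b - x a) / 2 by lra.
have IE k : (k <= b)%N -> blk a n k <-> (a <= k)%N.
  by move=> kb; rewrite /blk /= (leq_trans kb bn) andbT.
split; (apply/(agree_left e IE e') => //; first by rewrite /blk /=; lia).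
  by rewrite (yR _ va); lra.
by rewrite (yL _ vb); lra.
Qed.

Lemma fate_Halt a k b n d : Halt x v s a k b -> (b <= n)%N ->
  evol x v s (blk a n) d ->
  d a = (x k.+1 - x a)%:E /\ d k.+1 = (x k.+1 - x a)%:E.
Proof.
move=> [E vz H L] bn e; have [d1 [e1 d1E d1a d1z]] := static_block E vz H L.
have [ak _ _] := E; have [kb vb _] := H.
have ab : (a <= b)%N by lia.
have bb : blk a b b by rewrite /blk /= ab leqnn.
have [d2 e2] := blk_exists b.+1 n.
have conf m u : blk a b m -> 0 <= u -> present d1 m u -> location x v m u <= x b - u.
  by apply: (Hit_confined e1 vb); exact/d1E.
have := evol_append ab bn e1 e2 conf; move/(blk_unique e) => ->.
by rewrite !glueL // /blk /=; lia.
Qed.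

Lemma Halt_Hit a k b : Halt x v s a k b -> Hit x v s a b.
Proof.
move=> [E vz H L]; have [d1 [e1 d1E _ _]] := static_block E vz H L.
have [ak _ _] := E; have [kb vb _] := H.
by split; [lia|done|exists d1].
Qed.

Lemma Pair_unique a b b' : Pair x v s a b -> Pair x v s a b' -> b = b'.
Proof.
move=> P P'; have [d e] := blk_exists a (maxn b b').
have [da _] := fate_Pair P (leq_maxl _ _) e.
have [+ _] := fate_Pair P' (leq_maxr _ _) e.
by rewrite da => -[xx]; apply: (x_inj); lra.
Qed.

Lemma Halt_unique a k b k' b' : Halt x v s a k b -> Halt x v s a k' b' ->
  k = k' /\ b = b'.
Proof.
move=> P P'; have [d e] := blk_exists a (maxn b b').
have [da _] := fate_Halt P (leq_maxl _ _) e.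
have [+ _] := fate_Halt P' (leq_maxr _ _) e.
rewrite da => -[xx]; have kk : k = k'.
  by apply/succn_inj/(x_inj); lra.
by split => //; subst k'; case: P P' => [_ _ + _] [_ _ + _]; exact: Hit_unique.
Qed.

(** Both together would make [a], [b] and the static particle meet at one instant, and the spin
    would save [a] or [b]. *)
Lemma Pair_Halt a b k b' : Pair x v s a b -> ~ Halt x v s a k b'.
Proof.
move=> P P'; have [d e] := blk_exists a (maxn b b').
have [da db] := fate_Pair P (leq_maxl _ _) e.
have [da' dz] := fate_Halt P' (leq_maxr _ _) e.
have [ab va vb _] := P; have xab := xlt ab.
have [E vz H _] := P'; have [ak _ _] := E; have [kb' _ _] := H.
set t := (x b - x a) / 2 in da db; have t0 : 0 <= t by rewrite /t; lra.
have tE : x k.+1 - x a = t by move: da'; rewrite da => -[].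
have pa : present d a t by rewrite /present da.
have pb : present d b t by rewrite /present db.
have pz : present d k.+1 t by rewrite /present dz tE.
have yab : location x v a t = location x v b t.
  by rewrite (yR _ va) (yL _ vb) /t; lra.
have yaz : location x v a t = location x v k.+1 t.
  by rewrite (yR _ va) (yS _ vz) -tE; lra.
have bz : b != k.+1 by apply: contra_eq_neq vb => ->; rewrite vz eq_sym oppr_eq0 oner_neq0.
have ba : blk a (maxn b b') a by rewrite /blk /=; lia.
have bb : blk a (maxn b b') b by rewrite /blk /=; lia.
have [_ _ dE] := e.
have [_ nSa] := (dE _ _ ba t0).1 da; have [_ nSb] := (dE _ _ bb t0).1 db.
have az : a != k.+1 by apply/eqP; lia.
have ab' : a != b by apply/eqP; lia.
case: (sP k.+1) => sz.
  apply: nSb; exists k.+1, a; split; rewrite ?va ?vb ?opprK ?sz //.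
    by split => //; rewrite -yab.
  by split; rewrite // 1?eq_sym // -yab.
by apply: nSa; exists k.+1, b; split; rewrite ?va ?vb ?sz.
Qed.

(** * First arrivals according to the velocity of the first particle *)

Lemma Hit_left a n : v a = -1 -> Hit x v s a n <-> n = a.
Proof.
move=> va; have Haa : Hit x v s a a.
  split => //; have [d e] := blk_exists a a; exists d => // i bn.
  have -> : i = a by move: bn; rewrite /blk /=; lia.
  split=> // _; have ba : blk a a a by rewrite /blk /= leqnn.
  have [_ d0 dE] := e.
  case da: (d a) (d0 _ ba) => [t| |//] //; rewrite lee_fin => t0.
  have [[j [aj _ pj _]] _] := (dE _ _ ba t0).1 da.
  by have := present_dom e pj; move/eqP: aj; rewrite /blk /=; lia.
by split=> [|->//]; move/Hit_unique; apply.
Qed.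

Lemma Hit_static a n : v a = 0 -> Hit x v s a n <->
  exists k, [/\ (a < k < n)%N, Hit x v s a.+1 k & Hit x v s k.+1 n].
Proof.
move=> va; split=> [H|[k [/andP[ak kn] H H']]]; last first.
  by apply/(clear_Hit (clear_static va H) (ltnW kn)).
have [an _ _] := H.
have [[k [kn Hk]]|nk] := pselect (exists k, (k <= n)%N /\ Hit x v s a.+1 k).
  have /(clear_Hit (clear_static va Hk) kn)[kn' Hk'] := H.
  by exists k; split => //; case: Hk => ->.
have [d1 e1] := blk_exists a a.
exfalso; apply: (no_arrival_Hit (leqnn a) an va e1 _ _ H).
  move=> m u u0 /(present_dom e1); rewrite /blk /= => bm.
  by have -> : m = a by [lia]; rewrite (yS _ va).
by move=> j jn Hj; apply: nk; exists j.
Qed.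

Lemma Hit_right a n : v a = 1 -> Hit x v s a n <->
  (exists k, [/\ (a < k < n)%N, Pair x v s a k & Hit x v s k.+1 n]) \/
  (exists k, Halt x v s a k n).
Proof.
move=> va; split=> [H|[[k [/andP[ak kn] P H]]|[k /Halt_Hit//]]]; last first.
  by apply/(clear_Hit (clear_Pair P) (ltnW kn)).
have [an vn [d e dE]] := H.
have ba : blk a n a by rewrite /blk /= leqnn.
have [/(dE _ ba) na|[b bn P]|[k [kn E vz L]]] := fate an e va.
- by move: vn; rewrite -na va; lra.
- left; exists b; have /(clear_Hit (clear_Pair P) bn)[bn' H'] := H.
  by split => //; case: P => ->.
have [[j [jn Hj]]|nj] := pselect (exists j, (j <= n)%N /\ Hit x v s k.+2 j).
  have Ha : Halt x v s a k j by split => //; exact: L.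
  by right; exists k; rewrite (Hit_unique H (Halt_Hit Ha)).
have [d1 [e1 _ _ bd _]] := Esc_collide E vz; have [ak _ _] := E.
exfalso; apply: (no_arrival_Hit (leqW ak) kn vz e1 bd _ H).
by move=> j jn Hj; apply: nj; exists j.
Qed.

(** The particle [a] is put back in front, and its [fate] is read in the block [a..n]. *)
Lemma Hit_behind_right a n : v a = 1 -> (a < n)%N -> Hit x v s a.+1 n <->
  Pair x v s a n \/
  (exists k j, [/\ (j < n)%N, Halt x v s a k j & Hit x v s j.+1 n]).
Proof.
move=> va an; split=> [H|[/(Pair_remove)//|[k [j [jn [E vz H L] H']]]]]; last first.
  by apply/(clear_Hit (clear_after_static E vz H L) (ltnW jn)).
have [_ vn [d0 e0 d0E]] := H.
have [d e] := blk_exists a n.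
have ba : blk a n a by rewrite /blk /= leqnn ltnW.
have [da|[b bn P]|[k [kn E vz L]]] := fate (ltnW an) e va.
(* Removing an immortal [a] frees nobody, so [n] would be immortal in the presence of [a] too; the
   two would have to cross. *)
- exfalso; have e1 := evol_remove (b := a) e ba va.
  have bE : blk a n `\ a = blk a.+1 n.
    by apply/seteqP; split => m; rewrite /blk /=; [case=> ? /eqP|move=> ?; split; [|apply/eqP]]; lia.
  rewrite bE in e1.
  have := blk_unique e0 (e1 _ _); rewrite eqxx => h.
  have bn : blk a.+1 n n by rewrite /blk /= an leqnn.
  have := (d0E _ bn).2 erefl; rewrite h //; last by move=> u j; rewrite da.
  rewrite gtn_eqF // => dn.
  pose u := x n - x a + 1; have xan := xlt an.
  have u0 : 0 <= u by rewrite /u; lra.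
  have := no_crossing_le e u0 (ltnW an) (present_oo u da) (present_oo u dn).
  by rewrite (yR _ va) (yL _ vn) /u; lra.
- by left; rewrite (Hit_unique H (Pair_remove P)).
right; have [[j [jn Hj]]|nj] := pselect (exists j, (j <= n)%N /\ Hit x v s k.+2 j).
  have Lj := L _ jn Hj.
  have /(clear_Hit (clear_after_static E vz Hj Lj) jn)[jn' H'] := H.
  by exists k, j.
have [d1 e1 d1P] := Esc_remove E; have [ak _ _] := E.
have [d2 e2] := blk_exists k.+1 k.+1.
have xkz : x k < x k.+1 by exact: xlt.
have dom2 m u : present d2 m u -> m = k.+1.
  by move/(present_dom e2); rewrite /blk /=; lia.
have e12 : evol x v s (blk a.+1 k.+1) (glue (blk a.+1 k) d1 d2).
  rewrite -(@blk_join a.+1 k k.+1) //.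
  apply: evol_glue => //; first by move=> m; exact: blk_disj.
  move=> i j u u0 _ _ pi /dom2 -> yij; exfalso.
  by have [+ _] := d1P i u u0 pi; rewrite yij (yS _ vz); lra.
exfalso; apply: (@no_arrival_Hit a.+1 k.+1 n _ _ kn vz e12 _ _ H) => //.
  move=> m u u0; rewrite /present /glue; case: ifP => _.
    by move=> /(d1P _ _ u0)[h _]; apply: le_trans h _; exact: ltW.
  by move=> /dom2 ->; rewrite (yS _ vz).
by move=> j jn Hj; apply: nj; exists j.
Qed.

(** * Translations and reflections of blocks *)

Lemma sole_transport (x' v' s' : nat -> R) (f : nat -> nat) (c e : R)
    a b g a' b' g' : e != 0 ->
  (forall n, blk a' b' n -> blk a b (f n)) ->
  (forall n m, blk a' b' n -> blk a' b' m -> f n = f m -> n = m) ->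
  (forall m, blk a b m -> exists2 n, blk a' b' n & f n = m) ->
  (forall n, blk a' b' n ->
    [/\ x' n = c + e * x (f n), v' n = e * v (f n) & s' n = e * s (f n)]) ->
  blk a' b' g' -> f g' = g ->
  (exists2 d, evol x v s (blk a b) d &
    forall n, blk a b n -> (d n = +oo%E <-> n = g)) ->
  exists2 d, evol x' v' s' (blk a' b') d &
    forall n, blk a' b' n -> (d n = +oo%E <-> n = g').
Proof.
move=> e0 fI finj fsurj fE bg' fg [d ed dE].
have xE n : blk a' b' n -> x' n = c + e * x (f n) by move/fE; case.
have vE n : blk a' b' n -> v' n = e * v (f n) by move/fE; case.
have sE n : blk a' b' n -> s' n = e * s (f n) by move/fE; case.
eexists; first exact: (evol_transport e0 fI finj fsurj xE vE sE ed).
move=> n bn; rewrite /= mem_set // dE; last exact: fI.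
by rewrite -fg; split=> [/finj|->//]; apply.
Qed.

End Dynamics.

Lemma Hit_shift (R : realType) (x v s x' v' s' : nat -> R) (c : R) k b :
  (forall n, (n <= b)%N ->
    [/\ x' n = c + x (k + n)%N, v' n = v (k + n)%N & s' n = s (k + n)%N]) ->
  Hit x' v' s' 0 b <-> Hit x v s k (k + b).
Proof.
move=> E; have bb : blk 0 b b by rewrite /blk /=.
have bb' : blk k (k + b) (k + b) by rewrite /blk /=; lia.
split=> -[h vb ex]; split; rewrite ?leq_addr //.
- by have [_ <- _] := E b (leqnn b).
- apply: (@sole_transport _ x' v' s' x v s (subn^~ k) (- c) 1 _ _ _ _ _ _ _ _ _ _ _ bb' _ ex).
  + by rewrite oner_neq0.
  + by move=> n; rewrite /blk /=; lia.
  + by move=> n m; rewrite /blk /=; lia.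
  + by move=> m bm; exists (k + m)%N; move: bm; rewrite /blk /=; lia.
  + move=> n bn; have nb : (n - k <= b)%N by move: bn; rewrite /blk /=; lia.
    have [-> -> ->] := E _ nb; rewrite subnKC; last by case/andP: bn.
    by rewrite !mul1r addKr.
  + by lia.
- by have [_ -> _] := E b (leqnn b).
- apply: (@sole_transport _ x v s x' v' s' (addn k) c 1 _ _ _ _ _ _ _ _ _ _ _ bb _ ex).
  + by rewrite oner_neq0.
  + by move=> n; rewrite /blk /=; lia.
  + by move=> n m; rewrite /blk /=; lia.
  + by move=> m bm; exists (m - k)%N; move: bm; rewrite /blk /=; lia.
  + by move=> n /andP[_ nb]; have [-> -> ->] := E _ nb; rewrite !mul1r.
  + by [].
Qed.

Section Mirror.
Context (R : realType).

Definition mirrored (x v s x' v' s' : nat -> R) (c : R) N : Prop :=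
  forall n, (n <= N)%N ->
    [/\ x' n = c - x (N - n)%N, v' n = - v (N - n)%N & s' n = - s (N - n)%N].

Lemma mirrored_sym x v s x' v' s' c N : mirrored x v s x' v' s' c N ->
  mirrored x' v' s' x v s c N.
Proof.
move=> E n nN; have [-> -> ->] := E (N - n)%N (leq_subr _ _).
by rewrite subKn // !opprK subKr.
Qed.

Lemma mirrored_sole x v s x' v' s' c N a b g : mirrored x v s x' v' s' c N ->
  (b <= N)%N -> blk a b g ->
  (exists2 d, evol x v s (blk a b) d &
    forall n, blk a b n -> (d n = +oo%E <-> n = g)) ->
  exists2 d, evol x' v' s' (blk (N - b) (N - a)) d &
    forall n, blk (N - b) (N - a) n -> (d n = +oo%E <-> n = (N - g)%N).
Proof.
move=> E bN bg ex.
apply: (@sole_transport _ x v s x' v' s' (subn N) c (-1) _ _ _ _ _ _ _ _ _ _ _ _ _ ex).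
- by rewrite oppr_eq0 oner_neq0.
- by move=> n; move: bg; rewrite /blk /=; lia.
- by move=> n m; move: bg; rewrite /blk /=; lia.
- by move=> m bm; exists (N - m)%N; move: bm; rewrite /blk /=; lia.
- move=> n bn; have nN : (n <= N)%N by move: bn bg; rewrite /blk /=; lia.
  by have [-> -> ->] := E _ nN; rewrite !mulN1r.
- by move: bg; rewrite /blk /=; lia.
- by move: bg; rewrite /blk /=; lia.
Qed.

Lemma Hit_Esc_mirror x v s x' v' s' c N a b : mirrored x v s x' v' s' c N ->
  (a <= b)%N -> (b <= N)%N ->
  Hit x v s a b <-> Esc x' v' s' (N - b) (N - a).
Proof.
move=> E ab bN; split=> -[h vb ex]; split.
- by lia.
- by have [_ -> _] := E (N - b)%N (leq_subr _ _); rewrite subKn // vb opprK.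
- by apply: (mirrored_sole E bN _ ex); rewrite /blk /= ab leqnn.
- by [].
- have [_ + _] := E (N - b)%N (leq_subr _ _).
  by rewrite subKn // vb => /eqP; rewrite eq_sym eqr_oppLR => /eqP.
- have aN := leq_trans ab bN.
  have := mirrored_sole (mirrored_sym E) (leq_subr a N) _ ex.
  by rewrite !subKn //; apply; rewrite /blk /=; lia.
Qed.

End Mirror.

(** * From the infinite evolution to finite blocks *)

Section ZeroReached.
Context (R : realType).

Lemma well_posed_admissible (x v s : nat -> R) :
  well_posed x v s -> admissible x v s.
Proof.
move=> [g0 _ vP sP]; split => // i j; elim: j => // j IH.
have xj : x j < x j.+1 by have := g0 j.+1; rewrite /gap subr_gt0.
by rewrite ltnS leq_eqVlt => /predU1P[->//|/IH/lt_trans]; apply.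
Qed.

(** A particle at 0 is to the left of [x 0], so [arrival] applies. Conversely the infinite evolution
    exists and gives [n] the same fate as its block. *)
Lemma zero_reachedP (x v s : nat -> R) : well_posed x v s ->
  zero_reached x v s <-> exists n, Hit x v s 0 n.
Proof.
move=> wp; have adm := well_posed_admissible wp; case: (wp) => g0 xoo _ _.
have x0 : 0 < x 0 by exact: (g0 0%N).
have IE k n : (k <= n)%N -> [set: nat] k <-> (0 <= k)%N by [].
split=> [[_ [d [/evolution_evol e [n [vn dn]]]]]|[n [_ vn [d' e' dE]]]].
  have xn0 : 0 <= x n by apply: le_trans (ltW x0) (x_le adm (leq0n n)).
  have [||k [_ Hk]] := arrival adm e (leq0n n) (fun k _ => _) vn xn0 (ltW dn).
  - by [].
  - by rewrite /location vn mulN1r subrr.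
  - by exists k.
split=> //; have [d e] : exists d, evol x v s setT d.
  apply: (evol_exists_setT adm) => M.
  move/cvgryPgt: xoo => /(_ M)[N _ NP]; exists N => n' Nn'; exact: NP.
exists d; split; first exact/evolution_evol.
have bn : blk 0 n n by rewrite /blk /= leqnn.
exists n; split=> //; have [_ d0 _] := e.
case dn: (d n) (d0 n I) => [w| |] //; last by rewrite ltry.
rewrite lee_fin => w0.
have : d' n = w%:E.
  by apply/(agree_left adm e (fun k _ => _) e') => //; rewrite /location vn mulN1r subrK.
by rewrite ((dE _ bn).2 erefl).
Qed.

End ZeroReached.

(** * Independence and invariance on a sequence space *)

Lemma measure_unique_finite (R : realType) d (T : measurableType d)
    (G : set (set T)) (m1 m2 : {measure set T -> \bar R}) :
  G `<=` measurable -> setI_closed G -> G setT ->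
  (forall A, G A -> m1 A = m2 A) -> (m1 setT < +oo)%E ->
  forall E, <<s G >> E -> m1 E = m2 E.
Proof.
move=> Gm GI GT m12 m1oo E GE.
by apply: (@g_sigma_algebra_measure_unique _ _ _ G Gm (fun=> setT)) => //; rewrite bigcup_const.
Qed.

Definition generated (R : realType) (K T : Type) (Z : K -> T -> R) (I : set K) :
    set (set T) :=
  \bigcup_(k in I) preimage_set_system setT (Z k) measurable.

Definition cylinder (R : realType) (K : choiceType) (T : Type) (Z : K -> T -> R)
    (J : seq K) (B : K -> set R) : set T :=
  \bigcap_(k in [set` J]) (Z k @^-1` B k).

Definition cylinders (R : realType) (K : choiceType) (T : Type)
    (Z : K -> T -> R) (I : set K) : set (set T) :=
  [set C | exists J B,
     [/\ [set` J] `<=` I, forall k, measurable (B k) & C = cylinder Z J B]].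

Section Families.
Context (R : realType) (K : choiceType) (d : measure_display) (T : measurableType d).
Context (P : probability T R) (Z : K -> T -> R).
Hypothesis mZ : forall k, measurable_fun setT (Z k).

Let mpre k (B : set R) : measurable B -> measurable (Z k @^-1` B).
Proof. by move=> mB; rewrite -[X in measurable X]setTI; exact: mZ. Qed.

Lemma cylinder_measurable J B : (forall k, measurable (B k)) -> measurable (cylinder Z J B).
Proof.
move=> mB; rewrite /cylinder bigcap_seq; apply: bigsetI_measurable => k _.
exact: mpre.
Qed.

Lemma cylinders_setI I : setI_closed (cylinders Z I).
Proof.
move=> _ _ [J [B [JI mB ->]]] [J' [B' [JI' mB' ->]]].
exists (J ++ J'), (fun k => (if k \in J then B k else setT) `&` (if k \in J' then B' k else setT)).
split.
- by move=> k /=; rewrite mem_cat => /orP[/JI|/JI'].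
- by move=> k; apply: measurableI; case: ifP.
- apply/seteqP; split=> t /=.
    by move=> [h h'] k _; split; case: ifPn => // kJ; [apply: h|apply: h'].
  move=> h; split=> k /= kJ; have := h k; rewrite /= mem_cat kJ ?orbT => /(_ isT)[].
    by [].
  by [].
Qed.

Lemma cylinders_setT I : cylinders Z I setT.
Proof.
exists [::], (fun=> setT); split=> //.
by apply/esym/seteqP; split.
Qed.

Lemma generated_cylinders I : <<s generated Z I >> `<=` <<s cylinders Z I >>.
Proof.
apply: smallest_sub; first exact: smallest_sigma_algebra.
move=> _ [k Ik [B mB <-]]; apply: sub_sigma_algebra.
exists [:: k], (fun=> B); split=> //; first by move=> j /=; rewrite inE => /eqP->.
rewrite setTI /cylinder; apply/seteqP; split=> t /= h; first by move=> j; rewrite /= inE => /eqP->.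
by apply: (h k); rewrite /= inE.
Qed.

Lemma generated_measurable I : <<s generated Z I >> `<=` measurable.
Proof.
apply: smallest_sub; first exact: sigma_algebra_measurable.
by move=> _ [k _ [B mB <-]]; rewrite setTI; exact: mpre.
Qed.

Definition independent_family : Prop := forall J (B : K -> set R),
  uniq J -> (forall k, measurable (B k)) ->
  P (cylinder Z J B) = (\prod_(k <- J) P (Z k @^-1` B k))%E.

Hypothesis indep : independent_family.

Lemma cylinder_undup J B : cylinder Z J B = cylinder Z (undup J) B.
Proof.
by rewrite /cylinder; apply/seteqP; split=> t h k /= kJ; apply: h; rewrite /= ?mem_undup // -mem_undup.
Qed.

Lemma independent_cylinders I I' A C : (forall k, I k -> ~ I' k) ->
  cylinders Z I A -> cylinders Z I' C -> P (A `&` C) = (P A * P C)%E.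
Proof.
move=> II' [J [B [JI mB ->]]] [J' [B' [JI' mB' ->]]].
rewrite (cylinder_undup J) (cylinder_undup J').
have JJ k : k \in J' -> (k \in J) = false.
  by move=> kJ'; apply/negP => /JI/II'; apply; exact: JI'.
pose B2 k := if k \in J then B k else B' k.
have -> : cylinder Z (undup J) B `&` cylinder Z (undup J') B' =
    cylinder Z (undup J ++ undup J') B2.
  apply/seteqP; split=> [t [h h'] k /=|t h].
    rewrite mem_cat /B2 => /orP[]; rewrite mem_undup => kJ.
      by rewrite kJ; apply: h; rewrite /= mem_undup.
    by rewrite JJ //; apply: h'; rewrite /= mem_undup.
  split=> k /= kJ; have := h k; rewrite /= mem_cat kJ ?orbT => /(_ isT);
    rewrite /B2; move: kJ; rewrite mem_undup => kJ; first by rewrite kJ.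
  by rewrite JJ.
rewrite !indep ?undup_uniq //; last first.
- by move=> k; rewrite /B2; case: ifP.
- rewrite cat_uniq !undup_uniq andbT /=; apply/hasPn => k.
  by rewrite !mem_undup => /JJ/negbT.
rewrite big_cat /=; congr (_ * _)%E; apply: eq_big_seq => k; rewrite mem_undup /B2.
  by move=> ->.
by move=> /JJ ->.
Qed.

(** As functions of [E], both sides are finite measures: the restriction of [P] to [C] and a
    multiple of [P]. They agree on cylinders, which are stable under intersection. *)
Lemma independent_generated_cylinder I C : measurable C ->
  (forall A, cylinders Z I A -> P (A `&` C) = (P A * P C)%E) ->
  forall E, <<s generated Z I >> E -> P (E `&` C) = (P E * P C)%E.
Proof.
move=> mC cylC E /generated_cylinders gE.
have PC_ge0 : 0 <= fine (P C) by rewrite fine_ge0.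
have scE A : mscale (NngNum PC_ge0) P A = (P A * P C)%E.
  by rewrite /mscale /= fineK ?fin_num_measure // muleC.
rewrite -scE.
apply: (@measure_unique_finite R d T (cylinders Z I) (mrestr P mC)
  (mscale (NngNum PC_ge0) P) _ (@cylinders_setI I) (cylinders_setT I) _ _ E gE).
- by move=> _ [J [B [_ mB ->]]]; exact: cylinder_measurable.
- by move=> A /cylC h; apply: etrans h _; apply/esym/scE.
- have : (P (setT `&` C) < +oo)%E by rewrite ltey_eq fin_num_measure // setTI.
  exact.
Qed.

Lemma independent_blocks I I' E E' : (forall k, I k -> ~ I' k) ->
  <<s generated Z I >> E -> <<s generated Z I' >> E' -> P (E `&` E') = (P E * P E')%E.
Proof.
move=> II' gE gE'; rewrite setIC muleC.
apply: (@independent_generated_cylinder I') => //; first exact: generated_measurable gE.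
move=> C cC; rewrite setIC muleC.
apply: (@independent_generated_cylinder I) => //.
  by case: cC => J [B [_ mB ->]]; exact: cylinder_measurable.
by move=> A cA; rewrite (independent_cylinders II' cA cC).
Qed.

End Families.

Section SequenceSpace.
Context (R : realType) (K : choiceType).

Definition entry (k : K) (z : K -> R) : R := z k.

Local Notation space := (g_sigma_algebraType (generated entry setT)).

Lemma entry_measurable k : measurable_fun setT (entry k : space -> R).
Proof.
move=> _ B mB; apply: sub_sigma_algebra; exists k => //; by exists B.
Qed.

Lemma space_measurable d (T : measurableType d) (F : T -> space) :
  (forall k, measurable_fun setT (fun t => F t k)) -> measurable_fun setT F.
Proof.
move=> mF; apply: (@measurability _ _ T space setT F (generated entry setT)) => //.
move=> _ [_ [k _ [B mB <-]] <-]; rewrite !setTI.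
by have := mF k measurableT B mB; rewrite setTI.
Qed.

Lemma law_unique (P Q : probability space R) :
  (forall (J : seq K) (B : K -> set R), uniq J -> (forall k, measurable (B k)) ->
    P (cylinder entry J B) = Q (cylinder entry J B)) ->
  forall E, measurable E -> P E = Q E.
Proof.
move=> PQ E mE.
apply: (@measure_unique_finite R _ space (cylinders (entry : K -> space -> R) setT) P Q) => //.
- move=> _ [J [B [_ mB ->]]]; apply: cylinder_measurable => //; exact: entry_measurable.
- exact: cylinders_setI.
- exact: cylinders_setT.
- move=> _ [J [B [_ mB ->]]]; rewrite cylinder_undup.
  exact: PQ (undup_uniq J) mB.
- have : (P setT < +oo)%E by rewrite probability_setT ltry.
  exact.
- exact: generated_cylinders.
Qed.

End SequenceSpace.

Section SpaceTransport.
Context (R : realType) (K : choiceType).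
Local Notation space := (g_sigma_algebraType (generated (@entry R K) setT)).
Context (P : probability space R).
Hypothesis indep : independent_family P (@entry R K).

Lemma entry_preimage_measurable (I : set K) k (B : set R) : I k -> measurable B ->
  <<s generated (@entry R K) I >> [set z | B (z k)].
Proof.
move=> Ik mB; apply: sub_sigma_algebra; exists k => //; exists B => //.
by rewrite setTI.
Qed.

(** [E] is its own preimage under the map [tau] that replaces the coordinates outside [I] by 0, and
    [tau] is measurable for the smaller sigma-algebra. Locality of an event is thus turned into
    independence without writing it through cylinders. *)
Lemma dependent_generated (I : set K) (E : set space) : measurable E ->
  (forall z z', (forall k, I k -> z k = z' k) -> E z -> E z') ->
  <<s generated (@entry R K) I >> E.
Proof.
move=> mE dE.
pose S := g_sigma_algebraType (generated (@entry R K) I).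
pose tau (z : S) : space := fun k => if k \in I then z k else 0.
have mtau : measurable_fun setT tau.
  apply: space_measurable => k; have [kI|kI] := boolP (k \in I); last first.
    rewrite /tau (negbTE kI); exact: measurable_cst.
  have Ik : I k by exact/set_mem.
  rewrite /tau kI => _ B mB; rewrite setTI.
  exact: (entry_preimage_measurable Ik mB).
have -> : E = tau @^-1` E.
  have tz z k : I k -> tau z k = z k by move=> Ik; rewrite /tau mem_set.
  by apply/seteqP; split=> z; apply: dE => k /tz.
by have := mtau measurableT E mE; rewrite setTI.
Qed.

Variables (sigma : K -> K) (phi : K -> R -> R).
Hypotheses (sigma_inj : injective sigma) (mphi : forall k, measurable_fun setT (phi k)).

Definition remap (z : space) : space := fun k => phi k (z (sigma k)).

Lemma remap_measurable : measurable_fun setT remap.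
Proof.
apply: space_measurable => k; rewrite /remap.
exact: (measurableT_comp (mphi k) (@entry_measurable R K (sigma k))).
Qed.

Lemma remap_law :
  (forall k (B : set R), measurable B ->
    P [set z | B (phi k (z (sigma k)))] = P [set z | B (z k)]) ->
  forall E, measurable E -> P (remap @^-1` E) = P E.
Proof.
move=> marg E mE.
pose F : {mfun space >-> space} := HB.pack remap
  (isMeasurableFun.Build _ _ _ _ remap remap_measurable).
rewrite -[LHS]/(distribution P F E); apply: law_unique => // J B uJ mB.
(* The constraint on coordinate [l] comes from its preimage by [sigma] and is void outside the
   image. *)
pose B' l := if pselect (exists k, sigma k = l) is left e
  then phi (projT1 (cid e)) @^-1` B (projT1 (cid e)) else setT.
have B'E k : B' (sigma k) = phi k @^-1` B k.
  rewrite /B'; case: pselect => [e|[]]; last by exists k.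
  by case: (cid e) => /= l /sigma_inj ->.
have mB' l : measurable (B' l).
  rewrite /B'; case: pselect => // e.
  by have := mphi (projT1 (cid e)) measurableT (mB (projT1 (cid e))); rewrite setTI.
transitivity (P (cylinder (@entry R K) (map sigma J) B')).
  congr (P _); apply/seteqP; split=> z /= h k.
    by move=> /mapP[l lJ ->]; rewrite /entry /= B'E; exact: (h l lJ).
  move=> kJ; have := h (sigma k); rewrite /= map_f // => /(_ isT).
  by rewrite B'E.
rewrite !indep ?map_inj_uniq // big_map; apply: eq_bigr => k _.
by rewrite B'E; exact: marg.
Qed.

End SpaceTransport.

(** * Arrival events *)

Section Configuration.
Context (R : realType).

(** A single index type for gaps, velocities and spins makes all the randomness one independent
    family; [rank] recovers the particle, so that blocks of particles become sets of labels. *)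
Definition label : choiceType := (nat + nat + nat)%type.
Definition gap_label (n : nat) : label := inl (inl n).
Definition vel_label (n : nat) : label := inl (inr n).
Definition spin_label (n : nat) : label := inr n.
Definition rank (k : label) : nat :=
  match k with inl (inl n) | inl (inr n) | inr n => n end.

Local Notation space := (g_sigma_algebraType (generated (@entry R label) setT)).

(* The entries are truncated to admissible values, so that every point of the
   sequence space encodes an admissible configuration. *)
Definition to_gap (r : R) : R := if 0 < r then r else 1.
Definition to_vel (r : R) : R := if (r == 1) || (r == -1) then r else 0.
Definition to_spin (r : R) : R := if r < 0 then -1 else 1.

Definition pos (z : label -> R) (n : nat) : R := \sum_(i < n.+1) to_gap (z (gap_label i)).
Definition vel (z : label -> R) (n : nat) : R := to_vel (z (vel_label n)).
Definition spin (z : label -> R) (n : nat) : R := to_spin (z (spin_label n)).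

Lemma posS z n : pos z n.+1 = pos z n + to_gap (z (gap_label n.+1)).
Proof. by rewrite /pos big_ord_recr. Qed.

Lemma to_gap_gt0 r : 0 < to_gap r.
Proof. by rewrite /to_gap; case: ifP. Qed.

Lemma config_admissible z : admissible (pos z) (vel z) (spin z).
Proof.
split=> [i j|n|n].
- elim: j => // j IH; rewrite ltnS leq_eqVlt => /predU1P[->|/IH h].
    by rewrite posS ltrDl to_gap_gt0.
  by rewrite posS (lt_trans h) // ltrDl to_gap_gt0.
- rewrite /vel /to_vel; case: ifP => [/orP[]/eqP->|_]; [exact: Or33|exact: Or31|exact: Or32].
- by rewrite /spin /to_spin; case: ifP; [left|right].
Qed.

Definition hit a b : set space := [set z | Hit (pos z) (vel z) (spin z) a b].
Definition esc a b : set space := [set z | Esc (pos z) (vel z) (spin z) a b].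
Definition pair a b : set space := [set z | Pair (pos z) (vel z) (spin z) a b].
Definition halt a k b : set space := [set z | Halt (pos z) (vel z) (spin z) a k b].
Definition late_set a k b : set space := [set z | late (pos z) (spin z) a k b].
Definition veq n r : set space := [set z | vel z n = r].

Definition shift_label (a : nat) (k : label) : label :=
  match k with
  | inl (inl n) => gap_label (a + n)
  | inl (inr n) => vel_label (a + n)
  | inr n => spin_label (a + n)
  end.

Definition shift_seq a : space -> space := remap (shift_label a) (fun=> id).

Lemma shift_label_inj a : injective (shift_label a).
Proof.
by move=> [[m|m]|m] [[n|n]|n] //= [] /addnI ->.
Qed.

Lemma hit_shift a b z : hit 0 b (shift_seq a z) <-> hit a (a + b) z.
Proof.
apply: (@Hit_shift _ _ _ _ _ _ _ (to_gap (z (gap_label a)) - pos z a)) => n _; split => //.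
elim: n => [|n IH]; first by rewrite addn0 subrK /pos big_ord1 /shift_seq /remap /= addn0.
by rewrite posS addnS posS IH -addrA /shift_seq /remap /= addnS.
Qed.

(** Gap [n] separates particles [n.-1] and [n], so it comes from gap [(N - n).+1], whereas particle
    labels come from [N - n]. Gap 0 and all labels beyond [N] are fixed, which keeps the map
    injective. *)
Definition mirror_label (N : nat) (k : label) : label :=
  match k with
  | inl (inl n) => gap_label (if (0 < n <= N)%N then (N - n).+1 else n)
  | inl (inr n) => vel_label (if (n <= N)%N then (N - n)%N else n)
  | inr n => spin_label (if (n <= N)%N then (N - n)%N else n)
  end.

(** Truncating before changing sign makes the mirrored configuration exact everywhere: [to_spin]
    sends 0 to 1, so it does not commute with the opposite. *)
Definition mirror_entry (N : nat) (k : label) (r : R) : R :=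
  match k with
  | inl (inl n) => r
  | inl (inr n) => if (n <= N)%N then - to_vel r else r
  | inr n => if (n <= N)%N then - to_spin r else r
  end.

Definition mirror_seq N : space -> space := remap (mirror_label N) (mirror_entry N).

Lemma mirror_label_inj N : injective (mirror_label N).
Proof.
move=> [[m|m]|m] [[n|n]|n] //= [].
- by do 2![case: ifPn => ?] => h; congr (inl (inl _)); lia.
- by do 2![case: ifPn => ?] => h; congr (inl (inr _)); lia.
- by do 2![case: ifPn => ?] => h; congr (inr _); lia.
Qed.

Lemma to_velN r : to_vel (- to_vel r) = - to_vel r.
Proof.
rewrite [to_vel r]/to_vel; case: ifP => [/orP[]/eqP->|_]; rewrite /to_vel.
- by rewrite eqxx orbT.
- by rewrite opprK eqxx.
- by rewrite oppr0; case: ifP => // /orP[]/eqP; lra.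
Qed.

Lemma to_spinN r : to_spin (- to_spin r) = - to_spin r.
Proof.
rewrite [to_spin r]/to_spin; case: ifP => _; rewrite /to_spin; first by rewrite opprK ltr10.
by rewrite oppr_lt0 ltr01.
Qed.

Lemma mirror_mirrored N z : mirrored (pos z) (vel z) (spin z)
  (pos (mirror_seq N z)) (vel (mirror_seq N z)) (spin (mirror_seq N z))
  (pos (mirror_seq N z) 0 + pos z N) N.
Proof.
move=> n nN; split; last 2 first.
- by rewrite /vel /mirror_seq /remap /= nN to_velN.
- by rewrite /spin /mirror_seq /remap /= nN to_spinN.
elim: n nN => [|n IH] nN; first by rewrite subn0 addrK.
have -> : (N - n.+1)%N = (N - n).-1 by lia.
have nE : (N - n)%N = (N - n).-1.+1 by lia.
rewrite posS IH 1?ltnW // [in LHS]nE posS /mirror_seq /remap /= nN.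
have -> : (N - n.+1).+1 = (N - n).-1.+1 by lia.
by lra.
Qed.

Lemma hit_mirror N a b z : (a <= b)%N -> (b <= N)%N ->
  hit a b z <-> esc (N - b) (N - a) (mirror_seq N z).
Proof. by move=> ab bN; exact: (Hit_Esc_mirror (@mirror_mirrored N z) ab bN). Qed.

Lemma esc_mirror N a b z : (a <= b)%N -> (b <= N)%N ->
  esc a b z <-> hit (N - b) (N - a) (mirror_seq N z).
Proof.
move=> ab bN; rewrite /hit /esc /=.
rewrite (Hit_Esc_mirror (mirrored_sym (@mirror_mirrored N z))) ?leq_subr //; last by lia.
by rewrite !subKn // (leq_trans ab).
Qed.

Lemma to_gap_measurable : measurable_fun setT to_gap.
Proof.
apply: measurable_fun_ifT => //.
exact: measurable_fun_ltr.
Qed.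

Lemma to_vel_measurable : measurable_fun setT to_vel.
Proof.
apply: measurable_fun_ifT => //.
by apply: measurable_or; apply: measurable_fun_eqr.
Qed.

Lemma to_spin_measurable : measurable_fun setT to_spin.
Proof.
apply: measurable_fun_ifT => //.
exact: measurable_fun_ltr.
Qed.

Let mentry k : measurable_fun setT (fun z : space => z k).
Proof. exact: entry_measurable. Qed.

Lemma pos_measurable n : measurable_fun setT (fun z : space => pos z n).
Proof.
apply: measurable_sum => i.
exact: (measurableT_comp to_gap_measurable (mentry _)).
Qed.

Lemma vel_measurable n : measurable_fun setT (fun z : space => vel z n).
Proof. exact: (measurableT_comp to_vel_measurable (mentry _)). Qed.

Lemma spin_measurable n : measurable_fun setT (fun z : space => spin z n).
Proof. exact: (measurableT_comp to_spin_measurable (mentry _)). Qed.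

Lemma veq_measurable n r : measurable (veq n r).
Proof.
have := vel_measurable n measurableT (measurable_set1 r).
by rewrite setTI.
Qed.

Lemma late_measurable a k b : measurable (late_set a k b).
Proof.
pose D z := pos z b - pos z k - (pos z k - pos z a).
have mD : measurable_fun setT (D : space -> R).
  by apply: measurable_funB; apply: measurable_funB; exact: pos_measurable.
have -> : late_set a k b = D @^-1` `]0, +oo[%classic `|`
    (D @^-1` [set 0] `&` [set z | spin z k = -1]).
  apply/seteqP; split=> z; rewrite /late_set /late /D /= in_itv /= andbT => -[h|[h h']];
    [left|right|left|right]; try split; try exact: h'; lra.
apply: measurableU.
  by have := mD measurableT _ (measurable_itv `]0, +oo[); rewrite setTI.
apply: measurableI.
  by have := mD measurableT _ (measurable_set1 0); rewrite setTI.
have := spin_measurable k measurableT (measurable_set1 (-1)).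
by rewrite setTI.
Qed.

Lemma shift_measurable a : measurable_fun setT (shift_seq a).
Proof. by apply: remap_measurable. Qed.

Lemma mirror_measurable N : measurable_fun setT (mirror_seq N).
Proof.
apply: remap_measurable => -[[n|n]|n]; first exact: measurable_id.
  rewrite /mirror_entry /=; case: (n <= N)%N => //.
  by apply: measurable_funN; exact: to_vel_measurable.
rewrite /mirror_entry /=; case: (n <= N)%N => //.
by apply: measurable_funN; exact: to_spin_measurable.
Qed.

End Configuration.

(** * Decomposition, measurability and locality of arrivals *)

Section Events.
Context (R : realType).
Local Notation space := (g_sigma_algebraType (generated (@entry R label) setT)).
Implicit Types z : label -> R.

Let adm z := config_admissible z.

Lemma hit_rec n : hit 0 n =
  (if n == 0%N then veq 0 (-1) else set0) `|`
  (veq 0 0 `&` \bigcup_(k < n.+1) (hit 1 k `&` hit k.+1 n)) `|`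
  \bigcup_(k < n.+1) (pair 0 k `&` hit k.+1 n) `|`
  \bigcup_(k < n.+1) halt 0 k n :> set space.
Proof.
apply/seteqP; split=> z.
  rewrite {1}/hit /= => H; have [v0|v0|v0] : [\/ vel z 0 = -1, vel z 0 = 0 | vel z 0 = 1] by case: (adm z).
  - by have -> : n = 0%N by [apply/(Hit_left (adm z) _ v0)]; left; left; left.
  - have [k [/andP[k0 kn] H1 H2]] := (Hit_static (adm z) n v0).1 H.
    by left; left; right; split => //; exists k => //=; rewrite ltnS ltnW.
  - case: ((Hit_right (adm z) n v0).1 H) => [[k [/andP[k0 kn] H1 H2]]|[k Hk]].
      by left; right; exists k => //=; rewrite ltnS ltnW.
    by right; exists k => //=; case: Hk => _ _ [] *; lia.
move=> [[[|[v0 [k kn [H1 H2]]]]|[k kn [H1 H2]]]|[k kn Hk]].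
- by case: eqP => // -> v0; apply/(Hit_left (adm z) _ v0).
- apply/(Hit_static (adm z) n v0); exists k; split => //.
  by case: H1; case: H2 => *; apply/andP; split; lia.
- have [_ v0 _ _] := H1; apply/(Hit_right (adm z) n v0); left; exists k; split => //.
  by case: H1; case: H2 => *; apply/andP; split; lia.
- have [[_ v0 _] _ _ _] := Hk; apply/(Hit_right (adm z) n v0); right; by exists k.
Qed.

(* Erasing a right-moving first particle: if it is annihilated by a left-moving
   one, the latter arrives instead; if it is stopped by a static particle, two
   arrivals are needed. *)
Lemma hit_behind n : (0 < n)%N -> veq 0 1 `&` hit 1 n =
  pair 0 n `|` \bigcup_(j < n) ((\bigcup_(k < n) halt 0 k j) `&` hit j.+1 n) :> set space.
Proof.
move=> n0; apply/seteqP; split=> z.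
  move=> [v0 H]; case: ((Hit_behind_right (adm z) v0 n0).1 H) => [|[k [j [jn H1 H2]]]]; first by left.
  right; exists j => //; split => //; exists k => //=.
  by case: H1 => _ _ [] *; lia.
move=> [P|[j jn [[k kn H1] H2]]].
  have [_ v0 _ _] := P; split => //; apply/(Hit_behind_right (adm z) v0 n0); by left.
have [[_ v0 _] _ _ _] := H1; split => //; apply/(Hit_behind_right (adm z) v0 n0); right.
by exists k, j.
Qed.

Lemma pair_not_behind n :
  pair 0 n `&` (\bigcup_(j < n) ((\bigcup_(k < n) halt 0 k j) `&` hit j.+1 n)) = set0 :> set space.
Proof.
apply/seteqP; split=> z // [P [j _ [[k _ H] _]]].
exact: (Pair_Halt (adm z) P H).
Qed.

Lemma pair0 : pair 0 0 = set0 :> set space.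
Proof. by apply/seteqP; split=> z // -[]. Qed.

(** Solving [hit_behind] for [pair] gives its measurability and locality without a further look at
    the dynamics. *)
Lemma pair_rec n : (0 < n)%N -> pair 0 n = (veq 0 1 `&` hit 1 n) `\`
  \bigcup_(j < n) ((\bigcup_(k < n) halt 0 k j) `&` hit j.+1 n) :> set space.
Proof.
move=> n0; rewrite hit_behind // setDUl setDv setU0; apply/esym/setDidPl.
exact: pair_not_behind.
Qed.

Lemma hit_empty a b : (b < a)%N -> hit a b = set0 :> set space.
Proof. by move=> ba; apply/seteqP; split=> z // -[]; lia. Qed.

Lemma hit_shiftE a b : hit a (a + b) = shift_seq a @^-1` hit 0 b :> set space.
Proof. by apply/seteqP; split=> z /hit_shift. Qed.

Lemma esc_mirrorE k : esc 0 k = mirror_seq k @^-1` hit 0 k :> set space.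
Proof.
by apply/seteqP; split=> z; have := @esc_mirror R k 0 k z (leq0n k) (leqnn k);
  rewrite subnn subn0 => -[].
Qed.

Lemma measurable_preimage (f : space -> space) (E : set space) :
  measurable_fun setT f -> measurable E -> measurable (f @^-1` E).
Proof. by move=> mf mE; rewrite -[X in measurable X]setTI; exact: mf. Qed.

Lemma haltE k j : halt 0 k j =
  esc 0 k `&` veq k.+1 0 `&` hit k.+2 j `&` late_set 0 k.+1 j :> set space.
Proof.
apply/seteqP; split=> z; first by move=> [E V H L]; split => //; split.
by move=> [[[E V] H] L]; split.
Qed.

(** Strong induction on the length of the block: the recursion involves only shorter blocks, up to
    shift and reflection. *)
Lemma hit0_measurable n : measurable (hit 0 n : set space).
Proof.
have [m] := ubnP n; elim: m => // m IH in n *; rewrite ltnS => nm.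
have mhit a b : (b < a + m)%N -> measurable (hit a b : set space).
  move=> bam; have [/hit_empty->//|ab] := ltnP b a.
  rewrite -(subnKC ab) hit_shiftE; apply: measurable_preimage; first exact: shift_measurable.
  by apply: IH; lia.
have mesc k : (k < m)%N -> measurable (esc 0 k : set space).
  move=> km; rewrite esc_mirrorE; apply: measurable_preimage; first exact: mirror_measurable.
  exact: IH.
have mhalt k j : (j <= n)%N -> measurable (halt 0 k j : set space).
  move=> jn; have [jk|kj] := ltnP j k.+2.
    rewrite (_ : halt 0 k j = set0) //; apply/seteqP; split=> z // -[_ _ [] *]; lia.
  rewrite haltE; apply: measurableI; last exact: late_measurable.
  apply: measurableI; last by apply: mhit; lia.
  apply: measurableI; last exact: veq_measurable.
  by apply: mesc; lia.
have mpair k : (k < n)%N -> measurable (pair 0 k : set space).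
  case: (posnP k) => [-> _|k0 kn]; first by rewrite pair0.
  rewrite pair_rec //; apply: measurableD.
    apply: measurableI; first exact: veq_measurable.
    by apply: mhit; lia.
  apply: fin_bigcup_measurable; first exact: finite_II.
  move=> j /= jk; apply: measurableI; last by apply: mhit; lia.
  apply: fin_bigcup_measurable; first exact: finite_II.
  by move=> i _; apply: mhalt; lia.
rewrite hit_rec; apply: measurableU; [apply: measurableU; [apply: measurableU|]|].
- by case: ifP => _ //; exact: veq_measurable.
- apply: measurableI; first exact: veq_measurable.
  apply: fin_bigcup_measurable; first exact: finite_II.
  move=> k /= kn; have [nk|kn'] := leqP n k.
    by rewrite (@hit_empty k.+1) ?setI0 // ltnS.
  by apply: measurableI; apply: mhit; lia.
- apply: fin_bigcup_measurable; first exact: finite_II.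
  move=> k /= kn; have [nk|kn'] := leqP n k.
    by rewrite (@hit_empty k.+1) ?setI0 // ltnS.
  by apply: measurableI; [exact: mpair|apply: mhit; lia].
- apply: fin_bigcup_measurable; first exact: finite_II.
  by move=> k _; exact: mhalt.
Qed.

Lemma hit_measurable a b : measurable (hit a b : set space).
Proof.
have [/hit_empty->//|ab] := ltnP b a.
rewrite -(subnKC ab) hit_shiftE; apply: measurable_preimage; first exact: shift_measurable.
exact: hit0_measurable.
Qed.

Lemma esc_measurable k : measurable (esc 0 k : set space).
Proof.
rewrite esc_mirrorE; apply: measurable_preimage; first exact: mirror_measurable.
exact: hit0_measurable.
Qed.

Lemma halt_measurable k j : measurable (halt 0 k j : set space).
Proof.
rewrite haltE; apply: measurableI; last exact: late_measurable.
apply: measurableI; last exact: hit_measurable.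
by apply: measurableI; [exact: esc_measurable|exact: veq_measurable].
Qed.

Lemma behind_measurable n : measurable
  (\bigcup_(j < n) ((\bigcup_(k < n) halt 0 k j) `&` hit j.+1 n) : set space).
Proof.
apply: fin_bigcup_measurable; first exact: finite_II.
move=> j _; apply: measurableI; last exact: hit_measurable.
apply: fin_bigcup_measurable; first exact: finite_II.
by move=> k _; exact: halt_measurable.
Qed.

Lemma pair_measurable n : measurable (pair 0 n : set space).
Proof.
case: (posnP n) => [->|n0]; first by rewrite pair0.
rewrite pair_rec //; apply: measurableD; last exact: behind_measurable.
by apply: measurableI; [exact: veq_measurable|exact: hit_measurable].
Qed.

Definition upto n : set label := [set k | (rank k <= n)%N].
Definition after n : set label := [set k | (n < rank k)%N].

Lemma pos_dep n z z' : (forall k, (rank k <= n)%N -> z k = z' k) -> pos z n = pos z' n.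
Proof. by move=> zz; apply: eq_bigr => i _; rewrite zz //= -ltnS. Qed.

Lemma vel_dep n z z' : (forall k, rank k = n -> z k = z' k) -> vel z n = vel z' n.
Proof. by move=> zz; rewrite /vel zz. Qed.

Lemma spin_dep n z z' : (forall k, rank k = n -> z k = z' k) -> spin z n = spin z' n.
Proof. by move=> zz; rewrite /spin zz. Qed.

Lemma hit0_dep n z z' : (forall k, (rank k <= n)%N -> z k = z' k) ->
  hit 0 n z -> hit 0 n z'.
Proof.
move=> zz; rewrite /hit /=.
rewrite (@Hit_shift R (pos z) (vel z) (spin z) (pos z') (vel z') (spin z') 0 0 n) //.
move=> m mn; rewrite add0n add0r; split.
- by apply: pos_dep => k km; apply/esym/zz/(leq_trans km).
- by apply: vel_dep => k km; apply/esym/zz; rewrite km.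
- by apply: spin_dep => k km; apply/esym/zz; rewrite km.
Qed.

Lemma rank_shift a k : rank (shift_label a k) = (a + rank k)%N.
Proof. by case: k => [[]|]. Qed.

Lemma hit_dep a b z z' : (forall k, (a <= rank k <= b)%N -> z k = z' k) ->
  hit a b z -> hit a b z'.
Proof.
move=> zz; have [ba [h _ _]|ab] := ltnP b a; first by lia.
rewrite -(subnKC ab) (hit_shiftE a) /=; apply: hit0_dep => k kb.
by rewrite /shift_seq /remap zz // rank_shift; lia.
Qed.

Lemma esc_dep n z z' : (forall k, (rank k <= n)%N -> z k = z' k) ->
  esc 0 n z -> esc 0 n z'.
Proof.
move=> zz; rewrite esc_mirrorE /=; apply: hit0_dep => k kn.
rewrite /mirror_seq /remap zz //.
by case: k kn => [[k|k]|k] /= kn; case: ifP => ?; lia.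
Qed.

Lemma halt_dep k n z z' : (forall l, (rank l <= n)%N -> z l = z' l) ->
  halt 0 k n z -> halt 0 k n z'.
Proof.
move=> zz [E V H L]; have [kn _ _] := H.
have sub m (mn : (m <= n)%N) l (lm : (rank l <= m)%N) : z l = z' l.
  by apply: zz; exact: leq_trans mn.
have kn1 : (k.+1 <= n)%N by lia.
have kn0 : (k <= n)%N by lia.
split.
- by apply: (esc_dep (sub k kn0) E).
- by rewrite -(vel_dep (z := z)) // => l lk; apply: zz; rewrite lk.
- by apply: hit_dep H => l /andP[_ ln]; exact: zz.
- move: L; rewrite /late (pos_dep (sub _ kn1)) (pos_dep (sub _ (leq0n n))) (pos_dep zz).
  by rewrite (@spin_dep _ z z') // => l lk; apply: zz; rewrite lk.
Qed.

Lemma pair_dep n z z' : (forall k, (rank k <= n)%N -> z k = z' k) ->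
  pair 0 n z -> pair 0 n z'.
Proof.
case: (posnP n) => [->|n0] zz; first by rewrite pair0.
rewrite pair_rec // => -[[v0 H] nB]; split.
  split; first by rewrite /veq /= -(vel_dep (z := z)) // => l lk; apply: zz; rewrite lk.
  by apply: hit_dep H => l /andP[_ ln]; exact: zz.
move=> [j jn [[k kn H1] H2]]; apply: nB; exists j => //; split.
  exists k => //; apply: halt_dep H1 => l lj; apply/esym/zz/(leq_trans lj).
  exact: ltnW.
by apply: hit_dep H2 => l /andP[_ ln]; apply/esym/zz.
Qed.

End Events.

Section Atoms.
Context (R : realType) d (T : measurableType d) (P : probability T R).

(** The atoms in [l] carry total mass 1, so everything else is negligible. Velocities and spins are
    prescribed by such atoms. *)
Lemma law_atoms (Y : T -> R) (l : seq R) (B : set R) : measurable_fun setT Y ->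
  uniq l -> (\sum_(a <- l) P (Y @^-1` [set a]) = 1)%E -> measurable B ->
  P (Y @^-1` B) = (\sum_(a <- l) (if a \in B then P (Y @^-1` [set a]) else 0))%E.
Proof.
move=> mY ul l1 mB.
have mYB C : measurable C -> measurable (Y @^-1` C).
  by move=> mC; rewrite -[X in measurable X]setTI; exact: mY.
have sumP (F : R -> set T) : (forall a, measurable (F a)) ->
    (forall a, F a `<=` Y @^-1` [set a]) ->
    P (\bigcup_(a in [set` l]) F a) = (\sum_(a <- l) P (F a))%E.
  move=> mF FY; rewrite measure_fin_bigcup -?fsbig_seq //; first exact: finite_seq.
  by move=> a b _ _ [t [/FY/= <- /FY/= <-]].
pose A := \bigcup_(a in [set` l]) Y @^-1` [set a].
have mA : measurable A.
  by apply: fin_bigcup_measurable => [|a _]; [exact: finite_seq|exact: (mYB _ (measurable_set1 a))].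
have PA : P A = 1%E.
  have := sumP (fun a => Y @^-1` [set a]) (fun a => mYB _ (measurable_set1 a)).
  by rewrite l1 => h; apply: h => a t.
have PAC : P (~` A) = 0%E by rewrite probability_setC // PA subee.
have D0 : P (Y @^-1` B `\` A) = 0%E.
  apply/eqP; rewrite eq_le measure_ge0 andbT -PAC.
  apply: le_measure; rewrite ?inE; [exact: measurableD (mYB _ mB) mA|exact: measurableC|].
  by move=> t [].
transitivity (P (Y @^-1` B `&` A)).
  transitivity (P (Y @^-1` B `\` A) + P (Y @^-1` B `&` A))%E; last by rewrite D0 add0e.
  exact: measureDI (mYB _ mB) mA.
have -> : Y @^-1` B `&` A = \bigcup_(a in [set` l]) (Y @^-1` B `&` Y @^-1` [set a]).
  by rewrite /A setI_bigcupr.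
rewrite sumP; last 2 first.
- by move=> a; apply: measurableI; apply: mYB => //; exact: measurable_set1.
- by move=> a t [].
apply: eq_bigr => a _; case: ifPn => [/set_mem aB|/negP aB].
  by congr (P _); apply/seteqP; split=> t /=; [case|move=> ta; rewrite ta].
rewrite (_ : _ `&` _ = set0) ?measure0 //.
by apply/seteqP; split=> t //= [Bt ta]; apply: aB; rewrite inE -ta.
Qed.

End Atoms.

Section RealProbability.
Context (R : realType) d (T : measurableType d) (P : probability T R).

Definition pr (E : set T) : R := fine (P E).

Lemma prE E : measurable E -> P E = (pr E)%:E.
Proof. by move=> mE; rewrite /pr fineK ?fin_num_measure. Qed.

Lemma pr_ge0 E : 0 <= pr E.
Proof. exact: fine_ge0. Qed.

Lemma pr0 : pr set0 = 0.
Proof. by rewrite /pr measure0. Qed.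

Lemma pr_le1 E : measurable E -> pr E <= 1.
Proof. by move=> mE; rewrite -lee_fin -prE //; exact: probability_le1. Qed.

Lemma prU E F : measurable E -> measurable F -> E `&` F = set0 ->
  pr (E `|` F) = pr E + pr F.
Proof.
move=> mE mF EF; apply: EFin_inj; rewrite EFinD -!prE //; last exact: measurableU.
exact: measureU.
Qed.

Lemma pr_bigcup n (F : nat -> set T) : (forall k, measurable (F k)) ->
  (forall i j t, F i t -> F j t -> i = j) ->
  pr (\bigcup_(k < n) F k) = \sum_(k < n) pr (F k).
Proof.
move=> mF FF; elim: n => [|n IH].
  by rewrite bigcup_mkord !big_ord0 pr0.
rewrite bigcup_mkord !big_ord_recr /= -bigcup_mkord prU ?IH //.
- by apply: fin_bigcup_measurable => [|k _]; [exact: finite_II|exact: mF].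
- apply/seteqP; split=> t // [[k kn Fk] Fn]; move: kn.
  by rewrite (FF _ _ _ Fk Fn) /= ltnn.
Qed.

End RealProbability.

(** * The generating function *)

Definition convolution (R : realType) (f g : nat -> R) (n : nat) : R :=
  \sum_(i < n.+1) f i * g (n - i)%N.

Section Convolution.
Context (R : realType).
Implicit Types f g : nat -> R.

Definition psum f N : R := \sum_(i < N) f i.

Lemma psumS f N : psum f N.+1 = psum f N + f N.
Proof. by rewrite /psum big_ord_recr. Qed.

Lemma psum_le f M N : (forall n, 0 <= f n) -> (M <= N)%N -> psum f M <= psum f N.
Proof.
move=> f0; elim: N => [|N IH]; first by rewrite leqn0 => /eqP->.
rewrite leq_eqVlt => /predU1P[->//|]; rewrite ltnS psumS => /IH h.
by rewrite (le_trans h) // lerDl.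
Qed.

Lemma psum_ge0 f N : (forall n, 0 <= f n) -> 0 <= psum f N.
Proof. by move=> f0; apply: sumr_ge0. Qed.

Lemma convolution_ge0 f g n : (forall n, 0 <= f n) -> (forall n, 0 <= g n) -> 0 <= convolution f g n.
Proof. by move=> f0 g0; apply: sumr_ge0 => i _; rewrite mulr_ge0. Qed.

Lemma psum_convolution f g N : psum (convolution f g) N = \sum_(i < N) f i * psum g (N - i).
Proof.
elim: N => [|N IH]; first by rewrite /psum !big_ord0.
have g1 : psum g 1 = g 0%N by rewrite /psum big_ord1.
rewrite psumS IH big_ord_recr /= subSn // subnn g1.
rewrite /convolution big_ord_recr /= subnn addrA; congr (_ + _).
rewrite -big_split /=; apply: eq_bigr => i _.
have iN := ltnW (ltn_ord i).
by rewrite -mulrDr subSn // psumS.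
Qed.

Lemma psum_convolution_le f g N : (forall n, 0 <= f n) -> (forall n, 0 <= g n) ->
  psum (convolution f g) N <= psum f N * psum g N.
Proof.
move=> f0 g0; rewrite psum_convolution {2}/psum mulr_suml; apply: ler_sum => i _.
by rewrite ler_wpM2l // psum_le // leq_subr.
Qed.

(** Two indices below [N] have a sum below [2 * N]. *)
Lemma psum_convolution_ge f g N : (forall n, 0 <= f n) -> (forall n, 0 <= g n) ->
  psum f N * psum g N <= psum (convolution f g) (2 * N).
Proof.
move=> f0 g0; rewrite psum_convolution mul2n -addnn {1}/psum mulr_suml big_split_ord /=.
rewrite -[leLHS]addr0 lerD //.
  by apply: ler_sum => i _; rewrite ler_wpM2l // psum_le //; have := ltn_ord i; lia.
by apply: sumr_ge0 => i _; rewrite mulr_ge0 // psum_ge0.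
Qed.

Lemma convolution_geometric f g z n :
  convolution (fun n => f n * z ^+ n) (fun n => g n * z ^+ n) n = convolution f g n * z ^+ n.
Proof.
rewrite /convolution mulr_suml; apply: eq_bigr => i _.
have -> : z ^+ n = z ^+ i * z ^+ (n - i) by rewrite -exprD subnKC // -ltnS.
by ring.
Qed.

End Convolution.

(** * The functional equation and the choice of its root *)

Section GeneratingFunction.
Context (R : realType) (p : R) (A : nat -> R).
Hypothesis p01 : 0 <= p <= 1.
Hypothesis A_ge0 : forall n, 0 <= A n.
Hypothesis A0 : A 0%N = 0.
Hypothesis A_sum : forall N, psum A N <= 1.

Let A4 := convolution (convolution (convolution A A) A) A.

Hypothesis A_rec : forall n,
  2 * A n.+1 = (if n == 0%N then 1 - p else 0) + (1 + 2 * p) * convolution A A n - p * A4 n.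

Let F (q : R) := (1 - p) + (1 + 2 * p) * q ^+ 2 - p * q ^+ 4.

Let b z n := A n * z ^+ n.

Let b_ge0 z : 0 <= z -> forall n, 0 <= b z n.
Proof. by move=> z0 n; rewrite mulr_ge0 // exprn_ge0. Qed.

Let b_le z n : 0 <= z <= 1 -> b z n <= A n.
Proof. by move=> /andP[z0 z1]; rewrite ler_piMr // exprn_ile1. Qed.

Lemma psum_dist z M N : 0 <= z <= 1 -> (M <= N)%N ->
  psum (b z) N - psum (b z) M <= psum A N - psum A M.
Proof.
move=> z01; elim: N => [|N IH]; first by rewrite leqn0 => /eqP->; rewrite !subrr.
rewrite leq_eqVlt => /predU1P[->|]; first by rewrite !subrr.
rewrite ltnS !psumS => /IH h; have := b_le N z01; lra.
Qed.

Lemma psum_b_le1 z N : 0 <= z <= 1 -> psum (b z) N <= 1.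
Proof.
by move=> z01; apply: le_trans (A_sum N); apply: ler_sum => i _; exact: b_le.
Qed.

(** Partial sums of a convolution lie between products of partial sums over half the range and over
    the full range. The fourth power takes three nested convolutions, whence [8 = 2 ^ 3]; the error
    is then a multiple of a tail of [A], whatever [z] is. *)
Lemma approximate_equation z M : 0 <= z <= 1 -> (0 < M)%N ->
  `|2 * psum (b z) (8 * M) - z * F (psum (b z) (8 * M))| <=
  12 * (psum A (8 * M).+1 - psum A M).
Proof.
move=> z01 M0; have M2 : (M <= 2 * M)%N by rewrite leq_pmull.
have M4 : (M <= 2 * (2 * M))%N by rewrite mulnA leq_pmull.
have M8 : (8 * M = 2 * (2 * (2 * M)))%N by rewrite !mulnA.
have M28 : (2 * M <= 8 * M)%N by rewrite leq_pmul2r.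
have MN : (M <= 8 * M)%N by rewrite leq_pmull.
have N_gt0 : (0 < 8 * M)%N by rewrite muln_gt0.
set N := (8 * M)%N in M8 M28 MN N_gt0 *; have /andP[z0 z1] := z01; have /andP[p0 p1] := p01.
have b0 := b_ge0 z0.
pose b2 := convolution (b z) (b z); pose b3 := convolution b2 (b z); pose b4 := convolution b3 (b z).
have b20 n : 0 <= b2 n by apply: convolution_ge0.
have b30 n : 0 <= b3 n by apply: convolution_ge0.
have b40 n : 0 <= b4 n by apply: convolution_ge0.
have E2 n : b2 n = convolution A A n * z ^+ n by exact: convolution_geometric.
have E3 n : b3 n = convolution (convolution A A) A n * z ^+ n.
  by rewrite -convolution_geometric; apply: eq_bigr => i _; rewrite E2.
have E4 n : b4 n = A4 n * z ^+ n.
  by rewrite -convolution_geometric; apply: eq_bigr => i _; rewrite E3.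
(* The recursion summed, exactly: its factor [z] takes the left-hand sum one term further than the
   right-hand ones. *)
have eqn K : 2 * psum (b z) K.+2 = z * ((1 - p) + (1 + 2 * p) * psum b2 K.+1 - p * psum b4 K.+1).
  elim: K => [|K IH].
    rewrite /psum !big_ord_recr !big_ord0 /= !E2 !E4 /b A0 expr0 expr1.
    by transitivity (z * (2 * A 1%N)); [ring|rewrite A_rec eqxx; ring].
  rewrite psumS mulrDr IH [psum b2 K.+2]psumS [psum b4 K.+2]psumS E2 E4 /b.
  have -> : 2 * (A K.+2 * z ^+ K.+2) = 2 * A K.+2 * z ^+ K.+2 by ring.
  by rewrite A_rec /= exprS; ring.
have N0 : N = N.-1.+1 by rewrite prednK.
have := eqn N.-1; rewrite -N0 psumS => {}eqn.
set u := psum (b z) N in eqn *; set w := psum (b z) M.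
have w0 : 0 <= w by exact: psum_ge0.
have wu : w <= u by exact: psum_le.
have u1 : u <= 1 by exact: psum_b_le1.
have uw : u - w <= psum A N - psum A M by exact: psum_dist.
have S2u : psum b2 N <= u ^+ 2 by rewrite expr2; exact: psum_convolution_le.
have S4u : psum b4 N <= u ^+ 4.
  apply: le_trans (psum_convolution_le _ _ _) _ => //.
  rewrite -/u exprSr ler_wpM2r //; first by lra.
  apply: le_trans (psum_convolution_le _ _ _) _ => //.
  rewrite -/u exprSr ler_wpM2r //; first by lra.
have S2w : w ^+ 2 <= psum b2 N.
  rewrite expr2; apply: le_trans (psum_convolution_ge _ _ _) _ => //.
  exact: psum_le.
have S4w : w ^+ 4 <= psum b4 N.
  rewrite M8.
  apply: le_trans (psum_convolution_ge _ _ _) => //.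
  rewrite exprSr ler_pM ?exprn_ge0 //; last exact: psum_le.
  apply: le_trans (psum_convolution_ge _ _ _) => //.
  rewrite exprSr ler_pM ?exprn_ge0 //; last exact: psum_le.
  by rewrite expr2; exact: psum_convolution_ge.
have u2w2 : u ^+ 2 - w ^+ 2 <= 2 * (u - w) by nra.
have u4w4 : u ^+ 4 - w ^+ 4 <= 4 * (u - w).
  have -> : u ^+ 4 - w ^+ 4 = (u ^+ 2 - w ^+ 2) * (u ^+ 2 + w ^+ 2) by ring.
  have h1 : 0 <= u ^+ 2 - w ^+ 2 by nra.
  have h2 : u ^+ 2 + w ^+ 2 <= 2 by nra.
  have h3 : 0 <= u ^+ 2 + w ^+ 2 by nra.
  nra.
have bN : b z N <= A N by exact: b_le.
have bN0 := b0 N.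
set D := psum A N - psum A M in uw *.
have -> : psum A N.+1 - psum A M = D + A N by rewrite psumS /D; ring.
have -> : 2 * u - z * F u = - (2 * b z N) - z * ((1 + 2 * p) * (u ^+ 2 - psum b2 N) -
    p * (u ^+ 4 - psum b4 N)).
  by rewrite /F; lra.
set X := u ^+ 2 - psum b2 N; set Y := u ^+ 4 - psum b4 N.
have X0 : 0 <= X by rewrite /X; lra.
have XD : X <= 2 * D by rewrite /X; lra.
have Y0 : 0 <= Y by rewrite /Y; lra.
have YD : Y <= 4 * D by rewrite /Y; lra.
(* The square costs at most [3 * 2 * D] and the fourth power [4 * D]; with the boundary term
   [2 * b z N] this stays below 12 times the tail. *)
have pX : 0 <= (1 + 2 * p) * X <= 6 * D by nra.
have pY : 0 <= p * Y <= 4 * D by nra.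
rewrite ler_norml; set W := (1 + 2 * p) * X - p * Y.
have WD : - (4 * D) <= W <= 6 * D by rewrite /W; lra.
have D0 : 0 <= D by lra.
have zW : - (4 * D) <= z * W <= 6 * D by nra.
by lra.
Qed.

Lemma bernoulli_ineq (z : R) n : 0 <= z <= 1 -> 1 - n%:R * (1 - z) <= z ^+ n.
Proof.
move=> /andP[z0 z1]; elim: n => [|n IH]; first by rewrite mul0r subr0 expr0.
have zn1 : 0 <= z ^+ n <= 1 by rewrite exprn_ge0 //= exprn_ile1.
rewrite exprS -[n.+1]addn1 natrD; nra.
Qed.

(** Continuity at [z = 1], made quantitative for a fixed number of terms. *)
Lemma psum_b_ge z M : 0 <= z <= 1 -> psum A M - M%:R * (1 - z) <= psum (b z) M.
Proof.
move=> z01; have /andP[z0 z1] := z01.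
apply: (@le_trans _ _ ((1 - M%:R * (1 - z)) * psum A M)).
  have := A_sum M; have : 0 <= M%:R * (1 - z) by rewrite mulr_ge0 // subr_ge0.
  by move: (_ * _) (psum _ _) => c a c0 a1; nra.
rewrite /psum mulr_sumr; apply: ler_sum => i _; rewrite mulrC /b.
rewrite ler_wpM2l //; apply: le_trans (bernoulli_ineq i z01).
by rewrite lerD2l lerN2 ler_wpM2r ?subr_ge0 // ler_nat ltnW.
Qed.

Variable q : R.
Hypothesis A_cvg : psum A @ \oo --> q.

Lemma psum_le_lim N : psum A N <= q.
Proof.
rewrite -(cvg_lim _ A_cvg) //.
apply: nondecreasing_cvgn_le; last by apply/cvg_ex; exists q.
by move=> M K MK; exact: psum_le.
Qed.

Lemma lim_le1 : q <= 1.
Proof.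
rewrite -(cvg_lim _ A_cvg) //; apply: limr_le; first by apply/cvg_ex; exists q.
by near=> N; exact: A_sum.
Unshelve. all: by end_near.
Qed.

Lemma psum_near e : 0 < e -> exists M0, forall M, (M0 <= M)%N -> q - e < psum A M.
Proof.
move=> e0; move/cvgrPdist_lt: A_cvg => /(_ e e0)[M0 _ MP]; exists M0 => M MM.
have := MP M MM; rewrite /= ltr_norml; lra.
Qed.

Lemma limit_equation : 2 * q = F q.
Proof.
have [p0 p1] := andP p01.
have one01 : 0 <= (1 : R) <= 1 by rewrite ler01 lexx.
have q1 := lim_le1.
have q0 : 0 <= q by apply: le_trans (psum_le_lim 0); exact: psum_ge0.
suff small e : 0 < e -> `|2 * q - F q| <= e.
  apply/eqP; rewrite -subr_eq0 -normr_eq0 eq_le normr_ge0 andbT.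
  by apply/ler_addgt0Pr => e e0; rewrite add0r; exact: small.
(* [approximate_equation] costs 12 times [e / 24], and replacing the partial sum by [q] at most 8
   times [e / 24]. *)
move=> e0; have e24 : 0 < e / 24 by lra.
have [M0 MP] := psum_near e24; pose M := M0.+1.
have := approximate_equation one01 (ltn0Sn M0); rewrite -/M mul1r.
have -> : psum (b 1) (8 * M) = psum A (8 * M).
  by apply: eq_bigr => i _; rewrite /b expr1n mulr1.
have aM : q - e / 24 < psum A M by apply: MP; exact: leqnSn.
have aN : psum A M <= psum A (8 * M) by rewrite psum_le // leq_pmull.
have aN1 := psum_le_lim (8 * M).+1; have aN2 := psum_le_lim (8 * M).
have a0 : 0 <= psum A (8 * M) by exact: psum_ge0.
set u := psum A (8 * M) in aN aN2 a0 *.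
rewrite !ler_norml => /andP[h1 h2].
have qu : 0 <= q - u <= e / 24 by lra.
have s2 : 0 <= q ^+ 2 - u ^+ 2 <= 2 * (q - u) by nra.
have s4 : 0 <= q ^+ 4 - u ^+ 4 <= 4 * (q - u).
  have -> : q ^+ 4 - u ^+ 4 = (q ^+ 2 - u ^+ 2) * (q ^+ 2 + u ^+ 2) by ring.
  have h3 : 0 <= q ^+ 2 + u ^+ 2 <= 2 by nra.
  nra.
have Fd : - (4 * (q - u)) <= F q - F u <= 6 * (q - u).
  rewrite /F; set X := q ^+ 2 - u ^+ 2 in s2; set Y := q ^+ 4 - u ^+ 4 in s4.
  have -> : 1 - p + (1 + 2 * p) * q ^+ 2 - p * q ^+ 4 -
    (1 - p + (1 + 2 * p) * u ^+ 2 - p * u ^+ 4) = (1 + 2 * p) * X - p * Y.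
    by rewrite /X /Y; ring.
  have hX : 0 <= (1 + 2 * p) * X <= 6 * (q - u) by nra.
  have hY : 0 <= p * Y <= 4 * (q - u) by nra.
  by lra.
by lra.
Qed.

(* If the partial sums exceeded the root [qs] of [2 q = F q], then by the
   intermediate value theorem the generating function would take the value
   [qs] at some [z < 1], whereas [2 qs = z F qs] forces [z = 1]. *)
Lemma limit_le_root qs : 0 < qs -> 2 * qs = F qs -> q <= qs.
Proof.
move=> qs0 qsE; rewrite leNgt; apply/negP => qsq.
have qqs : 0 < q - qs by rewrite subr_gt0.
have [M0 M0P] := psum_near qqs.
pose K := M0.+1.
have aK : qs < psum A K by have := M0P K (leqnSn _); lra.
have K0 : 0 < K%:R :> R by rewrite ltr0n.
(* The first [K] terms at [z] do not exceed [qs], so [psum_b_ge] will force [c <= 1 - z], while a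
   tail below [qs * c / 12] will give [2 * (1 - z) < c]. *)
pose c := (psum A K - qs) / K%:R.
have c0 : 0 < c by rewrite divr_gt0 // subr_gt0.
have qc0 : 0 < qs * c by exact: mulr_gt0.
have e0 : 0 < qs * c / 12 by lra.
have [M1 M1P] := psum_near e0; pose M := maxn M1 K.
have M_gt0 : (0 < M)%N by rewrite /M leq_max /= orbT.
have KM : (K <= 8 * M)%N by rewrite (leq_trans (leq_maxr M1 K)) // leq_pmull.
have aM : q - qs * c / 12 < psum A M by apply: M1P; exact: leq_maxl.
pose f : {poly R} := \poly_(i < 8 * M) A i - qs%:P.
have fE z : f.[z] = psum (b z) (8 * M) - qs.
  by rewrite /f hornerD hornerN hornerC horner_poly.
have f01 : f.[0] <= 0 <= f.[1].
  rewrite !fE; apply/andP; split.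
    have -> : psum (b 0) (8 * M) = 0.
      apply: big1 => -[[|i] ?] _; rewrite /b /=; first by rewrite A0 mul0r.
      by rewrite expr0n mulr0.
    by lra.
  have -> : psum (b 1) (8 * M) = psum A (8 * M).
    by apply: eq_bigr => i _; rewrite /b expr1n mulr1.
  by have := psum_le A_ge0 KM; lra.
have [z z01 rz] := poly_ivt ler01 f01.
have {rz} bz : psum (b z) (8 * M) = qs.
  by move: rz; rewrite /root fE subr_eq0 => /eqP.
have := approximate_equation z01 M_gt0; rewrite bz -qsE.
have /andP[z0 z1] := z01.
have -> : 2 * qs - z * (2 * qs) = 2 * qs * (1 - z) by ring.
rewrite ger0_norm; last by rewrite !mulr_ge0 ?subr_ge0 // ltW.
have := psum_le_lim (8 * M).+1 => aN h.
have hz : (1 - z) * (2 * qs) < c * qs by lra.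
have {}hz : 2 * (1 - z) < c by move: hz; rewrite mulrA ltr_pM2r // mulrC.
have := psum_b_ge K z01.
have : psum (b z) K <= psum (b z) (8 * M) by apply: psum_le => //; exact: b_ge0.
rewrite bz => h1 h2.
have : c <= 1 - z by rewrite ler_pdivrMr //; lra.
by lra.
Qed.

Lemma limit_value : q = if p <= 1 / 4 then 1 else (Num.sqrt p)^-1 - 1.
Proof.
have [p0 p1] := andP p01.
have q1 := lim_le1.
have q0 : 0 <= q by apply: le_trans (psum_le_lim 0); exact: psum_ge0.
have := limit_equation; rewrite /F => qE.
have fact : (1 - q) ^+ 2 * (p * (1 + q) ^+ 2 - 1) = 0.
  by rewrite !exprS expr0 in qE *; lra.
case: ifPn => [p4|]; last rewrite -ltNge => p4.
  apply/eqP; move/eqP: fact; rewrite mulf_eq0 sqrf_eq0 subr_eq0 => /orP[/eqP->//|/eqP h].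
  (* [p * (1 + q) ^+ 2 = 1] with [p <= 1 / 4] gives [1 + q >= 2]. *)
  by rewrite eq_le q1 /= leNgt; apply/negP => ql; nra.
set r := Num.sqrt p; have r2 : r ^+ 2 = p by rewrite sqr_sqrtr.
have r0 : 0 < r by rewrite sqrtr_gt0; lra.
have r12 : 1 / 2 < r by nra.
have r1 : r <= 1 by nra.
have rV : r * r^-1 = 1 by rewrite divff // gt_eqF.
pose qs := r^-1 - 1.
have rqs : r * (1 + qs) = 1 by rewrite /qs addrC subrK.
have qs1 : qs < 1 by nra.
have qs0 : 0 <= qs by nra.
have pqs : p * (1 + qs) ^+ 2 = 1 by rewrite -r2 -exprMn rqs expr1n.
(* At [p = 1] the root [qs] is 0, outside the scope of [limit_le_root]; there the recursion makes
   all [A n] vanish. *)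
have [p1'|p1'] := eqVneq p 1.
  have A00 n : A n = 0.
    have [m] := ubnP n; elim: m => // m IH in n *; case: n => [_|n]; first exact: A0.
    rewrite ltnS => nm.
    have c0 (g : nat -> R) : convolution g A n = 0.
      by apply: big1 => i _; rewrite IH ?mulr0 // (leq_ltn_trans (leq_subr _ _)).
    have := A_rec n; rewrite /A4 !c0 p1' subrr; case: ifP => _; lra.
  have -> : q = 0.
    apply: (cvg_unique _ A_cvg) => //.
    rewrite (_ : psum A = fun=> 0); first exact: cvg_cst.
    by apply/funext => N; apply: big1.
  by rewrite -[RHS]/qs; rewrite p1' in pqs; nra.
have qs_gt0 : 0 < qs.
  rewrite lt_neqAle qs0 andbT; apply/eqP => qs00; move/eqP: p1'; apply.
  by rewrite -pqs -qs00 addr0 expr1n mulr1.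
have FE : 2 * qs = F qs.
  have : (1 - qs) ^+ 2 * (p * (1 + qs) ^+ 2 - 1) = 0 by rewrite pqs subrr mulr0.
  by rewrite /F !exprS expr0; lra.
have qqs := limit_le_root qs_gt0 FE.
move/eqP: fact; rewrite mulf_eq0 sqrf_eq0 subr_eq0 => /orP[/eqP h|/eqP h]; first by lra.
by rewrite -[RHS]/qs; apply/eqP; rewrite eq_le qqs /=; nra.
Qed.

End GeneratingFunction.

(** * The random model *)

Section Model.
Context (R : realType).
Local Notation space := (g_sigma_algebraType (generated (@entry R label) setT)).
Context (P : probability space R) (p : R) (G : set R -> \bar R).
Hypothesis indep : independent_family P (@entry R label).
Hypothesis gap_law : forall n (B : set R), measurable B ->
  P [set z | B (z (gap_label n))] = G B.
Hypothesis vel_law : forall n,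
  [/\ P [set z | z (vel_label n) = 0] = p%:E,
      P [set z | z (vel_label n) = -1] = ((1 - p) / 2)%:E &
      P [set z | z (vel_label n) = 1] = ((1 - p) / 2)%:E].
Hypothesis spin_law : forall n,
  P [set z | z (spin_label n) = -1] = (2^-1)%:E /\
  P [set z | z (spin_label n) = 1] = (2^-1)%:E.

Let mentry k : measurable_fun setT (fun z : space => z k).
Proof. exact: entry_measurable. Qed.

Lemma vel_entry_law n (B : set R) : measurable B ->
  P [set z | B (z (vel_label n))] =
  ((if 0%R \in B then p%:E else 0) + ((if (-1)%R \in B then ((1 - p) / 2)%:E else 0) +
   (if 1%R \in B then ((1 - p) / 2)%:E else 0)))%E.
Proof.
move=> mB; have [v0 vN v1] := vel_law n.
have := @law_atoms R _ space P (fun z => z (vel_label n)) [:: 0; -1; 1] B (mentry _).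
rewrite !big_cons !big_nil /= !adde0 => ->//.
- by rewrite !(v0, vN, v1).
- rewrite /= !inE !negb_or andbT; apply/andP; split; last by apply/eqP; lra.
  by apply/andP; split; apply/eqP; lra.
- transitivity (p%:E + (((1 - p) / 2)%:E + ((1 - p) / 2)%:E))%E.
    by congr (_ + (_ + _))%E; [exact: v0|exact: vN|exact: v1].
  by rewrite -!EFinD; congr EFin; lra.
Qed.

Lemma spin_entry_law n (B : set R) : measurable B ->
  P [set z | B (z (spin_label n))] =
  ((if (-1)%R \in B then (2^-1)%:E else 0) + (if 1%R \in B then (2^-1)%:E else 0))%E.
Proof.
move=> mB; have [vN v1] := spin_law n.
have := @law_atoms R _ space P (fun z => z (spin_label n)) [:: -1; 1] B (mentry _).
rewrite !big_cons !big_nil /= !adde0 => ->//.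
- by rewrite !(vN, v1).
- by rewrite /= !inE andbT; apply/eqP; lra.
- transitivity ((2^-1)%:E + (2^-1)%:E : \bar R)%E.
    by congr (_ + _)%E; [exact: vN|exact: v1].
  by rewrite -EFinD; congr EFin; lra.
Qed.

Lemma veq_law n : [/\ P (veq n 0) = p%:E & P (veq n 1) = ((1 - p) / 2)%:E] /\
  P (veq n (-1)) = ((1 - p) / 2)%:E.
Proof.
have E (r : R) : veq n r = [set z : space | (@to_vel R @^-1` [set r]) (z (vel_label n))] by [].
have mE (r : R) : measurable (@to_vel R @^-1` [set r]).
  by have := @to_vel_measurable R measurableT _ (measurable_set1 r); rewrite setTI.
have t0 : to_vel (0 : R) = 0.
  by rewrite /to_vel; case: ifP => // /orP[]/eqP; lra.
have t1 : to_vel (1 : R) = 1 by rewrite /to_vel eqxx.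
have tN : to_vel (-1 : R) = -1 by rewrite /to_vel eqxx orbT.
have memE (r a : R) : (a \in @to_vel R @^-1` [set r]) = (to_vel a == r).
  by apply/idP/eqP => [/set_mem|h]; [|apply/mem_set].
have n10 : ((1 : R) == 0) = false by apply/eqP; lra.
have nN0 : ((-1 : R) == 0) = false by apply/eqP; lra.
have nN1 : ((-1 : R) == 1) = false by apply/eqP; lra.
have n1N : ((1 : R) == -1) = false by apply/eqP; lra.
have n01 : ((0 : R) == 1) = false by apply/eqP; lra.
have n0N : ((0 : R) == -1) = false by apply/eqP; lra.
by split; [split|]; rewrite E vel_entry_law // !memE t0 t1 tN
  !(n10, nN0, nN1, n1N, n01, n0N, eqxx) ?adde0 ?add0e.
Qed.

Lemma shift_law a (E : set space) : measurable E -> P (shift_seq a @^-1` E) = P E.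
Proof.
apply: remap_law => //; first exact: shift_label_inj.
move=> [[n|n]|n] B mB /=.
- by rewrite !gap_law.
- by rewrite !vel_entry_law.
- by rewrite !spin_entry_law.
Qed.

Lemma mirror_law N (E : set space) : measurable E -> P (mirror_seq N @^-1` E) = P E.
Proof.
apply: remap_law => //; first exact: mirror_label_inj.
  move=> [[n|n]|n]; first exact: measurable_id.
    rewrite /mirror_entry /=; case: (n <= N)%N => //.
    by apply: measurable_funN; exact: to_vel_measurable.
  rewrite /mirror_entry /=; case: (n <= N)%N => //.
  by apply: measurable_funN; exact: to_spin_measurable.
move=> [[n|n]|n] B mB /=; first by rewrite !gap_law.
  case: (n <= N)%N; last by rewrite !vel_entry_law.
  pose B' := (fun r : R => - to_vel r) @^-1` B.
  have mB' : measurable B'.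
    have := measurable_funN (@to_vel_measurable R); rewrite /comp => /(_ measurableT B mB).
    by rewrite setTI.
  have BE (r r' : R) : - to_vel r = r' -> (r \in B') = (r' \in B).
    by move=> rr; apply/idP/idP => /set_mem h; apply/mem_set; move: h; rewrite /B' /= rr.
  rewrite (vel_entry_law _ mB') vel_entry_law //.
  rewrite (BE 0 0) ?(BE 1 (-1)) ?(BE (-1) 1); first by congr (_ + _)%E; rewrite addeC.
  - by rewrite /to_vel eqxx orbT opprK.
  - by rewrite /to_vel eqxx.
  - by rewrite /to_vel; case: ifP => [/orP[]/eqP|]; lra.
case: (n <= N)%N; last by rewrite !spin_entry_law.
pose B' := (fun r : R => - to_spin r) @^-1` B.
have mB' : measurable B'.
  have := measurable_funN (@to_spin_measurable R); rewrite /comp => /(_ measurableT B mB).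
  by rewrite setTI.
have BE (r r' : R) : - to_spin r = r' -> (r \in B') = (r' \in B).
  by move=> rr; apply/idP/idP => /set_mem h; apply/mem_set; move: h; rewrite /B' /= rr.
rewrite (spin_entry_law _ mB') spin_entry_law //.
rewrite ?(BE 1 (-1)) ?(BE (-1) 1); first by rewrite addeC.
- by rewrite /to_spin; case: ifP; lra.
- by rewrite /to_spin; case: ifP; lra.
Qed.

Local Notation pr := (pr P).

(** [hitp n] refers to a block of [n] particles, so that sizes add up in convolutions. In [pairp n]
    the first particle is not counted: it is the shift from [n] to [n.+1] in [hitp_rec]. *)
Definition hitp n : R := if n is m.+1 then pr (hit 0 m) else 0.
Definition pairp n : R := pr (pair 0 n).

Lemma pr_hit a b : pr (hit a b) = hitp (b.+1 - a).
Proof.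
have [ba|ab] := ltnP b a; first by rewrite hit_empty // pr0 (eqP ba).
rewrite subSn // /hitp -{1}(subnKC ab) hit_shiftE /pr.
by rewrite (shift_law) //; exact: hit0_measurable.
Qed.

Lemma pr_esc k : pr (esc 0 k) = hitp k.+1.
Proof.
rewrite esc_mirrorE /pr (mirror_law) //.
exact: hit0_measurable.
Qed.

Lemma pr_indep (I I' : set label) (E E' : set space) : (forall k, I k -> ~ I' k) ->
  <<s generated (@entry R label) I >> E -> <<s generated (@entry R label) I' >> E' ->
  pr (E `&` E') = pr E * pr E'.
Proof.
move=> II' gE gE'.
have mE : measurable E by exact: (generated_measurable mentry gE).
have mE' : measurable E' by exact: (generated_measurable mentry gE').
apply: EFin_inj; rewrite EFinM -!prE //; last exact: measurableI.
exact: (independent_blocks mentry indep II' gE gE').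
Qed.

Lemma upto_after k l : upto k l -> ~ after k l.
Proof. by rewrite /upto /after /=; lia. Qed.

Lemma gen_hit_after k n : <<s generated (@entry R label) (after k) >> (hit k.+1 n).
Proof.
apply: dependent_generated; first exact: hit_measurable.
move=> z z' zz; apply: hit_dep => l /andP[kl _]; exact: zz.
Qed.

Lemma gen_veq_hit r k : <<s generated (@entry R label) (upto k) >> (veq 0 r `&` hit 1 k).
Proof.
apply: dependent_generated.
  by apply: measurableI; [exact: veq_measurable|exact: hit_measurable].
move=> z z' zz [v0 H]; split.
  by rewrite /veq /= -(vel_dep (z := z)) // => l l0; apply: zz; rewrite /upto /= l0.
by apply: hit_dep H => l /andP[_ lk]; exact: zz.
Qed.

Lemma gen_veq k r : <<s generated (@entry R label) (upto k) >> (veq k r).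
Proof.
apply: dependent_generated; first exact: veq_measurable.
move=> z z' zz; rewrite /veq /= -(@vel_dep _ k z z') // => l lk.
by apply: zz; rewrite /upto /= lk.
Qed.

Lemma gen_pair k : <<s generated (@entry R label) (upto k) >> (pair 0 k).
Proof.
apply: dependent_generated; first exact: pair_measurable.
by move=> z z' zz; exact: pair_dep.
Qed.

Lemma gen_halts n k : <<s generated (@entry R label) (upto k) >> (\bigcup_(i < n) halt 0 i k).
Proof.
apply: dependent_generated.
  apply: fin_bigcup_measurable; first exact: finite_II.
  by move=> i _; exact: halt_measurable.
by move=> z z' zz [i ik H]; exists i => //; apply: halt_dep H.
Qed.

Lemma pr_veq n : [/\ pr (veq n 0) = p, pr (veq n 1) = (1 - p) / 2 &
  pr (veq n (-1)) = (1 - p) / 2].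
Proof.
by have [[h0 h1] hN] := veq_law n; split; rewrite /pr ?h0 ?h1 ?hN.
Qed.

Lemma pr_veq_hit r k : pr (veq 0 r `&` hit 1 k) = pr (veq 0 r) * hitp k.
Proof.
rewrite (pr_indep (@upto_after 0) (@gen_veq 0 r) (@gen_hit_after 0 k)) pr_hit.
by rewrite subn1.
Qed.

Lemma halt_bounds (z : space) i k j : halt i k j z -> (k.+2 <= j)%N.
Proof. by case=> _ _ []. Qed.

(* Reflecting the block [0..m.+2] exchanges the two distances compared in
   [late] and flips the spin that decides ties. *)
Lemma halt_split k m : (k <= m)%N ->
  pr (halt 0 k m.+2) + pr (halt 0 (m - k) m.+2) = p * (hitp k.+1 * hitp (m - k).+1).
Proof.
move=> km; set n := m.+2.
have mE : measurable (mirror_seq n @^-1` halt 0 (m - k) n : set space).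
  by apply: measurable_preimage; [exact: mirror_measurable|exact: halt_measurable].
have <- : pr (mirror_seq n @^-1` halt 0 (m - k) n) = pr (halt 0 (m - k) n).
  rewrite /pr (mirror_law) //; exact: halt_measurable.
have mirE (z : space) : halt 0 (m - k) n (mirror_seq n z) <->
    [/\ esc 0 k z, vel z k.+1 = 0, hit k.+2 n z &
      pos z n - pos z k.+1 < pos z k.+1 - pos z 0 \/
      (pos z n - pos z k.+1 = pos z k.+1 - pos z 0 /\ spin z k.+1 = 1)].
  have M := @mirror_mirrored R n z.
  have e1 : (n - (m - k).+1 = k.+1)%N by rewrite /n; lia.
  have mkn : ((m - k).+1 <= n)%N by rewrite /n; lia.
  have [x1 v1 s1] := M _ mkn.
  have [x0 _ _] := M 0%N (leq0n n).
  have [xn _ _] := M n (leqnn n).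
  rewrite e1 in x1 v1 s1; rewrite subn0 in x0; rewrite subnn in xn.
  have h1 := @hit_mirror R n k.+2 n z; have h2 := @esc_mirror R n 0 k z.
  have e2 : (n - k.+2 = m - k)%N by rewrite /n; lia.
  have e3 : (n - k = (m - k).+2)%N by rewrite /n; lia.
  rewrite subnn e2 in h1; rewrite subn0 e3 in h2.
  have kn2 : (k.+2 <= n)%N by rewrite /n; lia.
  have kn0 : (k <= n)%N by rewrite /n; lia.
  have [h1a h1b] := h1 kn2 (leqnn n); have [h2a h2b] := h2 (leq0n k) kn0.
  rewrite /halt /Halt /late /= v1 s1 x1 x0 xn; split.
    move=> [E V H L]; split; [exact: h2b|by apply/oppr_inj; rewrite V oppr0|exact: h1b|].
    case: L => [L|[L L']]; [left|right; split]; try lra.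
  move=> [E V H L]; split; [exact: h1a|by rewrite V oppr0|exact: h2a|].
  by case: L => [L|[L L']]; [left|right; split; rewrite ?L' //]; lra.
rewrite -prU //; last 2 first.
- exact: halt_measurable.
- apply/seteqP; split=> z // [[_ _ _ L]] /mirE[_ _ _].
  by case: L => [L|[L sz]] [L'|[L' sz']]; try lra; rewrite sz in sz'; lra.
(* The distances are different, or equal with one of the two spins, so the two disjoint events
   exhaust the event without [late], which factorises. *)
have -> : halt 0 k n `|` mirror_seq n @^-1` halt 0 (m - k) n =
    (esc 0 k `&` veq k.+1 0) `&` hit k.+2 n :> set space.
  apply/seteqP; split=> z.
    by move=> [[E V H _]|/mirE[E V H _]].
  move=> [[E V] H].
  have [L|L|L] := ltgtP (pos z k.+1 - pos z 0) (pos z n - pos z k.+1).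
  - by left; split => //; left.
  - by right; apply/mirE; split => //; left.
  - have [_ _ /(_ k.+1)[sz|sz]] := config_admissible z.
      by left; split => //; right.
    by right; apply/mirE; split => //; right.
have gen : <<s generated (@entry R label) (upto k.+1) >> (esc 0 k `&` veq k.+1 0).
  apply: dependent_generated.
    by apply: measurableI; [exact: esc_measurable|exact: veq_measurable].
  move=> z z' zz [E V]; split.
    by apply: esc_dep E => l lk; apply: zz; rewrite /upto /= (leq_trans lk).
  rewrite /veq /= -(@vel_dep _ k.+1 z z') // => l lk.
  by apply: zz; rewrite /upto /= lk.
rewrite (pr_indep (@upto_after k.+1) gen (@gen_hit_after k.+1 n)) pr_hit.
have gesc : <<s generated (@entry R label) (upto k) >> (esc 0 k : set space).
  apply: dependent_generated; first exact: esc_measurable.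
  by move=> z z' zz; exact: esc_dep.
have gv : <<s generated (@entry R label) (after k) >> (veq k.+1 0 : set space).
  apply: dependent_generated; first exact: veq_measurable.
  move=> z z' zz; rewrite /veq /= -(@vel_dep _ k.+1 z z') // => l lk.
  by apply: zz; rewrite /after /= lk.
rewrite (pr_indep (@upto_after k) gesc gv) pr_esc; have [-> _ _] := pr_veq k.+1.
have -> : (n.+1 - k.+2 = (m - k).+1)%N by rewrite /n; lia.
by ring.
Qed.

(** [halt_split] only controls the sum of the terms [k] and [m - k]; adding over [k] counts every
    term twice, whence [p / 2]. *)
Lemma halt_sum n : \sum_(k < n.+1) pr (halt 0 k n) = p / 2 * convolution hitp hitp n.
Proof.
have halt0 k : (n < k.+2)%N -> pr (halt 0 k n) = 0.
  move=> nk; rewrite (_ : halt 0 k n = set0) ?pr0 //.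
  by apply/seteqP; split=> z // /halt_bounds; lia.
case: n halt0 => [|[|m]] halt0.
- by rewrite /convolution !big_ord1 halt0 // mul0r mulr0.
- by rewrite /convolution !big_ord_recr !big_ord0 /= !halt0 // mul0r mulr0 !addr0 mulr0.
(* The static particle and an arrival behind it take two places, so the last two [k] are void; the
   end terms of the convolution vanish with [hitp 0]. *)
rewrite 2!big_ord_recr /= !halt0 // !addr0.
have -> : convolution hitp hitp m.+2 = \sum_(k < m.+1) hitp k.+1 * hitp (m - k).+1.
  rewrite /convolution big_ord_recl big_ord_recr /= mul0r add0r subnn mulr0 addr0.
  by apply: eq_bigr => i _; rewrite /bump /= add1n subSS subSn // -ltnS.
have eqr : \sum_(k < m.+1) pr (halt 0 k m.+2) =
    \sum_(k < m.+1) pr (halt 0 (m - k) m.+2).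
  by rewrite (reindex_inj rev_ord_inj) /=; apply: eq_bigr => i _; rewrite subSS.
have : \sum_(k < m.+1) pr (halt 0 k m.+2) + \sum_(k < m.+1) pr (halt 0 (m - k) m.+2) =
    p * \sum_(k < m.+1) hitp k.+1 * hitp (m - k).+1.
  rewrite -big_split /= mulr_sumr; apply: eq_bigr => k _.
  by rewrite halt_split // -ltnS.
rewrite -eqr => h.
by lra.
Qed.

Lemma hitp_rec n : hitp n.+1 = (if n == 0%N then (1 - p) / 2 else 0) +
  p * convolution hitp hitp n + convolution pairp hitp n + p / 2 * convolution hitp hitp n.
Proof.
rewrite {1}/hitp hit_rec.
have mhh k : measurable (hit 1 k `&` hit k.+1 n : set space).
  by apply: measurableI; exact: hit_measurable.
have mB0 : measurable ((if n == 0%N then veq 0 (-1) else set0) : set space).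
  by case: ifP => _ //; exact: veq_measurable.
have mB1 : measurable (veq 0 0 `&` \bigcup_(k < n.+1) (hit 1 k `&` hit k.+1 n) : set space).
  apply: measurableI; first exact: veq_measurable.
  by apply: fin_bigcup_measurable => [|k _]; [exact: finite_II|exact: mhh].
have mph k : measurable (pair 0 k `&` hit k.+1 n : set space).
  by apply: measurableI; [exact: pair_measurable|exact: hit_measurable].
have mB2 : measurable (\bigcup_(k < n.+1) (pair 0 k `&` hit k.+1 n) : set space).
  by apply: fin_bigcup_measurable => [|k _]; [exact: finite_II|exact: mph].
have mB3 : measurable (\bigcup_(k < n.+1) halt 0 k n : set space).
  by apply: fin_bigcup_measurable => [|k _]; [exact: finite_II|exact: halt_measurable].
rewrite prU //; [|by do 2?[apply: measurableU => //]|]; last first.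
  apply/seteqP; split=> z // [+ [k _ H]]; have [[_ v0 _] _ _ _] := H.
  case=> [[|[v00 _]]|[j _ [Pj _]]].
  - by case: ifP => // _; rewrite /veq /= v0; lra.
  - by move: v00; rewrite /veq /= v0; lra.
  - exact: (Pair_Halt (config_admissible z) Pj H).
rewrite prU //; [|by apply: measurableU => //|]; last first.
  apply/seteqP; split=> z // [+ [k _ [[_ v0 _ _] _]]] => -[|[v00 _]].
  - by case: ifP => // _; rewrite /veq /= v0; lra.
  - by move: v00; rewrite /veq /= v0; lra.
rewrite prU //; last first.
  apply/seteqP; split=> z // [+ [v00 _]].
  by case: ifP => // _; move: v00; rewrite /veq /= => ->; lra.
congr (_ + _ + _ + _).
- by case: ifP => _; [have [_ _ ->] := pr_veq 0|rewrite pr0].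
- rewrite setI_bigcupr pr_bigcup; last 2 first.
  + by move=> k; apply: measurableI; [exact: veq_measurable|exact: mhh].
  + move=> i j z [_ [Hi _]] [_ [Hj _]].
    exact: (Hit_unique (config_admissible z) Hi Hj).
  rewrite /convolution mulr_sumr; apply: eq_bigr => k _.
  rewrite setIA (pr_indep (@upto_after k) (@gen_veq_hit 0 k) (@gen_hit_after k n)).
  by rewrite pr_veq_hit pr_hit subSS; have [-> _ _] := pr_veq 0; rewrite mulrA.
- rewrite pr_bigcup //; last first.
    move=> i j z [Hi _] [Hj _]; exact: (Pair_unique (config_admissible z) Hi Hj).
  apply: eq_bigr => k _.
  by rewrite (pr_indep (@upto_after k) (@gen_pair k) (@gen_hit_after k n)) pr_hit subSS.
- rewrite pr_bigcup; last 2 first.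
  + by move=> k; exact: halt_measurable.
  + by move=> i j z Hi Hj; have [] := Halt_unique (config_admissible z) Hi Hj.
  exact: halt_sum.
Qed.

(** The left-hand side is the probability of a right-moving first particle in front of an
    independent arrival, an event split by [hit_behind]. *)
Lemma pairp_rec n :
  (1 - p) / 2 * hitp n = pairp n + p / 2 * convolution (convolution hitp hitp) hitp n.
Proof.
case: (posnP n) => [->|n0].
  by rewrite /pairp pair0 pr0 /convolution !big_ord1 /= !mul0r !mulr0 addr0.
have [_ v1 _] := pr_veq 0; rewrite -v1 -pr_veq_hit hit_behind //.
rewrite prU; last 3 first.
- exact: pair_measurable.
- exact: behind_measurable.
- exact: pair_not_behind.
congr (_ + _); rewrite pr_bigcup; last 2 first.
- move=> j; apply: measurableI; last exact: hit_measurable.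
  apply: fin_bigcup_measurable; first exact: finite_II.
  by move=> k _; exact: halt_measurable.
- move=> i j z [[k _ Hi] _] [[l _ Hj] _].
  by have [] := Halt_unique (config_admissible z) Hi Hj.
rewrite /convolution big_ord_recr /= subnn mulr0 addr0 mulr_sumr; apply: eq_bigr => j _.
rewrite (pr_indep (@upto_after j) (@gen_halts n j) (@gen_hit_after j n)) pr_hit subSS.
rewrite mulrA -halt_sum; congr (_ * _).
rewrite (_ : \bigcup_(k < n) halt 0 k j = \bigcup_(k < j.+1) halt 0 k j); last first.
  apply/seteqP; split=> z [k /= kn Hk]; exists k => //=; have := halt_bounds Hk; first by lia.
  by have := ltn_ord j; lia.
rewrite pr_bigcup //; first by move=> k; exact: halt_measurable.
by move=> i l z Hi Hj; have [] := Halt_unique (config_admissible z) Hi Hj.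
Qed.

Hypothesis p01 : 0 <= p <= 1.

Let A := hitp.

Lemma reached_measurable : measurable (\bigcup_n (hit 0 n : set space)).
Proof. by apply: bigcup_measurable => n _; exact: hit0_measurable. Qed.

Lemma psum_hitp N : psum A N.+1 = pr (\bigcup_(n < N) hit 0 n).
Proof.
rewrite pr_bigcup; last 2 first.
- exact: hit0_measurable.
- by move=> i j z Hi Hj; exact: (Hit_unique (config_admissible z) Hi Hj).
by rewrite /psum big_ord_recl add0r; apply: eq_bigr => i _.
Qed.

Lemma psum_hitp_cvg : psum A @ \oo --> pr (\bigcup_n hit 0 n).
Proof.
rewrite -(cvg_shiftS (psum A)) /=.
rewrite (_ : (fun n => psum A n.+1) = fine \o (P \o (fun N => \bigcup_(n < N) hit 0 n))); last first.
  by apply/funext => N; rewrite psum_hitp.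
apply: fine_cvg; rewrite -prE; last exact: reached_measurable.
rewrite (_ : \bigcup_n hit 0 n = \bigcup_N \bigcup_(n < N) hit 0 n); last first.
  apply/seteqP; split=> z; first by move=> [n _ Hn]; exists n.+1 => //; exists n => //=.
  by move=> [N _ [n _ Hn]]; exists n.
have mF N : measurable (\bigcup_(n < N) hit 0 n : set space).
  by apply: fin_bigcup_measurable => [|k _]; [exact: finite_II|exact: hit0_measurable].
apply: nondecreasing_cvg_mu => //; first by apply: bigcup_measurable.
move=> M N MN; apply/subsetPset => z [n nM Hn]; exists n => //=.
exact: leq_trans MN.
Qed.

Lemma hitp_equation n : 2 * A n.+1 =
  (if n == 0%N then 1 - p else 0) + (1 + 2 * p) * convolution A A n -
  p * convolution (convolution (convolution A A) A) A n.
Proof.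
rewrite /A (hitp_rec).
have -> : convolution (pairp) (hitp) n =
    (1 - p) / 2 * convolution A A n -
    p / 2 * convolution (convolution (convolution A A) A) A n.
  have cE (f g : nat -> R) : convolution f g n = \sum_(i < n.+1) f i * g (n - i)%N by [].
  rewrite !cE !mulr_sumr -sumrB; apply: eq_bigr => i _.
  have := pairp_rec i.
  rewrite -/A => h.
  have -> : pairp i = (1 - p) / 2 * A i - p / 2 * convolution (convolution A A) A i by lra.
  by rewrite /A; ring.
by case: ifP => _; rewrite /A; lra.
Qed.

Lemma reached_probability :
  P (\bigcup_n hit 0 n) = (if p <= 1 / 4 then 1 else (Num.sqrt p)^-1 - 1)%:E.
Proof.
rewrite prE; last exact: reached_measurable.
congr EFin; apply: (@limit_value R p A p01) => //.
- by case=> [|n] //=; exact: pr_ge0.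
- case=> [|N]; first by rewrite /psum big_ord0 ler01.
  rewrite psum_hitp; apply: pr_le1.
  by apply: fin_bigcup_measurable => [|k _]; [exact: finite_II|exact: hit0_measurable].
- exact: hitp_equation.
- exact: psum_hitp_cvg.
Qed.

End Model.

(** * From the model to the sequence space, and almost sure well-posedness *)

Section BallisticModel.
Context (R : realType) (dT : measure_display) (T : measurableType dT)
  (P : probability T R) (m : probability (measurableTypeR R) R) (p : R)
  (x v s : nat -> {RV P >-> R}).
Hypothesis m_pos : m [set r | 0 < r] = 1%E.
Hypothesis model : ballistic_model m p x v s.
Local Notation space := (g_sigma_algebraType (generated (@entry R label) setT)).

Definition data (k : label) (w : T) : R :=
  match k with
  | inl (inl n) => gap (x ^~ w) n
  | inl (inr n) => v n w
  | inr n => s n w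
  end.

Lemma gap_measurable n : measurable_fun setT (fun w => gap (x ^~ w) n).
Proof. by case: n => [|n] //=; apply: measurable_funB. Qed.

Lemma data_measurable k : measurable_fun setT (data k).
Proof. by case: k => [[n|n]|n] //=; exact: gap_measurable. Qed.

Definition sample (w : T) : space := data ^~ w.

Lemma sample_measurable : measurable_fun setT sample.
Proof. by apply: space_measurable => k; exact: data_measurable. Qed.

HB.instance Definition _ := isMeasurableFun.Build _ _ _ _ sample sample_measurable.

Definition law : probability space R := distribution P sample.

Lemma sigma_of_cylinder (X : nat -> T -> R) (J : seq nat) (B : nat -> set R) :
  (forall n, measurable (B n)) ->
  sigma_of X (\bigcap_(n in [set` J]) X n @^-1` B n).
Proof.
move=> mB; rewrite bigcap_seq.
apply: (@bigsetI_measurable _ (g_sigma_algebraType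
  (\bigcup_n preimage_set_system setT (X n) measurable))) => n _.
by apply: sub_sigma_algebra; exists n => //; exists (B n); rewrite ?setTI.
Qed.

(** Independence of the three sequences splits a cylinder by kind of label; independence within each
    sequence factorises the pieces. *)
Lemma data_independent : independent_family P data.
Proof.
move=> J B uJ mB.
pose Jg := pmap (fun k : label => if k is inl (inl n) then Some n else None) J.
pose Jv := pmap (fun k : label => if k is inl (inr n) then Some n else None) J.
pose Js := pmap (fun k : label => if k is inr n then Some n else None) J.
have inJg n : (n \in Jg) = (gap_label n \in J).
  rewrite mem_pmap; apply/mapP/idP => [[[[k|k]|k] kJ] // [->//]|nJ].
  by exists (gap_label n).
have inJv n : (n \in Jv) = (vel_label n \in J).
  rewrite mem_pmap; apply/mapP/idP => [[[[k|k]|k] kJ] // [->//]|nJ].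
  by exists (vel_label n).
have inJs n : (n \in Js) = (spin_label n \in J).
  rewrite mem_pmap; apply/mapP/idP => [[[[k|k]|k] kJ] // [->//]|nJ].
  by exists (spin_label n).
have ug : uniq Jg by apply: (pmap_uniq (g := gap_label)) uJ => -[[k|k]|k].
have uv : uniq Jv by apply: (pmap_uniq (g := vel_label)) uJ => -[[k|k]|k].
have us : uniq Js by apply: (pmap_uniq (g := spin_label)) uJ => -[[k|k]|k].
have pJ : perm_eq J (map gap_label Jg ++ map vel_label Jv ++ map spin_label Js).
  apply: uniq_perm => //.
    rewrite !cat_uniq !map_inj_uniq ?ug ?uv ?us /=; [|by move=> ? ? []..].
    rewrite andbT; apply/andP; split.
      apply/hasPn => k; rewrite mem_cat => /orP[]/mapP[n _ ->];
        by apply/mapP => -[].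
    by apply/hasPn => k /mapP[n _ ->]; apply/mapP => -[].
  move=> k; rewrite !mem_cat; apply/idP/idP.
    by case: k => [[n|n]|n] kJ; rewrite ?(map_f gap_label) ?(map_f vel_label)
      ?(map_f spin_label) ?orbT ?inJg ?inJv ?inJs.
  by move=> /or3P[]/mapP[n]; rewrite ?inJg ?inJv ?inJs => nJ ->.
rewrite (perm_big _ pJ) !big_cat !big_map /=.
have -> : cylinder data J B =
    (\bigcap_(n in [set` Jg]) (fun w => gap (x ^~ w) n) @^-1` B (gap_label n)) `&`
    (\bigcap_(n in [set` Jv]) (fun w => v n w) @^-1` B (vel_label n)) `&`
    (\bigcap_(n in [set` Js]) (fun w => s n w) @^-1` B (spin_label n)).
  apply/seteqP; split=> w.
    by move=> h; split; [split|] => n /=; rewrite ?inJg ?inJv ?inJs => nJ; exact: (h _ nJ).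
  move=> [[hg hv] hs] [[n|n]|n] /= nJ; [apply: (hg n)|apply: (hv n)|apply: (hs n)] => /=;
    by rewrite ?inJg ?inJv ?inJs.
rewrite (gap_velocity_spin_indep model); last 3 first.
- exact: (@sigma_of_cylinder (fun n w => gap (x ^~ w) n) Jg (fun n => B (gap_label n)) (fun n => mB (gap_label n))).
- exact: (@sigma_of_cylinder (fun n w => v n w) Jv (fun n => B (vel_label n)) (fun n => mB (vel_label n))).
- exact: (@sigma_of_cylinder (fun n w => s n w) Js (fun n => B (spin_label n)) (fun n => mB (spin_label n))).
rewrite (gap_indep model ug (fun n => mB (gap_label n))).
rewrite (velocity_indep model uv (fun n => mB (vel_label n))).
by rewrite (spin_indep model us (fun n => mB (spin_label n))) muleA.
Qed.

Lemma law_independent : independent_family law (@entry R label).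
Proof. exact: data_independent. Qed.

Lemma reached_law : 0 <= p <= 1 ->
  P (sample @^-1` \bigcup_n hit 0 n) =
  (if p <= 1 / 4 then 1 else (Num.sqrt p)^-1 - 1)%:E.
Proof.
move=> p01; rewrite -[LHS]/(law (\bigcup_n hit 0 n)).
apply: (@reached_probability R law p m law_independent) => //.
- by move=> n B mB; have := gap_law model n mB.
- by move=> n; have := velocity_law model n.
- by move=> n; have := spin_law model n.
Qed.

Lemma ae_of_probability1 (E : set T) : measurable E -> P E = 1%E ->
  {ae P, forall w, E w}.
Proof.
move=> mE PE; exists (~` E); split; first exact: measurableC.
  by rewrite probability_setC // PE subee.
by [].
Qed.

Let mdata k (B : set R) : measurable B -> measurable (data k @^-1` B).
Proof.
by move=> mB; rewrite -[X in measurable X]setTI; exact: data_measurable.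
Qed.

Lemma ae_gap_gt0 : {ae P, forall w, forall n, 0 < gap (x ^~ w) n}.
Proof.
apply: ae_foralln => n; have m0 : measurable [set r : R | 0 < r].
  by rewrite (_ : [set _ | _] = `]0, +oo[%classic) //; apply/seteqP; split=> r;
    rewrite /= in_itv /= andbT.
apply: ae_of_probability1; first exact: (mdata (gap_label n) m0).
by have := gap_law model n m0 => ->.
Qed.

Let probabilityU (E F : set T) : measurable E -> measurable F -> E `&` F = set0 ->
  P (E `|` F) = (P E + P F)%E.
Proof. exact: measureU. Qed.

Lemma ae_velocity : {ae P, forall w, forall n, [\/ v n w = -1, v n w = 0 | v n w = 1]}.
Proof.
apply: ae_foralln => n; have [v0 vN v1] := velocity_law model n.
have m1 (r : R) : measurable [set w | v n w = r].
  exact: (mdata (vel_label n) (measurable_set1 r)).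
pose E := ([set w | v n w = -1] `|` [set w | v n w = 0]) `|` [set w | v n w = 1].
have mE : measurable E by do 2![apply: measurableU => //].
have PE : P E = 1%E.
  rewrite /E probabilityU //; last 2 first.
  - exact: measurableU.
  - by apply/seteqP; split=> w //= [[->|->]]; lra.
  rewrite probabilityU //; last by apply/seteqP; split=> w //= [->]; lra.
  by rewrite vN v0 v1 -!EFinD; congr EFin; lra.
apply: filterS (ae_of_probability1 mE PE) => w.
by case=> [[]|]; [exact: Or31|exact: Or32|exact: Or33].
Qed.

Lemma ae_spin : {ae P, forall w, forall n, s n w = -1 \/ s n w = 1}.
Proof.
apply: ae_foralln => n; have [sN s1] := spin_law model n.
have m1 (r : R) : measurable [set w | s n w = r].
  exact: (mdata (spin_label n) (measurable_set1 r)).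
apply: (@ae_of_probability1 ([set w | s n w = -1] `|` [set w | s n w = 1])).
  exact: measurableU.
rewrite probabilityU //; last by apply/seteqP; split=> w //= [->]; lra.
by rewrite sN s1 -EFinD; congr EFin; lra.
Qed.

(** Otherwise [r < 1 / (k + 1)] would have full measure for every [k], and [0 < r] would be
    negligible. *)
Lemma m_tail : exists2 e, 0 < e & (m [set r | (r < e)%R] < 1)%E.
Proof.
apply: contrapT => nE.
have m_lt (e : R) : measurable [set r : R | r < e].
  by rewrite (_ : [set _ | _] = `]-oo, e[%classic) //; apply/seteqP; split=> r;
    rewrite /= in_itv.
have m1 k : m (~` [set r | r < k.+1%:R^-1]) = 0%E.
  have mk : m [set r | r < k.+1%:R^-1] = 1%E.
    apply/eqP; rewrite eq_le; apply/andP; split; first by apply: probability_le1; exact: m_lt.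
    by rewrite leNgt; apply/negP => h; apply: nE; exists k.+1%:R^-1.
  transitivity (1 - m [set r : R | (r < k.+1%:R^-1)%R])%E; last by rewrite mk subee.
  exact: (probability_setC m (m_lt _)).
have : m.-negligible (\bigcup_k ~` [set r : R | r < k.+1%:R^-1]).
  apply: negligible_bigcup => k.
  have mC : measurable (~` [set r : R | r < k.+1%:R^-1]) by exact: measurableC (m_lt _).
  exact/(negligibleP m mC)/m1.
have mU : measurable (\bigcup_k ~` [set r : R | r < k.+1%:R^-1]).
  by apply: bigcup_measurable => k _; exact: measurableC.
move=> /(negligibleP m mU) mU0.
have : (m [set r : R | (0 < r)%R] <= m (\bigcup_k ~` [set r : R | (r < k.+1%:R^-1)%R]))%E.
  apply: le_measure; rewrite ?inE //.
    rewrite (_ : [set _ | _] = `]0, +oo[%classic) //; apply/seteqP; split=> r;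
    by rewrite /= in_itv /= andbT.
  move=> r /= r0; have [k] := ltr_add_invr r0; rewrite add0r => kr.
  by exists k => //=; apply/negP; rewrite -leNgt ltW.
by rewrite mU0 m_pos lee_fin ler10.
Qed.

(** The [M] gaps from index [N] on are all below [e] with probability [q ^+ M], which tends to 0. *)
Lemma ae_gap_large : exists2 e, 0 < e &
  {ae P, forall w, forall N, exists2 n, (N <= n)%N & e <= gap (x ^~ w) n}.
Proof.
have [e e0 me] := m_tail; exists e => //; apply: ae_foralln => N.
have m_lt : measurable [set r : R | r < e].
  by rewrite (_ : [set _ | _] = `]-oo, e[%classic) //; apply/seteqP; split=> r;
    rewrite /= in_itv.
pose E M := \bigcap_(n in [set` iota N M]) ((fun w => gap (x ^~ w) n) @^-1` [set r | r < e]).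
have mE M : measurable (E M).
  rewrite /E bigcap_seq; apply: bigsetI_measurable => n _.
  exact: (mdata (gap_label n) m_lt).
set q := fine (m [set r | r < e]).
have mq : m [set r | r < e] = q%:E by rewrite /q fineK ?fin_num_measure.
have q01 : 0 <= q < 1 by rewrite fine_ge0 //= -lte_fin -mq.
have prodq M N' : (\prod_(n <- iota N' M) q%:E = (q ^+ M)%:E :> \bar R)%E.
  elim: M N' => [|M IH] N'; first by rewrite big_nil expr0.
  by rewrite big_cons IH -EFinM exprS.
have PE M : P (E M) = (q ^+ M)%:E.
  rewrite /E (gap_indep model (iota_uniq N M) (fun=> m_lt)).
  rewrite (eq_bigr (fun=> q%:E)); last by move=> n _; rewrite -mq; exact: (gap_law model n m_lt).
  exact: prodq.
exists (\bigcap_M E M); split.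
- exact: bigcap_measurable.
- apply/eqP; rewrite eq_le measure_ge0 andbT.
  have PEM M : (P (\bigcap_M E M) <= (q ^+ M)%:E)%E.
    rewrite -PE; apply: le_measure; rewrite ?inE //; first exact: bigcap_measurable.
    by move=> w; apply.
  have : (fun M => (q ^+ M)%:E) @ \oo --> (0 : R)%:E.
    apply: cvg_EFin; first by near=> M.
    by apply: cvg_expr; rewrite ger0_norm; case/andP: q01.
  move=> qM; rewrite (_ : 0%E = limn (fun M => (q ^+ M)%:E)); last first.
    by apply/esym/cvg_lim.
  apply: lime_ge.
    by apply/cvg_ex; eexists; exact: qM.
  by near=> M; exact: PEM.
- move=> w /= nw M _ n /=; rewrite mem_iota => /andP[Nn _].
  rewrite ltNge; apply/negP => en; apply: nw; by exists n.
Unshelve. all: by end_near.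
Qed.

Lemma ae_well_posed : {ae P, forall w, well_posed (x ^~ w) (v ^~ w) (s ^~ w)}.
Proof.
have [e e0 big] := ae_gap_large.
near=> w.
have g0 : forall n, 0 < gap (x ^~ w) n by near: w; exact: ae_gap_gt0.
have large : forall N, exists2 n, (N <= n)%N & e <= gap (x ^~ w) n by near: w.
split => //; [|by near: w; exact: ae_velocity|by near: w; exact: ae_spin].
have xS n : x n w < x n.+1 w by have := g0 n.+1; rewrite /gap subr_gt0.
have x_mono i j : (i <= j)%N -> x i w <= x j w.
  elim: j => [|j IH]; first by rewrite leqn0 => /eqP->.
  by rewrite leq_eqVlt => /predU1P[->//|/IH h]; apply: le_trans h (ltW (xS j)).
have x0 : 0 < x 0%N w by exact: (g0 0%N).
have grow k : exists n, k%:R * e <= x n w.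
  elim: k => [|k [n IH]]; first by exists 0%N; rewrite mul0r ltW.
  have [[|j] nj ej] := large n.+1; first by [].
  exists j.+1; rewrite -natr1 mulrDl mul1r.
  move: ej; rewrite /gap => ej; have := x_mono n j nj; lra.
apply/cvgryPgt => M; have [n nM] := grow (Num.bound (`|M| / e)).
near=> k; apply: lt_le_trans (x_mono n k _); last by near: k; exact: nbhs_infty_ge.
apply: lt_le_trans nM; rewrite -ltr_pdivrMr //.
apply: le_lt_trans (archi_boundP _); last by rewrite divr_ge0 // ltW.
by rewrite ler_pM2r ?invr_gt0 // ler_norm.
Unshelve. all: by end_near.
Qed.

Lemma sample_config w : well_posed (x ^~ w) (v ^~ w) (s ^~ w) ->
  [/\ pos (sample w) = x ^~ w, vel (sample w) = v ^~ w & spin (sample w) = s ^~ w].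
Proof.
move=> [g0 _ vP sP]; split; apply/funext => n.
- elim: n => [|n IH].
    by rewrite /pos big_ord1 /sample /data /= /to_gap (g0 0%N).
  by rewrite posS IH /sample /data /= /to_gap (g0 n.+1) /gap addrC subrK.
- rewrite /vel /sample /data /to_vel /=; case: (vP n) => ->; rewrite ?eqxx ?orbT //.
  by case: ifP.
- rewrite /spin /sample /data /to_spin /=; case: (sP n) => ->.
    by rewrite oppr_lt0 ltr01.
  by rewrite ltr10.
Qed.

Definition well_posed_event : set T :=
  [set w | well_posed (x ^~ w) (v ^~ w) (s ^~ w)].

Lemma well_posed_event_measurable : measurable well_posed_event.
Proof.
have m_gt k : measurable [set r : R | k < r].
  by rewrite (_ : [set _ | _] = `]k, +oo[%classic) //; apply/seteqP; split=> r;
    rewrite /= in_itv /= andbT.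
have m1 k (r : R) : measurable [set w | data k w = r].
  exact: (mdata k (measurable_set1 r)).
(* Since the points increase, divergence means exceeding every integer at some index, a countable
   condition. *)
have -> : well_posed_event =
    \bigcap_n [set w | 0 < gap (x ^~ w) n] `&`
    (\bigcap_M \bigcup_n [set w | M%:R < x n w]) `&`
    \bigcap_n (([set w | v n w = -1] `|` [set w | v n w = 0]) `|` [set w | v n w = 1]) `&`
    \bigcap_n ([set w | s n w = -1] `|` [set w | s n w = 1]).
  apply/seteqP; split=> w.
    move=> [g0 xoo vP sP]; split; [split; [split|]|] => n _ /=.
    - exact: g0.
    - move/cvgryPgt: xoo => /(_ n%:R)[N _ NP]; exists N => //=; exact: (NP N (leqnn N)).
    - by case: (vP n) => h; [left; left|left; right|right].
    - exact: sP.
  move=> [[[g0 xoo] vP] sP]; split.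
  - by move=> n; exact: (g0 n).
  - have xS n : x n w < x n.+1 w by have := g0 n.+1 I; rewrite /= subr_gt0.
    have x_mono i j : (i <= j)%N -> x i w <= x j w.
      elim: j => [|j IH]; first by rewrite leqn0 => /eqP->.
      by rewrite leq_eqVlt => /predU1P[->//|/IH h]; apply: le_trans h (ltW (xS j)).
    apply/cvgryPgt => M; have [n _ /= nM] := xoo (Num.bound `|M|) I.
    near=> k; apply: lt_le_trans (x_mono n k _); last by near: k; exact: nbhs_infty_ge.
    apply: lt_trans nM; apply: le_lt_trans (archi_boundP _) => //; exact: ler_norm.
  - by move=> n; have := vP n I; case=> [[]|]; [exact: Or31|exact: Or32|exact: Or33].
  - by move=> n; exact: (sP n).
apply: measurableI; [apply: measurableI; [apply: measurableI|]|];
  apply: bigcapT_measurable => n.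
- exact: (mdata (gap_label n) (m_gt 0)).
- apply: bigcup_measurable => k _.
  have mx : measurable_fun setT (x k) by exact: measurable_funPT.
  by have := mx measurableT _ (m_gt n%:R); rewrite setTI.
- by apply: measurableU; [apply: measurableU|]; exact: (m1 (vel_label n)).
- by apply: measurableU; exact: (m1 (spin_label n)).
Unshelve. all: by end_near.
Qed.

(** The equality holds everywhere, not just almost surely, because [zero_reached] contains
    well-posedness, on which truncation changes nothing. Measurability thus needs no completeness of
    the space. *)
Lemma zero_reached_eventE :
  zero_reached_event x v s = well_posed_event `&` sample @^-1` \bigcup_n hit 0 n.
Proof.
apply/seteqP; split=> w.
  move=> zr; have [wp _] := zr; split => //.
  have [/(_ zr)[n Hn] _] := zero_reachedP wp; exists n => //.
  by rewrite /hit /=; have [-> -> ->] := sample_config wp.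
move=> [wp [n _ Hn]]; apply/(zero_reachedP wp); exists n.
by move: Hn; rewrite /hit /=; have [-> -> ->] := sample_config wp.
Qed.

End BallisticModel.

Theorem theorem1 (R : realType) (dT : measure_display) (T : measurableType dT)
    (P : probability T R) (m : probability (measurableTypeR R) R) (p : R)
    (x v s : nat -> {RV P >-> R})
    (p01 : 0 <= p <= 1)
    (m_pos : m [set r | 0 < r] = 1%E)
    (model : ballistic_model m p x v s) :
  measurable (zero_reached_event x v s) /\
  P (zero_reached_event x v s) =
    (if p <= 1 / 4 then 1 else (Num.sqrt p)^-1 - 1)%:E.
Proof.
have mW := well_posed_event_measurable x v s.
have mH : measurable (sample x v s @^-1` \bigcup_n hit 0 n).
  rewrite -[X in measurable X]setTI; apply: sample_measurable => //.
  exact: reached_measurable.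
rewrite zero_reached_eventE; split; first exact: measurableI.
rewrite -(reached_law model p01); apply/eqP; rewrite eq_le; apply/andP; split.
  exact: measureIr.
have [N [mN PN WN]] := ae_well_posed m_pos model.
have mC : measurable (~` N) by exact: measurableC.
(* The arrival event is split along the null set [N], which contains the ill-posed
   configurations. *)
rewrite (measureDI P mH mC) -[leRHS]add0e leeD //.
  rewrite -PN; apply: le_measure; rewrite ?inE //; first exact: measurableD.
  by move=> w [_ /contrapT].
apply: le_measure; rewrite ?inE; [exact: measurableI|exact: measurableI|].
by move=> w [Hw nN]; split => //; apply: contrapT => /WN.
Qed.
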